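(* (Heisenberg's uncertainty inequality for the CFrWT) Let $n\ge1$ and let $\alpha,\beta\in\mathbb{R}$ be such that none of $\alpha$, $\beta$, $\alpha-\beta$ is an integer multiple of $\pi$. Let $\psi$ be a wavelet (with respect to $\alpha$), let $f\in L^2(\mathbb{R}^n)$, and let $(W_{\psi,\alpha}f)(b,a)$ be the CFrWT of $f$. Then $$\left(\int_{\mathbb{R}_0^n}\int_{\mathbb{R}^n}\|t\|^2\left|(\mathfrak{F}_{\beta,b}\{(W_{\psi,\alpha}f)(b,a)\})(t)\right|^2dt\,\frac{da}{|a|^2_{p}}\right)\left(\int_{\mathbb{R}^n}\|\xi\|^2|(\mathfrak{F}_{\alpha}f)(\xi)|^2\,d\xi\right)\geq\frac{n^2C_{\psi,\alpha}}{4|C_{\alpha}|^2}\,|\sin(\alpha-\beta)|^2\,\|f\|^4_{L^2(\mathbb{R}^n)} .$$ (The factors on the left are allowed to equal $+\infty$.)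
   Context: For $x,y\in\mathbb{R}^n$: $\|x\|$ is the Euclidean norm, $\langle x,y\rangle$ the Euclidean inner product, $|x|_p=|x_1x_2\cdots x_n|$, and $\mathbb{R}_0^n=\{x\in\mathbb{R}^n:|x|_p\ne 0\}$. For $y\in\mathbb{R}^n_0$, $\frac{x}{y}=(x_1/y_1,\dots,x_n/y_n)$. $\langle f,g\rangle_{L^2(\mathbb{R}^n)}=\int_{\mathbb{R}^n} f\overline{g}$. For $\alpha\in\mathbb{R}\setminus\pi\mathbb{Z}$ let $C_\alpha=\left(\frac{1-i\cot\alpha}{2\pi}\right)^{n/2}$ (principal branch) and $K_\alpha(t,\xi)=C_\alpha e^{\frac{i}{2}(\|t\|^2+\|\xi\|^2)\cot\alpha-i\langle t,\xi\rangle\csc\alpha}$. The fractional Fourier transform (FrFT) of $f\in L^1(\mathbb{R}^n)$ is $(\mathfrak{F}_\alpha f)(\xi)=\int_{\mathbb{R}^n}f(t)K_\alpha(t,\xi)\,dt$. For $f\in L^2(\mathbb{R}^n)$, $\mathfrak{F}_\alpha f\in L^2(\mathbb{R}^n)$ is the $L^2$-limit of $\mathfrak{F}_\alpha f_k$ for any sequence $f_k\in L^1\cap L^2$ converging to $f$ in $L^2(\mathbb{R}^n)$. For $\psi\in L^2(\mathbb{R}^n)$, $a\in\mathbb{R}^n_0$, $b\in\mathbb{R}^n$: $\psi_{a,b,\alpha}(t)=\frac{1}{\sqrt{|a|_p}}\psi\left(\frac{t-b}{a}\right)e^{-\frac{i}{2}(\|t\|^2-\|b\|^2)\cot\alpha}$.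 A non-zero $\psi\in L^2(\mathbb{R}^n)$ is a wavelet (wavelet admissible) if $\int_{\mathbb{R}_0^n}\int_{\mathbb{R}^n}|\langle\psi_{a,b,\alpha},\psi\rangle_{L^2(\mathbb{R}^n)}|^2\frac{db\,da}{|a|_p^2}<\infty$. The continuous fractional wavelet transform (CFrWT) of $f$ with respect to $\psi$ is $(W_{\psi,\alpha}f)(b,a)=\int_{\mathbb{R}^n}f(t)\overline{\psi_{a,b,\alpha}(t)}\,dt$, $(b,a)\in\mathbb{R}^n\times\mathbb{R}_0^n$. $C_{\psi,\alpha}=\int_{\mathbb{R}_{0}^n}\left|\left(\mathfrak{F}_\alpha\left\{e^{-\frac{i}{2}\|\cdot\|^2\cot\alpha}\psi(\cdot)\right\}\right)(u)\right|^2\frac{1}{|u|_{p}}\,du$. $\mathfrak{F}_{\beta,b}\{(W_{\psi,\alpha}f)(b,a)\}$ denotes the FrFT with parameter $\beta$ taken in the variable $b$, i.e. of the function $b\mapsto(W_{\psi,\alpha}f)(b,a)$, which lies in $L^2(\mathbb{R}^n)$ for almost every $a$. *)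

(* Defs.v *)
From HB Require Import structures.
From mathcomp Require Import all_boot all_order all_algebra.
From mathcomp Require Import all_classical all_reals all_analysis.
From mathcomp Require Import complex.
Set Implicit Arguments.
Unset Strict Implicit.
Unset Printing Implicit Defensive.
Import Order.TTheory GRing.Theory Num.Theory.
Import numFieldNormedType.Exports.
Import ComplexField.Normc.

Local Open Scope classical_set_scope.
Local Open Scope ring_scope.
Local Open Scope complex_scope.

(* R^n with its Borel sigma-algebra *)
Notation Rn R n := (n.-tuple (measurableTypeR R)).

(* Lebesgue measure on R^n.+1: image under (x, t) |-> x :: t of the product of
   the one-dimensional Lebesgue measure with mu. *)
Section lebesgue_cons.
Context {R : realType} {n : nat}.
Variable mu : {sigma_finite_measure set (Rn R n) -> \bar R}.

Definition tcons (p : measurableTypeR R * Rn R n) : Rn R n.+1 :=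
  [tuple of p.1 :: p.2].

Lemma measurable_tcons : measurable_fun setT tcons.
Proof. exact: measurable_cons. Qed.

Definition lebesgue_cons : set (Rn R n.+1) -> \bar R :=
  pushforward (@lebesgue_measure R \x mu)%E tcons.

Let image_measure : {measure set (Rn R n.+1) -> \bar R} :=
  measure_function_pushforward__canonical__measure_function_Measure
    (@lebesgue_measure R \x mu)%E measurable_tcons.

HB.instance Definition _ := isMeasure.Build _ _ _ lebesgue_cons
  (measure0 image_measure) (measure_ge0 image_measure)
  (@measure_semi_sigma_additive _ _ _ image_measure).

Lemma lebesgue_consE (A : set (measurableTypeR R)) (B : set (Rn R n)) :
  measurable A -> measurable B ->
  lebesgue_cons [set t | A (thead t) /\ B [tuple of behead t]] =
  (lebesgue_measure A * mu B)%E.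
Proof.
move=> mA mB; rewrite -product_measure1E//; congr product_measure1.
apply/seteqP; split => -[x t] /=; rewrite theadE.
  move=> [Ax Bt]; split => //=.
  by rewrite (_ : t = [tuple of behead (tcons (x, t))])//; exact: val_inj.
move=> [/= Ax Bt]; split => //.
by rewrite (_ : [tuple of _] = t)//; exact: val_inj.
Qed.

Lemma lebesgue_cons_sigma_finite : sigma_finite setT lebesgue_cons.
Proof.
have /sigma_finiteP[F [TF ndF Foo]] := sigma_finiteT (@lebesgue_measure R).
have /sigma_finiteP[G [TG ndG Goo]] := sigma_finiteT mu.
exists (fun k => [set t | F k (thead t) /\ G k [tuple of behead t]]).
  apply/seteqP; split => // t _.
  have [i _ Fi] : (\bigcup_i F i) (thead t) by rewrite -TF.
  have [j _ Gj] : (\bigcup_i G i) [tuple of behead t] by rewrite -TG.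
  exists (maxn i j) => //; split.
    by move: Fi; exact/subsetPset/ndF/leq_maxl.
  by move: Gj; exact/subsetPset/ndG/leq_maxr.
move=> k; have [mF Fk] := Foo k; have [mG Gk] := Goo k; split.
  apply: measurableI.
    by rewrite -[X in measurable X]setTI; exact: measurable_tnth.
  by rewrite -[X in measurable X]setTI; exact: measurable_behead.
by rewrite lebesgue_consE// lte_mul_pinfty// ge0_fin_numE.
Qed.

HB.instance Definition _ :=
  Measure_isSigmaFinite.Build _ _ _ lebesgue_cons lebesgue_cons_sigma_finite.

End lebesgue_cons.

Fixpoint lebesgue (R : realType) (n : nat) :
    {sigma_finite_measure set (Rn R n) -> \bar R} :=
  match n return {sigma_finite_measure set (Rn R n) -> \bar R} with
  | 0 => \d_ [tuple]
  | n'.+1 => lebesgue_cons (lebesgue R n')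
  end.

Lemma lebesgue_box (R : realType) (n : nat)
    (A : 'I_n -> set (measurableTypeR R)) :
  (forall i, measurable (A i)) ->
  lebesgue R n [set t | forall i, A i (tnth t i)] =
  (\big[*%E/1]_(i < n) lebesgue_measure (A i))%E.
Proof.
elim: n A => [|n IHn] A mA.
  by rewrite big_ord0 /= diracE mem_set//; case.
have mB : measurable [set t : Rn R n | forall i, A (lift ord0 i) (tnth t i)].
  rewrite [X in measurable X](_ : _ =
      \big[setI/setT]_(i < n) (@tnth n R ^~ i) @^-1` A (lift ord0 i)).
    apply: bigsetI_measurable => i _.
    by rewrite -[X in measurable X]setTI; exact: measurable_tnth.
  rewrite -bigcap_seq; apply/seteqP; split => [t At i _|t At i].
    exact: At.
  by apply: (At i) => /=; rewrite mem_index_enum.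
rewrite big_ord_recl -IHn// -lebesgue_consE//=; congr lebesgue_cons.
have tnth_lift (t : Rn R n.+1) i :
    tnth t (lift ord0 i) = tnth [tuple of behead t] i.
  by rewrite [in LHS](tuple_eta t) tnthS.
apply/seteqP; split => t /=.
  by move=> At; split => [|i]; [exact: At|rewrite -tnth_lift; exact: At].
move=> [A0 At] i; case: (unliftP ord0 i) => [j ->|->]; last exact: A0.
by rewrite tnth_lift; exact: At.
Qed.

Section vectors.
Context {R : realType} {n : nat}.
Implicit Types x y : Rn R n.

Definition dotp x y : R := \sum_(i < n) (tnth x i : R) * (tnth y i : R).
Definition enorm x : R := Num.sqrt (\sum_(i < n) (tnth x i : R) ^+ 2).
Definition absp x : R := `|\prod_(i < n) (tnth x i : R)|.
Definition subv x y : Rn R n := [tuple (tnth x i : R) - (tnth y i : R) | i < n].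
Definition divv x y : Rn R n := [tuple (tnth x i : R) / (tnth y i : R) | i < n].

End vectors.

Definition R0 (R : realType) (n : nat) : set (Rn R n) := [set a | absp a != 0].
Arguments R0 : clear implicits.

Section complex_functions.
Context {R : realType}.

(* e^{i x} *)
Definition expi (x : R) : R[i] := cos x +i* sin x.

(* Principal argument of z != 0, with values in ]-pi, pi]. *)
Definition Carg (z : R[i]) : R :=
  let theta := acos (complex.Re z / normc z) in
  if 0 <= complex.Im z then theta else - theta.

(* Principal branch of z^s, for z != 0. *)
Definition cpow (z : R[i]) (s : R) : R[i] :=
  (normc z `^ s)%:C * expi (s * Carg z).

Definition cot (x : R) : R := cos x / sin x.
Definition csc (x : R) : R := (sin x)^-1.

Context {n : nat}.
Local Notation mu := (lebesgue R n).
Implicit Types f g : Rn R n -> R[i].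

Definition cmeasurable f :=
  measurable_fun setT (@complex.Re R \o f) /\
  measurable_fun setT (@complex.Im R \o f).

Definition cintegral f : R[i] :=
  (\int[mu]_x complex.Re (f x))%R +i* (\int[mu]_x complex.Im (f x))%R.

Definition cLnorm (p : \bar R) f : \bar R := 'N[mu]_p[EFin \o @normc R \o f].

Definition cLp (p : \bar R) f := cmeasurable f /\ (cLnorm p f < +oo)%E.

Definition inner f g : R[i] := cintegral (fun x => f x * (g x)^*).

End complex_functions.

Section frft.
Context {R : realType} {n : nat}.
Implicit Types f g : Rn R n -> R[i].

Definition frft_const (alpha : R) : R[i] :=
  cpow ((1 -i* cot alpha) / (2 * pi)%:C) (n%:R / 2).

Definition frft_kernel (alpha : R) (t xi : Rn R n) : R[i] :=
  frft_const alpha *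
  expi ((enorm t ^+ 2 + enorm xi ^+ 2) / 2 * cot alpha - dotp t xi * csc alpha).

Definition frft_L1 (alpha : R) f : Rn R n -> R[i] :=
  fun xi => cintegral (fun t => f t * frft_kernel alpha t xi).

Definition is_frft (alpha : R) f g :=
  cLp 2%:E g /\
  forall f_ : nat -> Rn R n -> R[i],
    (forall k, cLp 1%:E (f_ k) /\ cLp 2%:E (f_ k)) ->
    cLnorm 2%:E (f_ k \- f) @[k --> \oo] --> 0%E ->
    cLnorm 2%:E (frft_L1 alpha (f_ k) \- g) @[k --> \oo] --> 0%E.

(* For f in L^2, a representative of the class of the FrFT of f, which is
   unique up to equality almost everywhere. *)
Definition frft (alpha : R) f : Rn R n -> R[i] :=
  xget (fun=> 0) [set g | is_frft alpha f g].

End frft.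
Arguments frft_const {R} n alpha.

Section frwt.
Context {R : realType} {n : nat}.
Local Notation mu := (lebesgue R n).
Implicit Types f psi : Rn R n -> R[i].

(* psi_{a,b,alpha} *)
Definition daughter (alpha : R) psi (a b : Rn R n) : Rn R n -> R[i] :=
  fun t => ((Num.sqrt (absp a))^-1)%:C * psi (divv (subv t b) a) *
           expi (- ((enorm t ^+ 2 - enorm b ^+ 2) / 2 * cot alpha)).

Definition wavelet (alpha : R) psi :=
  [/\ cLp 2%:E psi, cLnorm 2%:E psi != 0%E &
      (\int[mu]_(a in R0 R n)
        ((\int[mu]_b ((normc (inner (daughter alpha psi a b) psi)) ^+ 2)%:E) *
         ((absp a) ^- 2)%:E) < +oo)%E].

Definition cfrwt (alpha : R) psi f (b a : Rn R n) : R[i] :=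
  inner f (daughter alpha psi a b).

Definition frwt_const (alpha : R) psi : \bar R :=
  (\int[mu]_(u in R0 R n)
    ((normc (frft alpha
       (fun t => expi (- (enorm t ^+ 2 / 2 * cot alpha)) * psi t) u)) ^+ 2 /
     absp u)%:E)%E.

End frwt.

(* Main.v *)
Require Import Defs.
From mathcomp Require Import all_boot all_order all_algebra.
From mathcomp Require Import all_classical all_reals all_analysis.
From mathcomp Require Import measurable_realfun complex ring lra.
Import Order.TTheory GRing.Theory Num.Theory.
Import numFieldNormedType.Exports.
Import ComplexField.Normc.
Set Implicit Arguments.
Unset Strict Implicit.
Unset Printing Implicit Defensive.
Local Open Scope classical_set_scope.
Local Open Scope ring_scope.
Local Open Scope complex_scope.

(** Heisenberg's inequality for the fractional wavelet transform [W].

    Put [A = F_alpha f] and [Psi = F_alpha (e^{-i |t|^2 cot alpha / 2} psi)]. Each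
    daughter wavelet is a dilate and translate of [psi] with chirps which make its
    transform of angle [alpha] a phase times [|a|^{1/2} Psi (a xi)]
    ([frel_daughter]). By Parseval's identity [W f (b, a)] is then, up to the
    constant [conj C_alpha], the transform of angle [- alpha] of
    [H_a (xi) = |a|^{1/2} A (xi) conj (Psi (a xi))] times a phase ([cfrwtE]). Hence
    [F_alpha (W f (., a))] is [H_a / conj C_alpha], and since the integral of
    [|Psi (a xi)|^2 / |a|_p] over [a] is the constant [C_psi] for almost every [xi],
    Tonelli's theorem gives
    - the integral of [|W f (., a)|^2] against [da / |a|_p^2] is
      [C_psi / |C_alpha|^2 * |f|^2] ([wavelet_energy]);
    - that of the dispersions of [F_alpha (W f (., a))] is [C_psi / |C_alpha|^2]
      times the dispersion of [F_alpha f] ([dispersion_spectrum]).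

    For one square-integrable [g], the dispersions of [F_alpha g] and [F_beta g]
    satisfy an uncertainty inequality with constant [|sin (alpha - beta)|]
    ([coordinate_uncertainty]). It comes from two unitary groups: the phase space
    shifts which [F_alpha], respectively [F_beta], turns into multiplication by
    [e^{i r xi_j}]. They commute up to the phase [e^{i r s sin (alpha - beta)}], and
    the moments bound how far they move [g]; comparing at second order gives the
    inequality for all [g] in L2. Applied to [g = W f (., a)] in the additive form
    [uncertainty_sum], integrated over [a] ([integrated_uncertainty]) and optimised
    over the free parameter ([product_of_sums]), it yields the theorem. Where one
    factor is infinite the other has to be nonzero, which holds because a function
    whose transform has dispersion 0 vanishes. The dispersion of
    [F_beta (W f (., a))] is a sum of suprema of difference quotients of shifts
    ([moment_sup]), hence measurable in [a].

    The theory of the transform rests on Plancherel's identity, which is proved for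
    every integrable function with values in [0, +oo]. On the line, a Fejer weight
    reduces both inequalities to the convolution with a triangle: Schur's test gives
    one ([fourier_energy_le]), almost everywhere convergence at Lebesgue points the
    other ([fourier_energy_ge]), and the constant [2 pi] is read off from the
    one-sided exponential ([plancherel_const]). Chirps turn this into the identity
    for the fractional transform, and induction on the dimension into
    [frft_L1_energy]. On L2 the transform is handled through the closure [frel] of
    its graph; adjointness of the angles [alpha] and [- alpha] gives inversion
    ([frel_inversion]) and Parseval's identity ([frel_parseval]). *)

(** * Integration of complex-valued functions *)

(** Complex conjugation, with a monomorphic type: the overloaded conjugations
    are convertible to it but not syntactically equal to one another. *)
Definition cconj {R : realType} (z : R[i]) : R[i] := conjc z.

Section complex_components.
Context {R : realType}.
Implicit Types x y z : R[i].

Lemma ReD x y : complex.Re (x + y) = complex.Re x + complex.Re y.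
Proof. by case: x; case: y. Qed.
Lemma ImD x y : complex.Im (x + y) = complex.Im x + complex.Im y.
Proof. by case: x; case: y. Qed.
Lemma ReN x : complex.Re (- x) = - complex.Re x.
Proof. by case: x. Qed.
Lemma ImN x : complex.Im (- x) = - complex.Im x.
Proof. by case: x. Qed.
Lemma ReM x y :
  complex.Re (x * y) = complex.Re x * complex.Re y - complex.Im x * complex.Im y.
Proof. by case: x; case: y. Qed.
Lemma ImM x y :
  complex.Im (x * y) = complex.Re x * complex.Im y + complex.Im x * complex.Re y.
Proof. by case: x; case: y. Qed.
Lemma ReJ x : complex.Re (cconj x) = complex.Re x.
Proof. by case: x. Qed.
Lemma ImJ x : complex.Im (cconj x) = - complex.Im x.
Proof. by case: x. Qed.

Lemma complexP x y :
  complex.Re x = complex.Re y -> complex.Im x = complex.Im y -> x = y.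
Proof. by case: x; case: y => /= ? ? ? ? -> ->. Qed.

Lemma conjM x y : cconj (x * y) = cconj x * cconj y.
Proof. by apply: complexP; rewrite ?ReM ?ImM !(ReJ, ImJ) ?ReM ?ImM; ring. Qed.
Lemma conjD x y : cconj (x + y) = cconj x + cconj y.
Proof. by apply: complexP; rewrite ?ReD ?ImD !(ReJ, ImJ) ?ReD ?ImD; ring. Qed.
Lemma conjN x : cconj (- x) = - cconj x.
Proof. by apply: complexP; rewrite ?ReN ?ImN !(ReJ, ImJ) ?ReN ?ImN. Qed.
Lemma cconjK x : cconj (cconj x) = x.
Proof. by apply: complexP; rewrite !(ReJ, ImJ) ?opprK. Qed.
Lemma conj_real (r : R) : cconj (r%:C) = r%:C.
Proof. by apply: complexP; rewrite !(ReJ, ImJ) //= oppr0. Qed.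

Lemma realcM (a b : R) : (a * b)%:C = a%:C * b%:C.
Proof. by apply: complexP; rewrite ?ReM ?ImM /=; ring. Qed.

Lemma normc2E x : normc x ^+ 2 = complex.Re x ^+ 2 + complex.Im x ^+ 2.
Proof. by case: x => a b /=; rewrite sqr_sqrtr// addr_ge0// sqr_ge0. Qed.

Lemma normc_ge0 x : 0 <= normc x.
Proof. by case: x => a b; exact: sqrtr_ge0. Qed.

Lemma normcN x : normc (- x) = normc x.
Proof. by case: x => a b /=; rewrite !sqrrN. Qed.

Lemma normcJ x : normc (cconj x) = normc x.
Proof. by case: x => a b /=; rewrite sqrrN. Qed.

Lemma normc_eq0 x : (normc x == 0) = (x == 0).
Proof.
by apply/eqP/eqP => [/eq0_normc//|->]; rewrite normc0.
Qed.

Lemma normc_zero : normc (0 : R[i]) = 0.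
Proof. by apply/eqP; rewrite normc_eq0. Qed.

Lemma normc_real (r : R) : normc (r%:C) = `|r|.
Proof. by rewrite /= expr0n /= addr0 sqrtr_sqr. Qed.

Lemma mulcJ x : x * cconj x = (normc x ^+ 2)%:C.
Proof.
by apply: complexP; rewrite ?ReM ?ImM ReJ ImJ /= ?normc2E; ring.
Qed.

Lemma sqr_inj_ge0 (a b : R) : 0 <= a -> 0 <= b -> a ^+ 2 = b ^+ 2 -> a = b.
Proof. by move=> a0 b0 /eqP; rewrite eqrXn2// => /eqP. Qed.

Lemma normc_expi (t : R) : normc (expi t) = 1.
Proof. by rewrite /= cos2Dsin2 sqrtr1. Qed.

Lemma expiD (s t : R) : expi (s + t) = expi s * expi t.
Proof.
apply: complexP; rewrite ?ReM ?ImM /=; first exact: cosD.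
by rewrite sinD addrC.
Qed.

Lemma expi0 : expi 0 = 1 :> R[i].
Proof. by rewrite /expi cos0 sin0. Qed.

Lemma conj_expi (t : R) : cconj (expi t) = expi (- t).
Proof. by rewrite /expi cosN sinN. Qed.

Lemma le_Re_normc x : `|complex.Re x| <= normc x.
Proof.
rewrite -(@ler_pXn2r _ 2) ?nnegrE ?normc_ge0// normc2E real_normK ?num_real//.
by rewrite lerDl sqr_ge0.
Qed.

Lemma le_Im_normc x : `|complex.Im x| <= normc x.
Proof.
rewrite -(@ler_pXn2r _ 2) ?nnegrE ?normc_ge0// normc2E real_normK ?num_real//.
by rewrite lerDr sqr_ge0.
Qed.

(** Cauchy-Schwarz in the plane. *)
Lemma dot_le_normc x y :
  complex.Re x * complex.Re y + complex.Im x * complex.Im y <= normc x * normc y.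
Proof.
have -> : complex.Re x * complex.Re y + complex.Im x * complex.Im y =
    complex.Re (x * cconj y) by rewrite ReM ReJ ImJ; ring.
apply: (le_trans (ler_norm _)); apply: (le_trans (le_Re_normc _)).
by rewrite normcM normcJ.
Qed.

Lemma normcD2 x y : normc (x + y) ^+ 2 <= 2 * normc x ^+ 2 + 2 * normc y ^+ 2.
Proof.
rewrite !normc2E ReD ImD.
by have := sqr_ge0 (complex.Re x - complex.Re y);
   have := sqr_ge0 (complex.Im x - complex.Im y); nra.
Qed.

End complex_components.

Section cmeas.
Context d (T : measurableType d) {R : realType}.
Implicit Types f g : T -> R[i].

Definition cmeas f := measurable_fun setT (fun x => complex.Re (f x)) /\
  measurable_fun setT (fun x => complex.Im (f x)).

Lemma cmeas_cst c : cmeas (fun=> c).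
Proof. by split; exact: measurable_cst. Qed.

Lemma cmeasD f g : cmeas f -> cmeas g -> cmeas (fun x => f x + g x).
Proof.
move=> [fR fI] [gR gI]; split.
  by under eq_fun do rewrite ReD; exact: measurable_funD.
by under eq_fun do rewrite ImD; exact: measurable_funD.
Qed.

Lemma cmeasN f : cmeas f -> cmeas (fun x => - f x).
Proof.
move=> [fR fI]; split.
  by under eq_fun do rewrite ReN; exact: measurableT_comp.
by under eq_fun do rewrite ImN; exact: measurableT_comp.
Qed.

Lemma cmeasB f g : cmeas f -> cmeas g -> cmeas (fun x => f x - g x).
Proof. by move=> mf mg; apply: cmeasD => //; exact: cmeasN. Qed.

Lemma cmeasM f g : cmeas f -> cmeas g -> cmeas (fun x => f x * g x).
Proof.
move=> [fR fI] [gR gI]; split.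
  under eq_fun do rewrite ReM; apply: measurable_funB; exact: measurable_funM.
by under eq_fun do rewrite ImM; apply: measurable_funD; exact: measurable_funM.
Qed.

Lemma cmeasJ f : cmeas f -> cmeas (fun x => cconj (f x)).
Proof.
move=> [fR fI]; split.
  by under eq_fun do rewrite ReJ.
by under eq_fun do rewrite ImJ; exact: measurableT_comp.
Qed.

Lemma cmeas_real (h : T -> R) : measurable_fun setT h ->
  cmeas (fun x => (h x)%:C).
Proof. by move=> mh; split => //=; exact: measurable_cst. Qed.

Lemma cmeas_expi (h : T -> R) : measurable_fun setT h ->
  cmeas (fun x => expi (h x)).
Proof.
by move=> mh; split => /=; apply: measurableT_comp => //;
  apply: continuous_measurable_fun; [exact: continuous_cos|exact: continuous_sin].
Qed.

Lemma measurable_normc2 f : cmeas f ->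
  measurable_fun setT (fun x => normc (f x) ^+ 2).
Proof.
move=> [fR fI]; under eq_fun do rewrite normc2E.
by apply: measurable_funD; exact: measurable_funX.
Qed.

Lemma measurable_normc f : cmeas f -> measurable_fun setT (fun x => normc (f x)).
Proof.
move=> mf; rewrite (_ : (fun _ => _) = fun x => (normc (f x) ^+ 2) `^ 2^-1).
  by apply: (measurableT_comp (measurable_powR _)); exact: measurable_normc2.
apply/funext => x.
by rewrite powR12_sqrt ?sqr_ge0// sqrtr_sqr ger0_norm// normc_ge0.
Qed.

End cmeas.

Lemma cmeas_comp d1 d2 (T1 : measurableType d1) (T2 : measurableType d2)
  (R : realType) (h : T1 -> T2) (f : T2 -> R[i]) :
  measurable_fun setT h -> cmeas f -> cmeas (fun x => f (h x)).
Proof.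
by move=> mh [fR fI]; split; [exact: (measurableT_comp fR mh)|exact: (measurableT_comp fI mh)].
Qed.

Section cint.
Context d (T : measurableType d) {R : realType}.
Variable mu : {measure set T -> \bar R}.
Implicit Types f g : T -> R[i].

Definition cint f : R[i] := (\int[mu]_x complex.Re (f x))%R +i*
  (\int[mu]_x complex.Im (f x))%R.

Definition cintegrable f :=
  cmeas f /\ (\int[mu]_x (normc (f x))%:E < +oo)%E.

Lemma eq_cint f g : f =1 g -> cint f = cint g.
Proof. by move=> /funext ->. Qed.

Lemma cintegrable_Re f : cintegrable f ->
  mu.-integrable setT (fun x => (complex.Re (f x))%:E).
Proof.
move=> [mf fi]; apply/integrableP; split; first exact/measurable_EFinP/mf.1.
apply: le_lt_trans fi; apply: ge0_le_integral => //=.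
- by apply/measurable_EFinP/measurableT_comp => //; exact: mf.1.
- exact/measurable_EFinP/measurable_normc.
- by move=> x _; rewrite lee_fin le_Re_normc.
Qed.

Lemma cintegrable_Im f : cintegrable f ->
  mu.-integrable setT (fun x => (complex.Im (f x))%:E).
Proof.
move=> [mf fi]; apply/integrableP; split; first exact/measurable_EFinP/mf.2.
apply: le_lt_trans fi; apply: ge0_le_integral => //=.
- by apply/measurable_EFinP/measurableT_comp => //; exact: mf.2.
- exact/measurable_EFinP/measurable_normc.
- by move=> x _; rewrite lee_fin le_Im_normc.
Qed.

Lemma cintegrable_normc f : cintegrable f ->
  mu.-integrable setT (fun x => (normc (f x))%:E).
Proof.
move=> [mf fi]; apply/integrableP; split.
  exact/measurable_EFinP/measurable_normc.
under eq_integral do rewrite gee0_abs ?lee_fin ?normc_ge0//.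
exact: fi.
Qed.

Lemma le_cintegrable f (h : T -> R) : cmeas f -> (forall x, normc (f x) <= h x) ->
  measurable_fun setT h -> (\int[mu]_x (h x)%:E < +oo)%E -> cintegrable f.
Proof.
move=> mf fh mh hi; split => //; apply: le_lt_trans hi.
apply: ge0_le_integral => //=.
- by move=> x _; rewrite lee_fin normc_ge0.
- exact/measurable_EFinP/measurable_normc.
- exact/measurable_EFinP.
- by move=> x _; rewrite lee_fin.
Qed.

Lemma cintegrableD f g : cintegrable f -> cintegrable g ->
  cintegrable (fun x => f x + g x).
Proof.
move=> [mf fi] [mg gi].
apply: (@le_cintegrable _ (fun x => normc (f x) + normc (g x))).
- exact: cmeasD.
- by move=> x; exact: le_normcD.
- by apply: measurable_funD; exact: measurable_normc.
under eq_integral do rewrite EFinD.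
rewrite ge0_integralD//.
- exact: lte_add_pinfty.
- by move=> x _; rewrite lee_fin normc_ge0.
- exact/measurable_EFinP/measurable_normc.
- by move=> x _; rewrite lee_fin normc_ge0.
- exact/measurable_EFinP/measurable_normc.
Qed.

Lemma cintegrableZl c f : cintegrable f -> cintegrable (fun x => c * f x).
Proof.
move=> [mf fi]; split; first by apply: cmeasM => //; exact: cmeas_cst.
under eq_integral do rewrite normcM EFinM.
rewrite ge0_integralZl_EFin ?normc_ge0//.
- by rewrite lte_mul_pinfty ?lee_fin ?normc_ge0.
- by move=> x _; rewrite lee_fin normc_ge0.
- exact/measurable_EFinP/measurable_normc.
Qed.

Lemma cintegrableJ f : cintegrable f -> cintegrable (fun x => cconj (f x)).
Proof.
by move=> [mf fi]; split; [exact: cmeasJ|under eq_integral do rewrite normcJ].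
Qed.

Lemma cintegrableN f : cintegrable f -> cintegrable (fun x => - f x).
Proof.
by move=> [mf fi]; split; [exact: cmeasN|under eq_integral do rewrite normcN].
Qed.

Lemma cintD f g : cintegrable f -> cintegrable g ->
  cint (fun x => f x + g x) = cint f + cint g.
Proof.
move=> fi gi; apply: complexP => /=.
- under eq_Rintegral do rewrite ReD.
  by rewrite RintegralD//; exact: cintegrable_Re.
- under eq_Rintegral do rewrite ImD.
  by rewrite RintegralD//; exact: cintegrable_Im.
Qed.

Lemma cintZl c f : cintegrable f -> cint (fun x => c * f x) = c * cint f.
Proof.
move=> fi; have fR := cintegrable_Re fi; have fI := cintegrable_Im fi.
have Z (r : R) (h : T -> R) : mu.-integrable setT (fun x => (h x)%:E) ->
  mu.-integrable setT (fun x => (r * h x)%:E).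
  by move=> hi; under eq_fun do rewrite EFinM; exact: integrableZl.
apply: complexP; rewrite ?ReM ?ImM /=.
- under eq_Rintegral do rewrite ReM.
  by rewrite RintegralB ?RintegralZl//; exact: Z.
- under eq_Rintegral do rewrite ImM.
  by rewrite RintegralD ?RintegralZl//; exact: Z.
Qed.

Lemma cintN f : cintegrable f -> cint (fun x => - f x) = - cint f.
Proof.
move=> fi; under eq_cint do rewrite -mulN1r.
by rewrite cintZl// mulN1r.
Qed.

Lemma cintB f g : cintegrable f -> cintegrable g ->
  cint (fun x => f x - g x) = cint f - cint g.
Proof. by move=> fi gi; rewrite cintD ?cintN//; exact: cintegrableN. Qed.

Lemma cintJ f : cintegrable f -> cint (fun x => cconj (f x)) = cconj (cint f).
Proof.
move=> fi; apply: complexP; rewrite ?ReJ ?ImJ /=.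
- by under eq_Rintegral do rewrite ReJ.
- under eq_Rintegral do rewrite ImJ -mulN1r.
  by rewrite RintegralZl ?mulN1r//; exact: cintegrable_Im.
Qed.

(** [|I|^2] is the integral of the inner product of the vectors [f x] and
    [I = cint f], which is at most [|f x| |I|]; then divide by [|I|]. *)
Lemma le_normc_cint f : cmeas f ->
  ((normc (cint f))%:E <= \int[mu]_x (normc (f x))%:E)%E.
Proof.
move=> mf; have [fi|] := ltP (\int[mu]_x (normc (f x))%:E)%E +oo%E; last first.
  by rewrite leye_eq => /eqP ->; exact: leey.
have {mf} {}fi : cintegrable f by [].
set I := cint f.
have fR := cintegrable_Re fi; have fI := cintegrable_Im fi.
have fn := cintegrable_normc fi.
have [I0|I0] := eqVneq I 0.
  by rewrite I0 normc0; apply: integral_ge0 => x _; rewrite lee_fin normc_ge0.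
have nI0 : 0 < normc I by rewrite lt0r normc_ge0 normc_eq0 I0.
rewrite -[leRHS]fineK ?integrable_fin_num// lee_fin -(ler_pM2l nI0).
have Z (r : R) (h : T -> R) : mu.-integrable setT (fun x => (h x)%:E) ->
  mu.-integrable setT (fun x => (r * h x)%:E).
  by move=> hi; under eq_fun do rewrite EFinM; exact: integrableZl.
rewrite -expr2 normc2E !expr2.
rewrite -[X in _ * X + _]/(\int[mu]_x complex.Re (f x)).
rewrite -[X in _ + _ * X]/(\int[mu]_x complex.Im (f x)).
rewrite -[X in _ <= _ * X]/(\int[mu]_x normc (f x)).
rewrite -!RintegralZl// -RintegralD//; try exact: Z.
apply: le_Rintegral => //.
- exact: (integrableD measurableT (Z _ _ fR) (Z _ _ fI)).
- exact: Z.
- by move=> x _; exact: dot_le_normc.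
Qed.

End cint.

(** * Iterated integrals and affine substitutions *)

Section param.
Context d1 d2 (T1 : measurableType d1) (T2 : measurableType d2) {R : realType}.
Variable m1 : {sigma_finite_measure set T1 -> \bar R}.
Variable m2 : {sigma_finite_measure set T2 -> \bar R}.

Lemma measurable_Rintegral_param (f : T1 * T2 -> R) : measurable_fun setT f ->
  measurable_fun setT (fun x => \int[m2]_y f (x, y)).
Proof.
move=> mf; apply: measurableT_comp => //=.
rewrite (_ : (fun _ => _) = (fun x => \int[m2]_y (EFin \o f)^\+ (x, y) -
    \int[m2]_y (EFin \o f)^\- (x, y))%E); last first.
  apply/funext => x; rewrite [LHS]integralE.
  by congr (_ - _)%E; apply: eq_integral => y _; rewrite ?funeposE ?funenegE.
have mEf : measurable_fun setT (EFin \o f) by exact/measurable_EFinP.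
apply: emeasurable_funB.
- apply: (@measurable_fun_fubini_tonelli_F _ _ _ _ _ m2 (EFin \o f)^\+%E) => //.
  exact: measurable_funepos.
- apply: (@measurable_fun_fubini_tonelli_F _ _ _ _ _ m2 (EFin \o f)^\-%E) => //.
  exact: measurable_funeneg.
Qed.

(** The inner integrals may be infinite on a null set, where [fine] makes them 0;
    hence the two comparisons almost everywhere. *)
Lemma Rfubini (f : T1 * T2 -> R) :
  (m1 \x m2)%E.-integrable setT (EFin \o f) ->
  \int[m1]_x \int[m2]_y f (x, y) = \int[m2]_y \int[m1]_x f (x, y).
Proof.
move=> fi.
have mf : measurable_fun setT f by apply/measurable_EFinP; exact: measurable_int fi.
have F1 := integrable_fubini_F fi.
have F2 := measurable_fubini_G fi.
have fub := Fubini fi.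
rewrite /Rintegral; congr fine; transitivity (\int[m1]_x fubini_F m2 (EFin \o f) x)%E.
  apply: ae_eq_integral => //.
  - exact/measurable_EFinP/(measurable_Rintegral_param mf).
  - exact: measurable_int F1.
  - have := integrable_ae measurableT F1; apply: filterS => x /(_ I) xfin _.
    by rewrite fineK.
transitivity (\int[m2]_x fubini_G m1 (EFin \o f) x)%E; first exact: fub.
apply: ae_eq_integral => //.
- apply/measurable_EFinP; apply: measurableT_comp => //=.
- have := ae_integrable2 fi; apply: filterS => x xi _.
  by rewrite fineK//; exact: (integrable_fin_num measurableT xi).
Qed.

Lemma cmeas_param (F : T1 * T2 -> R[i]) : cmeas F ->
  cmeas (fun x => cint m2 (fun y => F (x, y))).
Proof.
by move=> [FR FI]; split => /=;
  [exact: (measurable_Rintegral_param FR)|exact: (measurable_Rintegral_param FI)].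
Qed.

Lemma cmeas_pair1 (F : T1 * T2 -> R[i]) x : cmeas F -> cmeas (fun y => F (x, y)).
Proof. by move=> mF; exact: (cmeas_comp (pair1_measurable x) mF). Qed.

Lemma cmeas_pair2 (F : T1 * T2 -> R[i]) y : cmeas F -> cmeas (fun x => F (x, y)).
Proof. by move=> mF; exact: (cmeas_comp (pair2_measurable y) mF). Qed.

Lemma cintegrable_param (F : T1 * T2 -> R[i]) : cmeas F ->
  (\int[m1]_x \int[m2]_y (normc (F (x, y)))%:E < +oo)%E ->
  cintegrable m1 (fun x => cint m2 (fun y => F (x, y))).
Proof.
move=> mF Fi; split; first exact: cmeas_param.
apply: le_lt_trans Fi; apply: ge0_le_integral => //.
- by move=> x _; rewrite lee_fin normc_ge0.
- exact/measurable_EFinP/measurable_normc/cmeas_param.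
- apply: (@measurable_fun_fubini_tonelli_F _ _ _ _ _ m2
    (fun p => (normc (F p))%:E)) => //.
  + exact/measurable_EFinP/measurable_normc.
  + by move=> p; rewrite lee_fin normc_ge0.
- by move=> x _; apply: le_normc_cint; exact: cmeas_pair1.
Qed.

Lemma cfubini (F : T1 * T2 -> R[i]) : cmeas F ->
  (\int[m1]_x \int[m2]_y (normc (F (x, y)))%:E < +oo)%E ->
  cint m1 (fun x => cint m2 (fun y => F (x, y))) =
  cint m2 (fun y => cint m1 (fun x => F (x, y))).
Proof.
move=> mF Fi; have Fn : cintegrable (m1 \x m2)%E F.
  split => //; rewrite fubini_tonelli1//.
    exact/measurable_EFinP/measurable_normc.
  by move=> p; rewrite lee_fin normc_ge0.
apply: complexP => /=.
- by rewrite (@Rfubini (fun p => complex.Re (F p)))//; exact: cintegrable_Re Fn.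
- by rewrite (@Rfubini (fun p => complex.Im (F p)))//; exact: cintegrable_Im Fn.
Qed.

Lemma tonelli (f : T1 * T2 -> \bar R) : measurable_fun setT f ->
  (forall p, 0 <= f p)%E ->
  (\int[m1]_x \int[m2]_y f (x, y) = \int[m2]_y \int[m1]_x f (x, y))%E.
Proof. by move=> mf f0; apply: fubini_tonelli. Qed.

End param.

Section lebesgue_rec.
Context {R : realType} {n : nat}.

Lemma ge0_integral_tcons (F : Rn R n.+1 -> \bar R) : measurable_fun setT F ->
  (forall t, 0 <= F t)%E ->
  (\int[lebesgue R n.+1]_t F t =
   \int[@lebesgue_measure R]_x \int[lebesgue R n]_y F (tcons (x, y)))%E.
Proof.
move=> mF F0.
have mT := @measurable_tcons R n.
transitivity (\int[pushforward (@lebesgue_measure R \x lebesgue R n)%E (@tcons R n)]_t F t)%E.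
  by [].
rewrite ge0_integral_pushforward//= fubini_tonelli1//.
exact: measurableT_comp.
Qed.

End lebesgue_rec.

Section affine1.
Context {R : realType}.
Local Notation mu1 := (@lebesgue_measure R).

(** Lebesgue measure is determined by its values on intervals, and
    [x |-> a x + b] scales those by [|a|]. *)
Lemma ge0_integral_affine (g : measurableTypeR R -> \bar R) (a b : R) : a != 0 ->
  measurable_fun setT g -> (forall x, 0 <= g x)%E ->
  (\int[mu1]_x g x = `|a|%:E * \int[mu1]_x g (a * x + b)%R)%E.
Proof.
move=> a0 mg g0.
pose phi (x : measurableTypeR R) : measurableTypeR R := a * x + b.
have mphi : measurable_fun setT phi.
  by apply: measurable_funD => //; exact: measurable_funM.
pose c : {nonneg R} := NngNum (normr_ge0 a).
pose nu : {measure set (measurableTypeR R) -> \bar R} :=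
  measure_function_pushforward__canonical__measure_function_Measure mu1 mphi.
have E A : measurable A -> mu1 A = mscale c nu A.
  move=> mA; apply: lebesgue_measure_unique => //= _ [[u v] _ <-].
  rewrite /mscale/= /nu/= /pushforward.
  have [a1|a1|a1] := ltgtP a 0; last by rewrite a1 eqxx in a0.
  - rewrite (_ : phi @^-1` _ = `[(v - b) / a, (u - b) / a[%classic); last first.
      apply/seteqP; split => x /=; rewrite !in_itv/= /phi.
        move=> /andP[h1 h2]; rewrite ler_ndivrMr// ltr_ndivlMr//; apply/andP; split; lra.
      move=> /andP[]; rewrite ler_ndivrMr// ltr_ndivlMr// => h1 h2; apply/andP; split; lra.
    rewrite !lebesgue_measure_itv/= !lte_fin ltr_nM2r ?invr_lt0// ltrD2r.
    case: ifPn => uv; last by rewrite mule0.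
    rewrite -EFinB -EFinB -EFinM; congr EFin.
    by rewrite ltr0_norm//; field.
  - rewrite (_ : phi @^-1` _ = `](u - b) / a, (v - b) / a]%classic); last first.
      apply/seteqP; split => x /=; rewrite !in_itv/= /phi.
        move=> /andP[h1 h2]; rewrite ltr_pdivrMr// ler_pdivlMr//; apply/andP; split; lra.
      move=> /andP[]; rewrite ltr_pdivrMr// ler_pdivlMr// => h1 h2; apply/andP; split; lra.
    rewrite !lebesgue_measure_itv/= !lte_fin ltr_pM2r ?invr_gt0// ltrD2r.
    case: ifPn => uv; last by rewrite mule0.
    rewrite -EFinB -EFinB -EFinM; congr EFin.
    by rewrite gtr0_norm//; field.
transitivity (\int[mscale c nu]_x g x)%E.
  by apply: eq_measure_integral => A mA _; exact: E.
rewrite ge0_integral_mscale//; congr (_ * _)%E.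
by rewrite /nu/= ge0_integral_pushforward.
Qed.

End affine1.

(** * The chord of the unit circle *)

Section chord.
Context {R : realType}.
Implicit Types x y u : R.

(** Half a chord is a sine, and a sine is compared to its argument by the mean
    value theorem; this gives both bounds on the chord below. *)
Lemma sin_mvt x : exists2 c, `|c| <= `|x| & sin x = x * cos c.
Proof.
wlog x0 : x / 0 <= x.
  move=> H; have [x0|x0] := leP 0 x; first exact: H.
  have [|c cx cE] := H (- x); first by rewrite oppr_ge0 ltW.
  exists c; first by rewrite normrN in cx.
  by apply: oppr_inj; rewrite -sinN cE mulNr.
have [c] := MVT_segment x0 (fun z _ => is_derive_sin z)
  (continuous_subspaceT (@continuous_sin R)).
rewrite in_itv/= => /andP[c0 cx]; rewrite sin0 !subr0 => E.
by exists c; [rewrite !ger0_norm|rewrite E mulrC].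
Qed.

Lemma normc_expiB1 u : normc (expi u - 1) ^+ 2 = 2 * (1 - cos u).
Proof.
rewrite normc2E ReD ImD ReN ImN /=.
have := cos2Dsin2 u; rewrite -/(cos u) -/(sin u) => h.
rewrite oppr0 addr0.
have -> : (cos u + -1) ^+ 2 + sin u ^+ 2 = (cos u ^+ 2 + sin u ^+ 2) + 1 - 2 * cos u by ring.
by rewrite h; ring.
Qed.

Lemma cos_sqr_le1 u : cos u ^+ 2 <= 1.
Proof. by rewrite cos2sin2 lerBlDr lerDl sqr_ge0. Qed.

Lemma cos_half u : cos u = cos (u / 2) ^+ 2 *+ 2 - 1.
Proof. by rewrite -cos_mulr2n mulr2n -splitr. Qed.

Lemma chord_le u : 2 * (1 - cos u) <= u ^+ 2.
Proof.
have [c cu sE] := sin_mvt (u / 2).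
rewrite cos_half cos2sin2 sE.
by have := cos_sqr_le1 c; have := sqr_ge0 u; nra.
Qed.

Lemma chord_ge u : u ^+ 2 * (1 - u ^+ 2 / 4) <= 2 * (1 - cos u).
Proof.
have [c cu sE] := sin_mvt (u / 2).
rewrite cos_half cos2sin2 sE.
have [e ec cE] := sin_mvt c.
have h1 : sin c ^+ 2 <= c ^+ 2.
  by rewrite cE exprMn ler_piMr ?sqr_ge0 ?cos_sqr_le1.
have h2 : c ^+ 2 <= (u / 2) ^+ 2.
  by rewrite -(real_normK (num_real c)) -(real_normK (num_real (u / 2))) lerXn2r ?nnegrE.
have h3 : cos c ^+ 2 >= 1 - (u / 2) ^+ 2 by rewrite cos2sin2; lra.
have -> : 2 * (1 - ((1 - (u / 2 * cos c) ^+ 2) *+ 2 - 1)) = u ^+ 2 * cos c ^+ 2.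
  by field.
rewrite ler_wpM2l ?sqr_ge0//.
by have -> : u ^+ 2 / 4 = (u / 2) ^+ 2 by field.
Qed.

End chord.

Section dirichlet.
Context {R : realType}.
Local Notation mu1 := (@lebesgue_measure R).

Lemma measurable_invr : measurable_fun setT (@GRing.inv R).
Proof.
rewrite -(setUv [set 0 : R]); apply/measurable_funU => //.
  exact: measurableC.
split; first exact: measurable_fun_set1.
apply: open_continuous_measurable_fun; first exact/closed_openC/accessible_closed_set1/hausdorff_accessible/Rhausdorff.
by move=> x /set_mem/= /eqP x0; exact: inv_continuous.
Qed.

Lemma measurable_div d (T : measurableType d) (f g : T -> R) :
  measurable_fun setT f -> measurable_fun setT g ->
  measurable_fun setT (fun x => f x / g x).
Proof.
move=> mf mg; apply: measurable_funM => //.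
exact: (measurableT_comp measurable_invr mg).
Qed.

Lemma integral_oneDsqr : (\int[mu1]_x ((1 + x ^+ 2)^-1)%:E = pi%:E)%E.
Proof.
rewrite (@ge0_symfun_integralT R (fun x => (1 + x ^+ 2)^-1)).
- rewrite -set_itvcy integral0y_oneDsqr -EFinM; congr EFin.
  by field.
- by move=> x; rewrite invr_ge0 addr_ge0// sqr_ge0.
- by move=> x; exact: continuous_oneDsqrV.
- by move=> x /=; rewrite sqrrN.
Qed.

(** The squared slope [|e^{i c x} - 1|^2 / x^2] of the chord. *)
Definition chordq (c x : R) := 2 * (1 - cos (c * x)) / x ^+ 2.

Lemma chordq_ge0 c x : 0 <= chordq c x.
Proof.
by rewrite /chordq mulr_ge0 ?invr_ge0 ?sqr_ge0// mulr_ge0// subr_ge0 cos_le1.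
Qed.

Lemma measurable_chordq c : measurable_fun setT (chordq c).
Proof.
apply: (@measurable_div _ _ (fun x => 2 * (1 - cos (c * x))) (fun x => x ^+ 2)).
  2: exact: measurable_funX.
apply: measurable_funM => //; apply: measurable_funB => //.
apply: measurableT_comp; last exact: measurable_funM.
by apply: continuous_measurable_fun; exact: continuous_cos.
Qed.

(** Near 0 the slope is at most 1, far away it is at most [4 / x^2]. *)
Lemma integral_chordq1_lty : (\int[mu1]_x (chordq 1 x)%:E < +oo)%E.
Proof.
apply: (@le_lt_trans _ _ (\int[mu1]_x (8%:E * ((1 + x ^+ 2)^-1)%:E))%E).
  apply: ge0_le_integral => //.
  - by move=> x _; rewrite lee_fin chordq_ge0.
  - by apply/measurable_EFinP; exact: measurable_chordq.
  - apply/measurable_EFinP/measurable_funM => //.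
    by apply: continuous_measurable_fun => x; exact: continuous_oneDsqrV.
  - move=> x _; rewrite -EFinM lee_fin /chordq mul1r.
    have [->|x0] := eqVneq x 0.
      by rewrite expr0n/= invr0 mulr0 mulr_ge0// invr_ge0 addr_ge0// ?sqr_ge0.
    have x2 : 0 < x ^+ 2 by rewrite exprn_even_gt0.
    rewrite ler_pdivrMr// mulrAC ler_pdivlMr ?ltr_pwDl ?sqr_ge0//.
    by have := chord_le x; have := cos_geN1 x; nra.
rewrite ge0_integralZl_EFin//.
- by rewrite integral_oneDsqr -EFinM ltry.
- by move=> x _; rewrite lee_fin invr_ge0 addr_ge0// sqr_ge0.
- apply/measurable_EFinP.
  by apply: continuous_measurable_fun => x; exact: continuous_oneDsqrV.
Qed.

(** Its product with [tri_mass] is computed in [plancherel_const]. *)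
Definition dirichlet_const : R := \int[mu1]_x chordq 1 x.

(** By homogeneity: [chordq c x = c^2 chordq 1 (c x)]. *)
Lemma integral_chordq c :
  (\int[mu1]_x (chordq c x)%:E = (`|c| * dirichlet_const)%:E)%E.
Proof.
have E1 : (\int[mu1]_x (chordq 1 x)%:E = dirichlet_const%:E)%E.
  rewrite /dirichlet_const /Rintegral fineK// ge0_fin_numE ?integral_chordq1_lty//.
  by apply: integral_ge0 => x _; rewrite lee_fin chordq_ge0.
have [->|c0] := eqVneq c 0.
  rewrite normr0 mul0r integral0_eq// => x _.
  by rewrite /chordq mul0r cos0 subrr mulr0 mul0r.
rewrite EFinM -E1 (@ge0_integral_affine R (fun x => (chordq 1 x)%:E) c 0)//; last 2 first.
- by apply/measurable_EFinP; exact: measurable_chordq.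
- by move=> x; rewrite lee_fin chordq_ge0.
rewrite muleA -EFinM -expr2 -ge0_integralZl_EFin ?sqr_ge0//; last 2 first.
- by move=> x _; rewrite lee_fin chordq_ge0.
- apply/measurable_EFinP; apply: (measurableT_comp (measurable_chordq 1)).
  by apply: measurable_funD => //; exact: measurable_funM.
apply: eq_integral => x _; rewrite -EFinM; congr EFin.
rewrite real_normK ?num_real// /chordq mul1r addr0.
have [->|x0] := eqVneq x 0; first by rewrite mulr0 expr0n/= invr0 !mulr0.
by field; rewrite x0.
Qed.

End dirichlet.
Arguments dirichlet_const : clear implicits.

(** * The Fejer kernel and its Fourier transform *)

(** A substitution formula for nonnegative functions extends to integrable ones.
    It is used for affine maps of the line and of [R^n]. *)
Section change_of_variables.
Context d (T : measurableType d) {R : realType}.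
Variables (mu : {measure set T -> \bar R}) (phi : T -> T) (c : R).
Hypothesis c0 : 0 < c.
Hypothesis mphi : measurable_fun setT phi.
Hypothesis ge0_scale : forall g : T -> \bar R, measurable_fun setT g ->
  (forall x, 0 <= g x)%E -> (\int[mu]_x g x = c%:E * \int[mu]_x g (phi x))%E.

Lemma integrable_scale (g : T -> \bar R) : mu.-integrable setT g ->
  mu.-integrable setT (fun x => g (phi x)).
Proof.
move=> /integrableP[mg gi]; apply/integrableP; split.
  exact: (measurableT_comp mg mphi).
move: gi; rewrite (ge0_scale (g := fun x => `|g x|)%E)//; last first.
  exact: measurableT_comp.
move=> h; rewrite ltNge leye_eq; apply/negP => /eqP h2.
by move: h; rewrite h2 gt0_muley ?lte_fin// ltxx.
Qed.

Lemma integral_scale (g : T -> \bar R) : mu.-integrable setT g ->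
  (\int[mu]_x g x = c%:E * \int[mu]_x g (phi x))%E.
Proof.
move=> gi; have mg := measurable_int _ gi; have ai := integrable_scale gi.
rewrite integralE [in RHS]integralE muleBr//; last first.
  apply: fin_num_adde_defl; rewrite fin_numN.
  exact: integrable_neg_fin_num ai.
congr (_ - _)%E.
  rewrite ge0_scale//; last exact: measurable_funepos.
  by congr (_ * _)%E; apply: eq_integral => x _; rewrite !funeposE.
rewrite ge0_scale//; last exact: measurable_funeneg.
by congr (_ * _)%E; apply: eq_integral => x _; rewrite !funenegE.
Qed.

Lemma cintegrable_scale (g : T -> R[i]) :
  cintegrable mu g -> cintegrable mu (fun x => g (phi x)).
Proof.
move=> gi; split; first exact: (cmeas_comp mphi gi.1).
exact/integrable_lty/(integrable_scale (cintegrable_normc gi)).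
Qed.

Lemma cint_scale (g : T -> R[i]) : cintegrable mu g ->
  cint mu g = c%:C * cint mu (fun x => g (phi x)).
Proof.
move=> gi; have gR := cintegrable_Re gi; have gI := cintegrable_Im gi.
apply: complexP; rewrite ?ReM ?ImM /= mul0r ?subr0 ?addr0.
- rewrite /Rintegral (integral_scale gR) fineM//.
  exact: (integrable_fin_num measurableT (integrable_scale gR)).
- rewrite /Rintegral (integral_scale gI) fineM//.
  exact: (integrable_fin_num measurableT (integrable_scale gI)).
Qed.

End change_of_variables.

Lemma measurable_affine {R : realType} (a b : R) :
  measurable_fun setT (fun x : measurableTypeR R => a * x + b : measurableTypeR R).
Proof. by apply: measurable_funD => //; exact: measurable_funM. Qed.

Lemma integral_affine {R : realType} (g : measurableTypeR R -> \bar R) (a b : R) :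
  a != 0 -> (@lebesgue_measure R).-integrable setT g ->
  (\int[@lebesgue_measure R]_x g x =
   `|a|%:E * \int[@lebesgue_measure R]_x g (a * x + b)%R)%E.
Proof.
move=> a0; apply: integral_scale.
- by rewrite normr_gt0.
- exact: measurable_affine.
- by move=> h mh h0; exact: ge0_integral_affine.
Qed.

Section fejer.
Context {R : realType}.
Local Notation mu1 := (@lebesgue_measure R).

Lemma integrable_chordq (c : R) :
  mu1.-integrable setT (fun x => (chordq c x)%:E).
Proof.
apply/integrableP; split; first by apply/measurable_EFinP; exact: measurable_chordq.
under eq_integral do rewrite gee0_abs ?lee_fin ?chordq_ge0//.
by rewrite integral_chordq ltry.
Qed.

Lemma Rintegral_chordq (c : R) :
  \int[mu1]_x chordq c x = `|c| * dirichlet_const R.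
Proof. by rewrite /Rintegral integral_chordq. Qed.

(** A weight with values in [0, 1] that tends to 1 as [r] tends to 0 and whose
    Fourier transform [D * tri r] is nonnegative and compactly supported. *)
Definition fejer (r x : R) := chordq r x / r ^+ 2.

Lemma fejer_ge0 r x : 0 <= fejer r x.
Proof. by rewrite /fejer divr_ge0 ?chordq_ge0// sqr_ge0. Qed.

Lemma fejer_le1 r x : fejer r x <= 1.
Proof.
rewrite /fejer /chordq -mulrA -invfM -exprMn (mulrC x).
have [h0|h0] := eqVneq (r * x) 0; first by rewrite h0 expr0n/= invr0 mulr0.
by rewrite ler_pdivrMr ?exprn_even_gt0// mul1r chord_le.
Qed.

Lemma fejer_ge r x : r != 0 -> x != 0 -> 1 - (r * x) ^+ 2 / 4 <= fejer r x.
Proof.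
move=> r0 x0; rewrite /fejer /chordq -mulrA -invfM -exprMn (mulrC x).
have h0 : r * x != 0 by rewrite mulf_neq0.
by rewrite ler_pdivlMr ?exprn_even_gt0// [leLHS]mulrC chord_ge.
Qed.

Lemma measurable_fejer r : measurable_fun setT (fejer r).
Proof. by apply: measurable_funM => //; exact: measurable_chordq. Qed.

Lemma integrable_fejer r : mu1.-integrable setT (fun x => (fejer r x)%:E).
Proof.
under eq_fun do rewrite /fejer mulrC EFinM.
by apply: integrableZl => //; exact: integrable_chordq.
Qed.

Lemma cintegrable_fejerM r (h : measurableTypeR R -> R[i]) (M : R) : cmeas h ->
  (forall x, normc (h x) <= M) -> cintegrable mu1 (fun x => (fejer r x)%:C * h x).
Proof.
move=> mh hM; apply: (@le_cintegrable _ _ _ _ _ (fun x : measurableTypeR R => M * fejer r x)).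
- by apply: cmeasM => //; apply: cmeas_real; exact: measurable_fejer.
- move=> x; rewrite normcM normc_real ger0_norm ?fejer_ge0// mulrC.
  by rewrite ler_wpM2r ?fejer_ge0.
- by apply: measurable_funM => //; exact: measurable_fejer.
- have M0 : 0 <= M by apply: le_trans (hM 0); exact: normc_ge0.
  under eq_integral do rewrite EFinM.
  have h1 := integrable_lty measurableT (integrable_fejer r).
  rewrite ge0_integralZl_EFin ?lte_mul_pinfty//.
  + by move=> x _; rewrite lee_fin fejer_ge0.
  + by apply/measurable_EFinP; exact: measurable_fejer.
Qed.

(** The triangle of base [-r, r] and height [1 / r], written as a second
    difference of the absolute value: this is the form in which it comes out of
    [integral_chordq]. *)
Definition tri (r z : R) := (`|z + r| + `|z - r| - 2 * `|z|) / (2 * r ^+ 2).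

Lemma tri_ge0 r z : 0 <= tri r z.
Proof.
apply: divr_ge0; last by rewrite mulr_ge0 ?sqr_ge0.
rewrite subr_ge0; have -> : 2 * `|z| = `|(z + r) + (z - r)|.
  by rewrite (_ : z + r + (z - r) = 2 * z); [rewrite normrM (ger0_norm (ler0n R 2))|ring].
exact: ler_normD.
Qed.

Lemma tri_le r z : 0 < r -> tri r z <= r^-1.
Proof.
move=> r0; rewrite /tri ler_pdivrMr ?mulr_gt0 ?exprn_gt0//.
have -> : r^-1 * (2 * r ^+ 2) = r + r by field; rewrite gt_eqF.
have := ler_normD z r; have := ler_normB z r; rewrite (gtr0_norm r0); lra.
Qed.

Lemma tri_eq0 r z : 0 < r -> r <= `|z| -> tri r z = 0.
Proof.
move=> r0; rewrite /tri; have [z0|z0] := leP 0 z.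
  rewrite ger0_norm// => rz.
  by rewrite !ger0_norm ?subr_ge0 ?addr_ge0// ?(ltW r0)//; rewrite (_ : _ - _ = 0) ?mul0r//; ring.
rewrite ltr0_norm// => rz.
by rewrite !ler0_norm; [rewrite (_ : _ - _ = 0) ?mul0r//; ring|lra|lra].
Qed.

Lemma triN r z : tri r (- z) = tri r z.
Proof.
by rewrite /tri normrN -(normrN (- z + r)) -(normrN (- z - r)) !opprD !opprK (addrC (`|z - r|)).
Qed.

Lemma measurable_tri r : measurable_fun setT (tri r).
Proof.
apply: measurable_funM => //; apply: measurable_funB.
  by apply: measurable_funD; apply: measurableT_comp => //; exact: measurable_funD.
by apply: measurable_funM => //; exact: measurableT_comp.
Qed.

Lemma integral_tri1_lty : (\int[mu1]_x (tri 1 x)%:E < +oo)%E.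
Proof.
apply: (@le_lt_trans _ _ (\int[mu1]_x (\1_`[-1, 1]%classic x)%:E)%E).
  apply: ge0_le_integral => //.
  - by move=> x _; rewrite lee_fin tri_ge0.
  - by apply/measurable_EFinP; exact: measurable_tri.
  - by apply/measurable_EFinP.
  - move=> x _; rewrite lee_fin indicE.
    have [x1|x1] := leP `|x| 1.
      by rewrite mem_set ?(le_trans (tri_le _ _))// ?invr1//= in_itv/= -ler_norml.
    by rewrite tri_eq0// ltW.
rewrite integral_indic// setIT/= lebesgue_measure_itv/=.
by case: ifP => // _; rewrite -EFinB ltry.
Qed.

Definition tri_mass : R := \int[mu1]_x tri 1 x.

Lemma integral_tri r : 0 < r -> (\int[mu1]_x (tri r x)%:E = tri_mass%:E)%E.
Proof.
move=> r0.
have E1 : (\int[mu1]_x (tri 1 x)%:E = tri_mass%:E)%E.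
  rewrite /tri_mass /Rintegral fineK// ge0_fin_numE ?integral_tri1_lty//.
  by apply: integral_ge0 => x _; rewrite lee_fin tri_ge0.
have rn0 : r != 0 by rewrite gt_eqF.
rewrite (@ge0_integral_affine R (fun x => (tri r x)%:E) r 0)//; last 2 first.
- by apply/measurable_EFinP; exact: measurable_tri.
- by move=> x; rewrite lee_fin tri_ge0.
rewrite -E1 -ge0_integralZl_EFin//; last 2 first.
- by move=> x _; rewrite lee_fin tri_ge0.
- apply/measurable_EFinP; apply: (measurableT_comp (measurable_tri r)).
  exact: (measurable_affine r 0).
apply: eq_integral => x _; rewrite -EFinM; congr EFin.
rewrite addr0 /tri (_ : r * x + r = r * (x + 1)); last by ring.
rewrite (_ : r * x - r = r * (x - 1)); last by ring.
by rewrite !normrM (gtr0_norm r0); field.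
Qed.

(** [2 cos (r x) cos (z x) = cos ((z + r) x) + cos ((z - r) x)]. *)
Lemma fejer_cos r z x : fejer r x * cos (z * x) =
  (2^-1 * chordq (z + r) x + 2^-1 * chordq (z - r) x - chordq z x) / r ^+ 2.
Proof.
rewrite /fejer /chordq (mulrDl z r x) (mulrBl x z r) cosD cosB.
by set rr := (r ^+ 2)^-1; set xx := (x ^+ 2)^-1; field.
Qed.

(** The real part follows from [fejer_cos] and [integral_chordq]; the imaginary
    part is the integral of an odd function. *)
Lemma fourier_fejer r z :
  cint mu1 (fun x => (fejer r x)%:C * expi (z * x)) =
  (dirichlet_const R * tri r z)%:C.
Proof.
have mz : measurable_fun setT (fun x : measurableTypeR R => z * x).
  exact: measurable_funM.
have I : cintegrable mu1 (fun x => (fejer r x)%:C * expi (z * x)).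
  by apply: (@cintegrable_fejerM _ _ 1); [exact: cmeas_expi|move=> x; rewrite normc_expi].
have Z (a c : R) : mu1.-integrable setT (fun x => (a * chordq c x)%:E).
  by under eq_fun do rewrite EFinM; apply: integrableZl => //; exact: integrable_chordq.
apply: complexP.
- rewrite /=.
  transitivity (\int[mu1]_x ((r ^+ 2)^-1 *
     ((2^-1 * chordq (z + r) x + 2^-1 * chordq (z - r) x) - chordq z x))).
    by apply: eq_Rintegral => x _; rewrite mul0r subr0 fejer_cos mulrC.
  have i1 : mu1.-integrable setT (fun x => (2^-1 * chordq (z + r) x + 2^-1 * chordq (z - r) x)%:E).
    exact: (integrableD measurableT (Z _ _) (Z _ _)).
  rewrite RintegralZl//; last first.
    exact: (integrableB measurableT i1 (integrable_chordq z)).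
  rewrite RintegralB//; last exact: integrable_chordq.
  rewrite RintegralD//; try exact: Z.
  rewrite !RintegralZl//; try exact: integrable_chordq.
  rewrite !Rintegral_chordq /tri.
  have [->|r0] := eqVneq r 0; first by rewrite expr0n/= mulr0 invr0 mulr0 mul0r mulr0.
  by field.
- rewrite /=; pose h (x : measurableTypeR R) := complex.Im ((fejer r x)%:C * expi (z * x)).
  have hN x : h (-1 * x + 0) = - h x.
    rewrite (_ : -1 * x + 0 = - x); last by rewrite addr0 mulN1r.
    rewrite /h !ImM /= /fejer /chordq.
    rewrite (mulrN z x) (mulrN r x) sinN !cosN sqrrN.
    by rewrite !mul0r !addr0 mulrN.
  have n10 : (-1 : R) != 0 by rewrite oppr_eq0 oner_neq0.
  have hi : mu1.-integrable setT (fun x => (h x)%:E) by exact: cintegrable_Im I.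
  have E : \int[mu1]_x h x = - \int[mu1]_x h x.
    rewrite {1}/Rintegral (integral_affine 0 n10 hi) normrN1 mul1e.
    rewrite -[LHS]/(\int[mu1]_x h (-1 * x + 0)).
    under eq_Rintegral do rewrite hN -mulN1r.
    by rewrite RintegralZl// mulN1r.
  by move/eqP: E; rewrite -addr_eq0 -mulr2n mulrn_eq0 /= => /eqP.
Qed.

End fejer.

(** * Bounded kernels *)

Section tensor.
Context d1 d2 (T1 : measurableType d1) (T2 : measurableType d2) {R : realType}.
Variable m1 : {sigma_finite_measure set T1 -> \bar R}.
Variable m2 : {sigma_finite_measure set T2 -> \bar R}.

Lemma tensor_lty (M : R) (f : T1 -> R[i]) (g : T2 -> R[i]) : 0 <= M ->
  cintegrable m1 f -> cintegrable m2 g ->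
  (\int[m1]_x \int[m2]_y (M * normc (f x) * normc (g y))%:E < +oo)%E.
Proof.
move=> M0 [mf fi] [mg gi].
have g0 : (0 <= \int[m2]_y (normc (g y))%:E)%E.
  by apply: integral_ge0 => y _; rewrite lee_fin normc_ge0.
have gE x : (\int[m2]_y (M * normc (f x) * normc (g y))%:E =
    (M * normc (f x))%:E * \int[m2]_y (normc (g y))%:E)%E.
  under eq_integral do rewrite EFinM.
  rewrite ge0_integralZl_EFin//; first by move=> y _; rewrite lee_fin normc_ge0.
    exact/measurable_EFinP/measurable_normc.
  by rewrite mulr_ge0// normc_ge0.
under eq_integral do rewrite gE.
have -> : (\int[m2]_y (normc (g y))%:E = (fine (\int[m2]_y (normc (g y))%:E))%:E)%E.
  by rewrite fineK// ge0_fin_numE.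
rewrite ge0_integralZr//.
- rewrite lte_mul_pinfty//.
  + by apply: integral_ge0 => x _; rewrite lee_fin mulr_ge0 ?normc_ge0.
  + under eq_integral do rewrite EFinM.
    rewrite ge0_integralZl_EFin//.
    * rewrite ge0_fin_numE ?lte_mul_pinfty//.
      by rewrite mule_ge0// integral_ge0// => x _; rewrite lee_fin normc_ge0.
    * by move=> x _; rewrite lee_fin normc_ge0.
    * exact/measurable_EFinP/measurable_normc.
  + by rewrite ltry.
- by apply/measurable_EFinP/measurable_funM => //; exact: measurable_normc.
- by move=> x _; rewrite lee_fin mulr_ge0// normc_ge0.
- by rewrite lee_fin fine_ge0.
Qed.

Lemma cintegrableM_bounded (M : R) (f k : T1 -> R[i]) :
  0 <= M -> cintegrable m1 f -> cmeas k -> (forall x, normc (k x) <= M) ->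
  cintegrable m1 (fun x => f x * k x).
Proof.
move=> M0 [mf fi] mk kM.
apply: (@le_cintegrable _ _ _ _ _ (fun x => M * normc (f x))).
- exact: cmeasM.
- by move=> y; rewrite normcM mulrC ler_wpM2r// normc_ge0.
- by apply: measurable_funM => //; exact: measurable_normc.
under eq_integral do rewrite EFinM.
rewrite ge0_integralZl_EFin ?lte_mul_pinfty//.
- by move=> y _; rewrite lee_fin normc_ge0.
- exact/measurable_EFinP/measurable_normc.
Qed.

(** The common source of the multiplication formula for the Fourier transform
    and of the adjointness of the fractional transforms. *)
Lemma cint_kernel_adjoint (M : R) (k : T1 * T2 -> R[i]) f g :
  0 <= M -> cmeas k -> (forall p, normc (k p) <= M) ->
  cintegrable m1 f -> cintegrable m2 g ->
  cint m1 (fun x => f x * cint m2 (fun y => k (x, y) * g y)) =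
  cint m2 (fun y => cint m1 (fun x => f x * k (x, y)) * g y).
Proof.
move=> M0 mk kM fi gi; have [mg gi2] := gi.
have mk1 x : cmeas (fun y => k (x, y)) by exact: cmeas_pair1.
have mk2 y : cmeas (fun x => k (x, y)) by exact: cmeas_pair2.
transitivity (cint m1 (fun x => cint m2 (fun y => f x * k (x, y) * g y))).
  apply: eq_cint => x; rewrite -cintZl.
    by apply: eq_cint => y; rewrite mulrA.
  apply: (@le_cintegrable _ _ _ _ _ (fun y => M * normc (g y))).
  - by apply: cmeasM => //; exact: gi.1.
  - by move=> y; rewrite normcM ler_wpM2r// normc_ge0.
  - by apply: measurable_funM => //; apply: measurable_normc; exact: gi.1.
  under eq_integral do rewrite EFinM.
  rewrite ge0_integralZl_EFin ?lte_mul_pinfty//.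
  + by move=> y _; rewrite lee_fin normc_ge0.
  + by apply/measurable_EFinP; apply: measurable_normc; exact: gi.1.
rewrite (@cfubini _ _ _ _ _ m1 m2 (fun p => f p.1 * k p * g p.2)).
- apply: eq_cint => y; rewrite mulrC -cintZl; last exact: (cintegrableM_bounded M0).
  by apply: eq_cint => x; rewrite mulrC.
- apply: cmeasM; last by apply: (cmeas_comp _ gi.1).
  by apply: cmeasM => //; apply: (cmeas_comp _ fi.1).
- apply: le_lt_trans (tensor_lty M0 fi gi).
  have mn : measurable_fun setT (fun p => normc (f p.1 * k p * g p.2)).
    apply: measurable_normc; apply: cmeasM; last by apply: (cmeas_comp _ gi.1).
    by apply: cmeasM => //; apply: (cmeas_comp _ fi.1).
  have mn2 : measurable_fun setT (fun p : T1 * T2 => M * normc (f p.1) * normc (g p.2)).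
    apply: measurable_funM; last by apply: measurable_normc; apply: (cmeas_comp _ gi.1).
    apply: measurable_funM => //.
    by apply: measurable_normc; apply: (cmeas_comp _ fi.1).
  apply: ge0_le_integral => //.
  + by move=> x _; apply: integral_ge0 => y _; rewrite lee_fin normc_ge0.
  + apply: (@measurable_fun_fubini_tonelli_F _ _ _ _ _ m2
      (fun p => (normc (f p.1 * k p * g p.2))%:E)) => //.
      exact/measurable_EFinP.
    by move=> q; rewrite lee_fin normc_ge0.
  + apply: (@measurable_fun_fubini_tonelli_F _ _ _ _ _ m2
      (fun p => (M * normc (f p.1) * normc (g p.2))%:E)) => //.
      exact/measurable_EFinP.
    by move=> q; rewrite lee_fin !mulr_ge0// normc_ge0.
  + move=> x _; apply: ge0_le_integral => //.
    * by move=> y _; rewrite lee_fin normc_ge0.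
    * by apply/measurable_EFinP; exact: (measurableT_comp mn (pair1_measurable x)).
    * by apply/measurable_EFinP; exact: (measurableT_comp mn2 (pair1_measurable x)).
    * move=> y _; rewrite lee_fin !normcM ler_wpM2r ?normc_ge0//.
      by rewrite mulrC ler_wpM2r ?normc_ge0.
Qed.

End tensor.

(** The square of the L2 norm, with values in [0, +oo]: Plancherel's identity
    will be proved for it on all integrable functions. *)
Definition energy d (T : measurableType d) (R : realType)
    (mu : {measure set T -> \bar R}) (f : T -> R[i]) : \bar R :=
  (\int[mu]_x (normc (f x) ^+ 2)%:E)%E.

Lemma measurable_energy d (T : measurableType d) (R : realType) (f : T -> R[i]) :
  cmeas f -> measurable_fun setT (fun x => (normc (f x) ^+ 2)%:E).
Proof. by move=> mf; apply/measurable_EFinP; exact: measurable_normc2. Qed.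

Section fatou.
Context d (T : measurableType d) {R : realType}.
Variable mu : {measure set T -> \bar R}.

Lemma fatou_bound (u : nat -> T -> R) (v : T -> R) (C : \bar R) :
  (forall n, measurable_fun setT (u n)) -> measurable_fun setT v ->
  (forall n x, 0 <= u n x) ->
  {ae mu, forall x, u n x @[n --> \oo] --> v x} ->
  (forall n, \int[mu]_x (u n x)%:E <= C)%E ->
  (\int[mu]_x (v x)%:E <= C)%E.
Proof.
move=> mu_ mv u0 uv uC.
have mEu n : measurable_fun setT (fun x => (u n x)%:E) by exact/measurable_EFinP.
have E : (\int[mu]_x (v x)%:E = \int[mu]_x limn_einf (fun n => (u n x)%:E))%E.
  apply: ae_eq_integral => //.
  - exact/measurable_EFinP.
  - rewrite (_ : (fun _ => _) =
        (fun x => - limn_esup (fun n => - (u n x)%:E))%E); last first.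
      by apply/funext => x; rewrite -limn_einfN; congr limn_einf;
        apply/funext => n /=; rewrite opprK.
    apply: measurableT_comp => //; apply: measurable_fun_limn_esup => n.
    exact: measurableT_comp.
  - apply: filterS uv => x ux _.
    have /cvg_limn_einf_sup[-> _] // : (u n x)%:E @[n --> \oo] --> (v x)%:E.
    by apply: cvg_comp ux _; exact: cvg_id.
rewrite E; apply: le_trans (fatou mu measurableT mEu _) _.
  by move=> n x _; rewrite lee_fin.
rewrite limn_einf_lim; apply: lime_le; first exact: is_cvg_einfs.
apply: nearW => n; apply: le_trans (uC n).
by apply: ereal_inf_lbound; exists n => /=.
Qed.

End fatou.

(** * Plancherel's identity on the line *)

Section fourier1.
Context {R : realType}.
Local Notation mu1 := (@lebesgue_measure R).
Local Notation L := (measurableTypeR R).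
Local Notation D := (dirichlet_const R).
Local Notation kap := (@tri_mass R).
Local Notation energy1 := (energy mu1).
Implicit Types f g : L -> R[i].

Definition fourier f (xi : L) : R[i] := cint mu1 (fun x => f x * expi (- (x * xi))).

Lemma measurable_fourier_phase :
  measurable_fun setT (fun p : L * L => - (p.1 * p.2) : R).
Proof. by apply: measurableT_comp => //; exact: measurable_funM. Qed.

Lemma cmeas_fourier_kernel : cmeas (fun p : L * L => expi (- (p.1 * p.2))).
Proof. by apply: cmeas_expi; exact: measurable_fourier_phase. Qed.

Lemma cmeas_phase (x : L) : cmeas (fun y : L => expi (x * y)).
Proof. by apply: cmeas_expi; exact: measurable_funM. Qed.

Lemma cintegrable_phase f (h : L -> R) : cintegrable mu1 f ->
  measurable_fun setT h -> cintegrable mu1 (fun x => f x * expi (h x)).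
Proof.
move=> fi mh; apply: (@cintegrableM_bounded _ _ _ mu1 1) => //.
- exact: cmeas_expi.
- by move=> x; rewrite normc_expi.
Qed.

Lemma fourier_mult f g : cintegrable mu1 f -> cintegrable mu1 g ->
  cint mu1 (fun xi => fourier f xi * g xi) = cint mu1 (fun x => f x * fourier g x).
Proof.
move=> fi gi.
have k1 (p : L * L) : normc (expi (- (p.1 * p.2)) : R[i]) <= 1.
  by rewrite normc_expi.
have E := cint_kernel_adjoint (@ler01 R) cmeas_fourier_kernel k1 fi gi.
transitivity (cint mu1 (fun y => cint mu1 (fun x => f x * expi (- (x * y))) * g y)).
  by [].
rewrite -E; apply: eq_cint => x; congr (_ * _); apply: eq_cint => y /=.
by rewrite mulrC (mulrC x).
Qed.

Lemma cmeas_fourier f : cmeas f -> cmeas (fourier f).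
Proof.
move=> mf; apply: (@cmeas_param _ _ _ _ _ mu1 (fun p => f p.2 * expi (- (p.2 * p.1)))).
apply: cmeasM; first exact: (cmeas_comp _ mf).
apply: cmeas_expi; apply: measurableT_comp => //; exact: measurable_funM.
Qed.

Lemma fourier_bound f xi : cintegrable mu1 f ->
  normc (fourier f xi) <= fine (\int[mu1]_x (normc (f x))%:E)%E.
Proof.
move=> [mf fi]; rewrite -lee_fin fineK; last first.
  rewrite ge0_fin_numE//; apply: integral_ge0 => x _.
  by rewrite lee_fin normc_ge0.
apply: le_trans (le_normc_cint _ _) _.
  apply: cmeasM => //; apply: cmeas_expi; apply: measurableT_comp => //.
  exact: measurable_funM.
by under eq_integral do rewrite normcM normc_expi mulr1.
Qed.

Lemma fourier_bound_ge0 f : 0 <= fine (\int[mu1]_x (normc (f x))%:E)%E.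
Proof. by rewrite fine_ge0// integral_ge0// => x _; rewrite lee_fin normc_ge0. Qed.

Lemma Re_conj_scale (a : R) (z : R[i]) :
  complex.Re (cconj (a%:C * z) * z) = normc z ^+ 2 * a.
Proof. by rewrite normc2E; case: z => u v /=; ring. Qed.

(** The convolution of [f] with an approximate identity of total mass
    [D * kap]; it is also the inverse transform of [fejer r * fourier f]. *)
Definition smooth r f (x : L) : R[i] :=
  cint mu1 (fun y => f y * (D * tri r (x - y))%:C).

Lemma fourier_fejer_phase r (x y : L) :
  fourier (fun xi => (fejer r xi)%:C * expi (x * xi)) y =
  (D * tri r (x - y))%:C.
Proof.
rewrite -fourier_fejer; apply: eq_cint => xi.
by rewrite -mulrA -expiD; congr (_ * expi _); rewrite mulrBl (mulrC xi).
Qed.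

Lemma smoothE r f x : cintegrable mu1 f ->
  smooth r f x = cint mu1 (fun xi => fourier f xi * ((fejer r xi)%:C * expi (x * xi))).
Proof.
move=> fi; rewrite fourier_mult//.
  by apply: eq_cint => y; rewrite fourier_fejer_phase.
apply: (@cintegrable_fejerM _ _ _ 1); first exact: cmeas_phase.
by move=> y; rewrite normc_expi.
Qed.

Lemma cintegrable_fourier_fejer r f : cintegrable mu1 f ->
  cintegrable mu1 (fun xi => (fejer r xi)%:C * fourier f xi).
Proof.
move=> fi; apply: (@cintegrable_fejerM _ _ _ (fine (\int[mu1]_x (normc (f x))%:E)%E)).
  by apply: cmeas_fourier; exact: fi.1.
by move=> xi; exact: fourier_bound.
Qed.

Lemma smooth_fourier r f x : cintegrable mu1 f ->
  smooth r f x = fourier (fun xi => (fejer r xi)%:C * fourier f xi) (- x).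
Proof.
move=> fi; rewrite smoothE//; apply: eq_cint => xi.
by rewrite mulrCA mulrA mulrN opprK (mulrC xi).
Qed.

Lemma measurable_tri_sub r :
  measurable_fun setT (fun p : L * L => tri r (p.1 - p.2)).
Proof.
apply: (measurableT_comp (measurable_tri r)); exact: measurable_funB.
Qed.

Lemma cmeas_smooth r f : cmeas f -> cmeas (smooth r f).
Proof.
move=> mf.
have mtri : cmeas (fun p : L * L => (D * tri r (p.1 - p.2))%:C).
  by apply: cmeas_real; apply: measurable_funM => //; exact: measurable_tri_sub.
apply: (@cmeas_param _ _ _ _ _ mu1 (fun p : L * L => f p.2 * (D * tri r (p.1 - p.2))%:C)).
by apply: cmeasM => //; exact: (cmeas_comp _ mf).
Qed.

Lemma integral_tri_subl r (x : L) : 0 < r ->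
  (\int[mu1]_y (tri r (x - y))%:E = kap%:E)%E.
Proof.
move=> r0; rewrite -(integral_tri r0).
rewrite (@ge0_integral_affine R (fun x => (tri r x)%:E) (-1) x)//.
- by rewrite normrN1 mul1e; apply: eq_integral => y _; rewrite mulN1r addrC.
- by apply/measurable_EFinP; exact: measurable_tri.
- by move=> y; rewrite lee_fin tri_ge0.
Qed.

Lemma integral_tri_subr r (y : L) : 0 < r ->
  (\int[mu1]_x (tri r (x - y))%:E = kap%:E)%E.
Proof.
move=> r0; rewrite -(integral_tri_subl y r0); apply: eq_integral => x _.
by rewrite -triN opprB.
Qed.

Lemma dirichlet_const_ge0 : 0 <= D.
Proof. by apply: Rintegral_ge0 => x _; exact: chordq_ge0. Qed.

Lemma tri_mass_ge0 : 0 <= kap.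
Proof. by apply: Rintegral_ge0 => x _; exact: tri_ge0. Qed.

(** Schur's test: [2 |f x| |f y| <= |f x|^2 + |f y|^2], and the kernel has mass
    [D * kap] in either variable. *)
Lemma schur_tri r f : 0 < r -> cmeas f ->
  (\int[mu1]_x \int[mu1]_y (normc (f x) * normc (f y) * (D * tri r (x - y)))%:E
   <= (D * kap)%:E * energy1 f)%E.
Proof.
move=> r0 mf; have mn := measurable_normc2 mf.
have c0 : 0 <= D * kap by rewrite mulr_ge0 ?dirichlet_const_ge0 ?tri_mass_ge0.
pose w (p : L * L) := D * tri r (p.1 - p.2).
have w0 p : 0 <= w p by rewrite mulr_ge0 ?dirichlet_const_ge0// tri_ge0.
have mw : measurable_fun setT w.
  by apply: measurable_funM => //; exact: measurable_tri_sub.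
have scale (u : L -> R) : measurable_fun setT u -> (forall z, 0 <= u z) ->
    (\int[mu1]_z (u z)%:E = kap%:E -> \int[mu1]_z (D * u z)%:E = (D * kap)%:E)%E.
  move=> mu u0 uE; under eq_integral do rewrite EFinM.
  rewrite ge0_integralZl_EFin ?dirichlet_const_ge0//; first by rewrite uE EFinM.
    by move=> z _; rewrite lee_fin.
  exact/measurable_EFinP.
have marginal (v : L -> L -> R) : (forall x, measurable_fun setT (v x)) ->
    (forall x y, 0 <= v x y) -> (forall x, \int[mu1]_y (v x y)%:E = (D * kap)%:E)%E ->
    (\int[mu1]_x \int[mu1]_y (normc (f x) ^+ 2 * v x y)%:E = (D * kap)%:E * energy1 f)%E.
  move=> mv v0 vE; rewrite -ge0_integralZl_EFin//.
  - apply: eq_integral => x _; under eq_integral do rewrite EFinM.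
    rewrite ge0_integralZl_EFin ?sqr_ge0//; first by rewrite vE muleC.
      by move=> y _; rewrite lee_fin.
    exact/measurable_EFinP.
  - by move=> y _; rewrite lee_fin sqr_ge0.
  - exact/measurable_EFinP.
pose F1 (p : L * L) := normc (f p.1) ^+ 2 * w p.
pose F2 (p : L * L) := normc (f p.2) ^+ 2 * w p.
pose F (p : L * L) := normc (f p.1) * normc (f p.2) * w p.
have mF1 : measurable_fun setT (EFin \o F1).
  by apply/measurable_EFinP; apply: measurable_funM => //; exact: (measurableT_comp mn).
have mF2 : measurable_fun setT (EFin \o F2).
  by apply/measurable_EFinP; apply: measurable_funM => //; exact: (measurableT_comp mn).
have mF : measurable_fun setT (EFin \o F).
  apply/measurable_EFinP; apply: measurable_funM => //.
  by apply: measurable_funM; apply: measurable_normc; exact: (cmeas_comp _ mf).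
have F10 p : (0 <= (EFin \o F1) p)%E by rewrite lee_fin mulr_ge0// sqr_ge0.
have F20 p : (0 <= (EFin \o F2) p)%E by rewrite lee_fin mulr_ge0// sqr_ge0.
have F0 p : (0 <= (EFin \o F) p)%E.
  by rewrite lee_fin; apply: mulr_ge0 (w0 p); rewrite mulr_ge0 ?normc_ge0.
have I1 : (\int[mu1 \x mu1]_p (EFin \o F1) p = (D * kap)%:E * energy1 f)%E.
  rewrite fubini_tonelli1//; apply: (marginal (fun x y => w (x, y))) => // x.
  - exact: (measurableT_comp mw (pair1_measurable x)).
  - apply: scale; [|by move=> z; exact: tri_ge0|exact: integral_tri_subl].
    exact: (measurableT_comp (measurable_tri_sub r) (pair1_measurable x)).
have I2 : (\int[mu1 \x mu1]_p (EFin \o F2) p = (D * kap)%:E * energy1 f)%E.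
  rewrite fubini_tonelli2//; apply: (marginal (fun y x => w (x, y))) => // y.
  - exact: (measurableT_comp mw (pair2_measurable y)).
  - apply: scale; [|by move=> z; exact: tri_ge0|exact: integral_tri_subr].
    exact: (measurableT_comp (measurable_tri_sub r) (pair2_measurable y)).
have E0 : (0 <= (D * kap)%:E * energy1 f)%E by rewrite -I1 integral_ge0.
rewrite (_ : (\int[mu1]_x _)%E = (\int[mu1 \x mu1]_p (EFin \o F) p)%E); last first.
  by rewrite fubini_tonelli1.
have half0 : (0 <= (2^-1 : R)%:E)%E by rewrite lee_fin.
apply: (@le_trans _ _ (\int[mu1 \x mu1]_p
    ((2^-1)%:E * (EFin \o F1) p + (2^-1)%:E * (EFin \o F2) p))%E).
  apply: ge0_le_integral => //.
  - by apply: emeasurable_funD; exact: emeasurable_funM.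
  - move=> p _; rewrite -!EFinM -EFinD lee_fin /F /F1 /F2.
    have := w0 p; move: (w p) (normc (f p.1)) (normc (f p.2)) => c a b cp.
    by have := sqr_ge0 (a - b); nra.
rewrite ge0_integralD//; last 4 first.
- by move=> p _; exact: mule_ge0.
- exact: emeasurable_funM.
- by move=> p _; exact: mule_ge0.
- exact: emeasurable_funM.
rewrite !ge0_integralZl_EFin// I1 I2 -ge0_muleDl// -EFinD.
by rewrite (_ : 2^-1 + 2^-1 = 1 :> R) ?mul1e//; field.
Qed.

(** By the multiplication formula the left-hand side is [<f, smooth r f>], and
    Schur's test applies to it. *)
Lemma fejer_energy_le r f : 0 < r -> cintegrable mu1 f ->
  (\int[mu1]_xi (normc (fourier f xi) ^+ 2 * fejer r xi)%:E
   <= (D * kap)%:E * energy1 f)%E.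
Proof.
move=> r0 fi; have mf := fi.1.
apply: le_trans (schur_tri r0 mf).
have hi := cintegrable_fourier_fejer r fi.
pose h xi := cconj ((fejer r xi)%:C * fourier f xi).
have hJ : cintegrable mu1 h by exact: cintegrableJ.
have ei : cintegrable mu1 (fun xi => h xi * fourier f xi).
  apply: (cintegrableM_bounded (fourier_bound_ge0 f) hJ).
  - exact: cmeas_fourier.
  - by move=> xi; exact: fourier_bound.
have -> : (\int[mu1]_xi (normc (fourier f xi) ^+ 2 * fejer r xi)%:E =
    (complex.Re (cint mu1 (fun xi => h xi * fourier f xi)))%:E)%E.
  transitivity (fine (\int[mu1]_xi (complex.Re (h xi * fourier f xi))%:E))%:E%E; last by [].
  rewrite fineK; last exact: (integrable_fin_num measurableT (cintegrable_Re ei)).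
  apply: eq_integral => xi _; congr EFin.
  by rewrite Re_conj_scale.
have -> : cint mu1 (fun xi => h xi * fourier f xi) =
    cint mu1 (fun x => f x * cconj (smooth r f x)).
  transitivity (cint mu1 (fun xi => fourier f xi * h xi)).
    by apply: eq_cint => xi; rewrite mulrC.
  rewrite (fourier_mult fi hJ); apply: eq_cint => x; congr (_ * _).
  have mph : measurable_fun setT (fun xi : L => - (xi * - x)).
    by apply: measurableT_comp => //; exact: measurable_funM.
  rewrite (smooth_fourier r x fi) /fourier.
  have E := cintJ (cintegrable_phase hi mph).
  apply: etrans E; apply: eq_cint => xi.
  by rewrite conjM conj_expi mulrN opprK.
apply: (@le_trans _ _ (normc (cint mu1 (fun x => f x * cconj (smooth r f x))))%:E).
  by rewrite lee_fin (le_trans (ler_norm _))// le_Re_normc.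
have mtri : cmeas (fun p : L * L => (D * tri r (p.1 - p.2))%:C).
  by apply: cmeas_real; apply: measurable_funM => //; exact: measurable_tri_sub.
have msm := cmeas_smooth r mf.
apply: le_trans (le_normc_cint _ _) _.
  by apply: cmeasM => //; exact: cmeasJ.
have mF4 : measurable_fun setT (fun p : L * L => normc (f p.1) * normc (f p.2) * (D * tri r (p.1 - p.2))).
  apply: measurable_funM; last by apply: measurable_funM => //; exact: measurable_tri_sub.
  by apply: measurable_funM; apply: measurable_normc; exact: (cmeas_comp _ mf).
apply: ge0_le_integral => //.
- by move=> x _; rewrite lee_fin normc_ge0.
- apply/measurable_EFinP; apply: measurable_normc.
  by apply: cmeasM => //; exact: cmeasJ.
- apply: (@measurable_fun_fubini_tonelli_F _ _ _ _ _ mu1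
    (fun p : L * L => (normc (f p.1) * normc (f p.2) * (D * tri r (p.1 - p.2)))%:E)).
    exact/measurable_EFinP.
  move=> p; rewrite lee_fin; apply: mulr_ge0; first by rewrite mulr_ge0 ?normc_ge0.
  by rewrite mulr_ge0 ?dirichlet_const_ge0 ?tri_ge0.
- move=> x _; rewrite normcM normcJ EFinM.
  have -> : (\int[mu1]_y (normc (f x) * normc (f y) * (D * tri r (x - y)))%:E =
     (normc (f x))%:E * \int[mu1]_y (normc (f y * (D * tri r (x - y))%:C))%:E)%E.
    rewrite -ge0_integralZl_EFin ?normc_ge0//.
    + apply: eq_integral => y _; rewrite -EFinM normcM normc_real; congr EFin.
      rewrite [in RHS]ger0_norm; last by rewrite mulr_ge0 ?dirichlet_const_ge0 ?tri_ge0.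
      by rewrite -mulrA.
    + by move=> y _; rewrite lee_fin normc_ge0.
    + apply/measurable_EFinP; apply: measurable_normc; apply: cmeasM => //.
      exact: (cmeas_pair1 x mtri).
  rewrite lee_wpmul2l ?lee_fin ?normc_ge0//.
  apply: le_normc_cint; apply: cmeasM => //.
  exact: (cmeas_pair1 x mtri).
Qed.

End fourier1.

Section plancherel1.
Context {R : realType}.
Local Notation mu1 := (@lebesgue_measure R).
Local Notation L := (measurableTypeR R).
Local Notation D := (dirichlet_const R).
Local Notation kap := (@tri_mass R).
Local Notation energy1 := (energy mu1).
Implicit Types f g : L -> R[i].

Local Notation rn n := (n.+1%:R^-1 : R).

Lemma rn_gt0 (n : nat) : 0 < rn n. Proof. by rewrite invr_gt0. Qed.

Lemma cvg_fejer (xi : R) : xi != 0 -> fejer (rn n) xi @[n --> \oo] --> (1 : R).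
Proof.
move=> x0.
have h0 : rn n @[n --> \oo] --> (0 : R) by exact: cvg_harmonic.
have h1 : 1 - (rn n * xi) ^+ 2 / 4 @[n --> \oo] --> 1 - (0 * xi) ^+ 2 / 4.
  apply: cvgB; first exact: cvg_cst.
  apply: cvgM; last exact: cvg_cst.
  apply: (@continuous_cvg _ _ _ _ _ _ (fun y : R => y ^+ 2)); first exact: exprn_continuous.
  by apply: cvgM => //; exact: cvg_cst.
rewrite mul0r expr0n/= mul0r subr0 in h1.
apply: (squeeze_cvgr _ h1 (cvg_cst (1 : R))).
by apply: nearW => n; rewrite fejer_le1 andbT fejer_ge// gt_eqF// rn_gt0.
Qed.

(** Let [r] tend to 0 in [fejer_energy_le]. *)
Lemma fourier_energy_le f : cintegrable mu1 f ->
  (energy1 (fourier f) <= (D * kap)%:E * energy1 f)%E.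
Proof.
move=> fi; have mF := cmeas_fourier fi.1.
apply: (@fatou_bound _ _ _ mu1 (fun n xi => normc (fourier f xi) ^+ 2 * fejer (rn n) xi)).
- by move=> n; apply: measurable_funM; [exact: measurable_normc2|exact: measurable_fejer].
- exact: measurable_normc2.
- by move=> n x; rewrite mulr_ge0 ?sqr_ge0 ?fejer_ge0.
- exists [set 0]; split.
  + exact: measurable_set1.
  + exact: lebesgue_measure_set1.
  + move=> x /= nx; apply: contrapT => /eqP x0; apply: nx.
    rewrite -[X in _ --> X]mulr1; apply: cvgM; first exact: cvg_cst.
    exact: cvg_fejer.
- by move=> n; apply: fejer_energy_le => //; exact: rn_gt0.
Qed.

(** Convolution with the triangle converges at the Lebesgue points: the error is
    at most twice the mean oscillation of [u] on the ball of radius [r]. *)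
Lemma tri_lebesgue (u : L -> R) (x : L) : mu1.-integrable setT (EFin \o u) ->
  lebesgue_pt u x ->
  \int[mu1]_y (u y * tri (rn n) (x - y)) @[n --> \oo] --> kap * u x.
Proof.
move=> ui ux; have mu_ : measurable_fun setT u.
  by apply/measurable_EFinP; exact: measurable_int ui.
have mt r : measurable_fun setT (fun y : L => tri r (x - y)).
  exact: (measurableT_comp (measurable_tri_sub r) (pair1_measurable x)).
have ti r : 0 < r -> mu1.-integrable setT (fun y => (tri r (x - y))%:E).
  move=> r0; apply/integrableP; split; first exact/measurable_EFinP.
  under eq_integral do rewrite gee0_abs ?lee_fin ?tri_ge0//.
  by rewrite integral_tri_subl// ltry.
have uti r : 0 < r -> mu1.-integrable setT (fun y => (u y * tri r (x - y))%:E).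
  move=> r0; apply: (@le_integrable _ _ _ _ _ measurableT _ (fun y => (r^-1)%:E * (u y)%:E)%E).
  - by apply/measurable_EFinP; exact: measurable_funM.
  - move=> y _; rewrite -EFinM !abse_EFin lee_fin (normrM (u y)) (normrM r^-1) (ger0_norm (tri_ge0 _ _)).
    by rewrite (@ger0_norm _ r^-1) ?invr_ge0 ?(ltW r0)// mulrC ler_wpM2r// tri_le.
  - exact: integrableZl.
have cti r : 0 < r -> mu1.-integrable setT (fun y => (u x * tri r (x - y))%:E).
  by move=> r0; under eq_fun do rewrite EFinM; apply: integrableZl => //; exact: ti.
have B r : 0 < r -> (`|\int[mu1]_y (u y * tri r (x - y)) - kap * u x|%:E
    <= 2%:E * davg u x r)%E.
  move=> r0.
  have -> : kap * u x = \int[mu1]_y (u x * tri r (x - y)).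
    rewrite RintegralZl//; last exact: ti.
    by rewrite mulrC /Rintegral integral_tri_subl.
  rewrite -RintegralB//; [|exact: uti|exact: cti].
  have dI := integrableB measurableT (uti r r0) (cti r r0).
  apply: le_trans (_ : _ <= \int[mu1]_y (`|u y - u x| * tri r (x - y))%:E)%E _.
    rewrite EFin_normr_Rintegral//; apply: le_trans (le_abse_integral _ _ _) _ => //.
      exact: measurable_int dI.
    rewrite le_eqVlt; apply/orP; left; apply/eqP; apply: eq_integral => y _.
    by rewrite abse_EFin -mulrBl normrM (ger0_norm (tri_ge0 _ _)).
  have mB : measurable (ball x r : set L) by exact: measurable_ball.
  have mux : measurable_fun setT (fun y => `|u y - u x|).
    by apply: measurableT_comp => //; exact: measurable_funB.
  apply: le_trans (_ : _ <= \int[mu1]_(y in ball x r) ((r^-1)%:E * (`|u y - u x|)%:E))%E _.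
    rewrite [leRHS]integral_mkcond; apply: ge0_le_integral => //.
    - by move=> y _; rewrite lee_fin mulr_ge0// tri_ge0.
    - by apply/measurable_EFinP; exact: measurable_funM.
    - apply/(measurable_restrictT _ _).1 => //.
      apply: emeasurable_funM => //; apply/measurable_EFinP.
      exact: measurable_funTS.
    - move=> y _; rewrite patchE; case: ifPn => [_|].
        by rewrite -EFinM lee_fin mulrC ler_wpM2r// tri_le.
      rewrite notin_setE /ball/= => /negP; rewrite -leNgt => h.
      by rewrite tri_eq0// mulr0.
  rewrite ge0_integralZl_EFin//; last 2 first.
  - by apply/measurable_EFinP; exact: measurable_funTS.
  - by rewrite invr_ge0 ltW.
  rewrite /davg /iavg (lebesgue_measure_ball _ (ltW r0)) muleA.
  rewrite inver ifF; last by apply/negbTE; rewrite mulrn_eq0/= gt_eqF.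
  rewrite -EFinM le_eqVlt; apply/orP; left; apply/eqP.
  by congr (_ * _)%E; congr EFin; rewrite -[r *+ 2]mulr_natl invfM mulrA divff ?mul1r.
have d0 : (2%:E * davg u x (rn n))%E @[n --> \oo] --> 0%E.
  rewrite -[X in _ --> X](mule0 2%:E).
  apply: cvgeZl => //.
  by move/cvge_at_rightP : ux; apply; split; [move=> n; exact: rn_gt0|exact: cvg_harmonic].
apply: (@cvg_zero R R^o); apply: norm_cvg0.
have h : (`|\int[mu1]_y (u y * tri (rn n) (x - y)) - kap * u x|)%:E
    @[n --> \oo] --> 0%:E.
  apply: (squeeze_cvge _ (cvg_cst 0%E) d0).
  by apply: nearW => n; rewrite lee_fin normr_ge0/= B// rn_gt0.
exact: (fine_cvg h).
Qed.

Lemma energy1_reflect f : cmeas f -> energy1 (fun x => f (- x)) = energy1 f.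
Proof.
move=> mf; rewrite /energy.
rewrite [RHS](@ge0_integral_affine R (fun x => (normc (f x) ^+ 2)%:E) (-1) 0)//.
- by rewrite normrN1 mul1e; apply: eq_integral => x _; rewrite mulN1r addr0.
- exact: measurable_energy.
- by move=> x; rewrite lee_fin sqr_ge0.
Qed.

Lemma cvg_smooth f : cintegrable mu1 f ->
  {ae mu1, forall x, normc (smooth (rn n) f x) ^+ 2 @[n --> \oo] -->
     (D * kap) ^+ 2 * normc (f x) ^+ 2}.
Proof.
move=> fi.
have fR : mu1.-integrable setT (EFin \o (fun x => complex.Re (f x))) := cintegrable_Re fi.
have fI : mu1.-integrable setT (EFin \o (fun x => complex.Im (f x))) := cintegrable_Im fi.
have lR := lebesgue_differentiation (open_integrable_locally openT fR).
have lI := lebesgue_differentiation (open_integrable_locally openT fI).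
apply: (@filterS2 _ _ (ae_filter_ringOfSetsType mu1) _ _ _ _ lR lI) => x xR xI.
have cR := tri_lebesgue fR xR; have cI := tri_lebesgue fI xI.
have E n : normc (smooth (rn n) f x) ^+ 2 =
    D ^+ 2 * ((\int[mu1]_y (complex.Re (f y) * tri (rn n) (x - y))) ^+ 2 +
      (\int[mu1]_y (complex.Im (f y) * tri (rn n) (x - y))) ^+ 2).
  have ki : cintegrable mu1 (fun y => f y * (tri (rn n) (x - y))%:C).
    apply: (@cintegrableM_bounded _ _ _ mu1 (rn n)^-1) => //.
    - apply: cmeas_real.
      exact: (measurableT_comp (measurable_tri_sub _) (pair1_measurable x)).
    - move=> y; rewrite normc_real ger0_norm ?tri_ge0// tri_le// rn_gt0.
  have -> : smooth (rn n) f x = D%:C * cint mu1 (fun y => f y * (tri (rn n) (x - y))%:C).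
    rewrite -(cintZl _ ki); apply: eq_cint => y.
    by rewrite realcM mulrCA.
  rewrite normcM exprMn normc_real real_normK ?num_real//; congr (_ * _).
  rewrite normc2E; congr (_ ^+ 2 + _ ^+ 2); apply: eq_Rintegral => y _.
  - by rewrite ReM /= mulr0 subr0.
  - by rewrite ImM /= mulr0 add0r.
under eq_fun do rewrite E.
have -> : (D * kap) ^+ 2 * normc (f x) ^+ 2 =
    D ^+ 2 * ((kap * complex.Re (f x)) ^+ 2 + (kap * complex.Im (f x)) ^+ 2).
  by rewrite normc2E; ring.
apply: cvgM; first exact: cvg_cst.
apply: cvgD.
- apply: (@continuous_cvg _ _ _ _ _ _ (fun y : R => y ^+ 2)) => //.
  exact: exprn_continuous.
- apply: (@continuous_cvg _ _ _ _ _ _ (fun y : R => y ^+ 2)) => //.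
  exact: exprn_continuous.
Qed.

(** [smooth r f] is, up to a reflection, the transform of [fejer r * fourier f];
    so [fourier_energy_le] bounds its energy, and it tends to [D * kap * f]
    almost everywhere. *)
Lemma fourier_energy_ge f : cintegrable mu1 f ->
  (((D * kap) ^+ 2)%:E * energy1 f <= (D * kap)%:E * energy1 (fourier f))%E.
Proof.
move=> fi; have mf := fi.1; have mF := cmeas_fourier mf.
have c0 : 0 <= D * kap by rewrite mulr_ge0 ?dirichlet_const_ge0 ?tri_mass_ge0.
rewrite -ge0_integralZl_EFin ?sqr_ge0//; last 2 first.
- by move=> x _; rewrite lee_fin sqr_ge0.
- exact: measurable_energy.
under eq_integral do rewrite -EFinM.
apply: (@fatou_bound _ _ _ mu1 (fun n x => normc (smooth (rn n) f x) ^+ 2)).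
- by move=> n; apply: measurable_normc2; exact: cmeas_smooth.
- by apply: measurable_funM => //; exact: measurable_normc2.
- by move=> n x; rewrite sqr_ge0.
- exact: cvg_smooth.
- move=> n; have gi := cintegrable_fourier_fejer (rn n) fi.
  have -> : (\int[mu1]_x (normc (smooth (rn n) f x) ^+ 2)%:E)%E =
      energy1 (fourier (fun xi => (fejer (rn n) xi)%:C * fourier f xi)).
    rewrite -(energy1_reflect (cmeas_fourier gi.1)); apply: eq_integral => x _.
    by rewrite (smooth_fourier _ _ fi).
  apply: le_trans (fourier_energy_le gi) _.
  rewrite lee_wpmul2l ?lee_fin//; apply: ge0_le_integral => //.
  + by move=> x _; rewrite lee_fin sqr_ge0.
  + exact: (measurable_energy gi.1).
  + exact: measurable_energy.
  + move=> x _; rewrite lee_fin normcM normc_real ger0_norm ?fejer_ge0//.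
    apply: lerXn2r; rewrite ?nnegrE ?normc_ge0//.
      by rewrite mulr_ge0 ?fejer_ge0 ?normc_ge0.
    by rewrite ler_piMl ?normc_ge0// fejer_le1.
Qed.

End plancherel1.

Section calibration.
Context {R : realType}.
Local Notation mu1 := (@lebesgue_measure R).
Local Notation L := (measurableTypeR R).
Local Notation D := (dirichlet_const R).
Local Notation kap := (@tri_mass R).
Local Notation energy1 := (energy mu1).
Implicit Types f g : L -> R[i].

Lemma cvg_expRN_bounded (G : R -> R) (M : R) : (forall x, `|G x| <= M) ->
  expR (- x) * G x @[x --> +oo] --> 0.
Proof.
move=> GM.
have E : expR (- x) * M @[x --> +oo] --> 0 * M.
  by apply: cvgM; [exact: cvgr_expR|exact: cvg_cst].
rewrite mul0r in E.
have EN : - (expR (- x) * M) @[x --> +oo] --> 0 by rewrite -oppr0; exact: cvgN.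
apply: (squeeze_cvgr _ EN E); apply: nearW => x.
rewrite -ler_norml normrM ger0_norm ?expR_ge0// ler_wpM2l ?expR_ge0//.
Qed.

(** The constant 1 makes the integrand nonnegative, as the fundamental theorem of
    calculus on a half-line requires; the phase [th] covers sine and cosine. *)
Lemma integral_expRN_cos (th xi : R) :
  (\int[mu1]_(x in `[0%R, +oo[) (expR (- x) * (1 + cos (x * xi + th)))%:E =
   (1 + (cos th - xi * sin th) / (1 + xi ^+ 2))%:E)%E.
Proof.
have d0 : 1 + xi ^+ 2 != 0 by rewrite gt_eqF// ltr_pwDl// sqr_ge0.
pose F (x : R) := expR (- x) *
  (-1 + (xi * sin (x * xi + th) - cos (x * xi + th)) / (1 + xi ^+ 2)).
have dF (x : R) : is_derive x (1 : R) F (expR (- x) * (1 + cos (x * xi + th))).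
  rewrite /F; apply: is_derive_eq.
  rewrite /GRing.scale/=; set e := expR (- x); set s := sin _; set c := cos _.
  by field.
rewrite (@ge0_continuous_FTC2y R _ F 0 0).
- rewrite -EFinB /F; congr EFin; rewrite mul0r !add0r oppr0 expR0.
  by field.
- by move=> x _; rewrite mulr_ge0 ?expR_ge0//; have := cos_geN1 (x * xi + th); lra.
- apply: continuous_subspaceT => x.
  apply: cvgM; first by apply: continuous_comp; [exact: opp_continuous|exact: continuous_expR].
  apply: cvgD; first exact: cvg_cst.
  apply: continuous_comp; last exact: continuous_cos.
  apply: cvgD; last exact: cvg_cst.
  by apply: cvgM; [exact: cvg_id|exact: cvg_cst].
- apply: (@cvg_expRN_bounded _ (1 + (`|xi| + 1) / (1 + xi ^+ 2))) => x.
  apply: le_trans (ler_normD _ _) _; rewrite normrN1 lerD2l normrM.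
  rewrite (@ger0_norm _ (1 + xi ^+ 2)^-1) ?invr_ge0 ?addr_ge0 ?sqr_ge0//.
  rewrite ler_wpM2r ?invr_ge0 ?addr_ge0 ?sqr_ge0//.
  apply: le_trans (ler_normB _ _) _; rewrite normrM lerD ?cos_max//.
  by rewrite ler_piMr// sin_max.
- by move=> x _; exact: ex_derive.
- apply: cvg_at_right_filter; apply: differentiable_continuous.
  by apply/derivable1_diffP; exact: ex_derive.
- by move=> x _; rewrite derive1E derive_val.
Qed.

Definition exp0 (x : L) : R := if 0 <= x then expR (- x) else 0.

Lemma exp0_ge0 x : 0 <= exp0 x.
Proof. by rewrite /exp0; case: ifP => // _; exact: expR_ge0. Qed.

Lemma measurable_exp0 : measurable_fun setT exp0.
Proof.
apply: measurable_fun_ifT => //.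
- exact: measurable_fun_ler.
- by apply: measurableT_comp => //; exact: measurableT_comp.
Qed.

Lemma integral_exp0M (h : L -> R) :
  (\int[mu1]_x (exp0 x * h x)%:E =
   \int[mu1]_(x in `[0%R, +oo[) (expR (- x) * h x)%:E)%E.
Proof.
rewrite [RHS]integral_mkcond; apply: eq_integral => x _.
rewrite patchE /exp0; have [x0|x0] := leP 0 x.
  by rewrite mem_set//= in_itv/= x0.
by rewrite memNset ?mul0r//= in_itv/= andbT; apply/negP; rewrite -ltNge.
Qed.

Lemma integral_exp0 : (\int[mu1]_x (exp0 x)%:E = 1)%E.
Proof.
have := integral_expRN_cos 0 0.
rewrite -integral_exp0M cos0 mul0r subr0 expr0n/= addr0 divr1.
under eq_integral do rewrite mulr0 addr0 cos0 mulrC EFinM.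
rewrite ge0_integralZl_EFin//.
- case: (\int[mu1]_x (exp0 x)%:E)%E => [r| |].
  + by rewrite -EFinM => -[h]; congr EFin; lra.
  + by rewrite gt0_muley ?lte_fin.
  + by rewrite gt0_muleNy ?lte_fin.
- by move=> x _; rewrite lee_fin exp0_ge0.
- by apply/measurable_EFinP; exact: measurable_exp0.
Qed.

(** [exp0 x ^ 2 = exp0 (2 x)]. *)
Lemma energy_exp0 : energy1 (fun x => (exp0 x)%:C) = (2^-1)%:E.
Proof.
have E : (1 = 2%:E * energy1 (fun x => (exp0 x)%:C))%E.
  rewrite -integral_exp0 (@ge0_integral_affine R (fun x => (exp0 x)%:E) 2 0)//.
  - rewrite ger0_norm//; congr (_ * _)%E; apply: eq_integral => x _; congr EFin.
    rewrite addr0 normc_real real_normK ?num_real// /exp0 pmulr_rge0//.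
    case: ifP => _; last by rewrite expr0n.
    by rewrite -expRM_natl mulrN.
  - by apply/measurable_EFinP; exact: measurable_exp0.
  - by move=> x; rewrite lee_fin exp0_ge0.
move: E; case: (energy1 _) => [r| |].
- by rewrite -EFinM => -[h]; congr EFin; apply: (@mulfI _ 2) => //; rewrite -h divff.
- by rewrite gt0_muley ?lte_fin.
- by rewrite gt0_muleNy ?lte_fin.
Qed.

Lemma integrable_exp0M (h : L -> R) : measurable_fun setT h ->
  (forall x, `|h x| <= 1) -> mu1.-integrable setT (fun x => (exp0 x * h x)%:E).
Proof.
move=> mh h1; apply: (@le_integrable _ _ _ _ _ measurableT _ (fun x => (exp0 x)%:E)).
- by apply/measurable_EFinP; apply: measurable_funM => //; exact: measurable_exp0.
- move=> x _; rewrite !abse_EFin lee_fin normrM (ger0_norm (exp0_ge0 _)).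
  by rewrite ler_piMr// exp0_ge0.
- apply/integrableP; split; first by apply/measurable_EFinP; exact: measurable_exp0.
  under eq_integral do rewrite gee0_abs ?lee_fin ?exp0_ge0//.
  by rewrite integral_exp0 ltry.
Qed.

Lemma Rintegral_exp0_cos th xi :
  \int[mu1]_x (exp0 x * cos (x * xi + th)) =
  (cos th - xi * sin th) / (1 + xi ^+ 2).
Proof.
have mc : measurable_fun setT (fun x : L => cos (x * xi + th)).
  apply: measurableT_comp; last exact: (measurable_funD (measurable_funM _ _)).
  by apply: continuous_measurable_fun; exact: continuous_cos.
have i1 : mu1.-integrable setT (fun x => (exp0 x * 1)%:E).
  by apply: integrable_exp0M => // x; rewrite normr1.
have i2 := integrable_exp0M mc (fun x => cos_max _).
have E : \int[mu1]_x (exp0 x * (1 + cos (x * xi + th))) =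
    1 + (cos th - xi * sin th) / (1 + xi ^+ 2).
  by rewrite /Rintegral integral_exp0M integral_expRN_cos.
apply: (@addrI _ 1); rewrite -E -[X in X + _](_ : \int[mu1]_x (exp0 x * 1) = 1).
  by rewrite -RintegralD//; apply: eq_Rintegral => x _; rewrite mulrDr.
by rewrite /Rintegral; under eq_integral do rewrite mulr1; rewrite integral_exp0.
Qed.

Lemma cintegrable_exp0 : cintegrable mu1 (fun x => (exp0 x)%:C).
Proof.
split; first by apply: cmeas_real; exact: measurable_exp0.
under eq_integral do rewrite normc_real ger0_norm ?exp0_ge0//.
by rewrite integral_exp0 ltry.
Qed.

Lemma fourier_exp0 xi :
  normc (fourier (fun x => (exp0 x)%:C) xi) ^+ 2 = (1 + xi ^+ 2)^-1.
Proof.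
rewrite normc2E.
have -> : complex.Re (fourier (fun x => (exp0 x)%:C) xi) = (1 + xi ^+ 2)^-1.
  have := Rintegral_exp0_cos 0 xi; rewrite cos0 sin0 mulr0 subr0 mul1r => <-.
  apply: eq_Rintegral => x _.
  by rewrite ReM [complex.Re (expi _)]/= cosN [complex.Im _]/= mul0r subr0 addr0.
have -> : complex.Im (fourier (fun x => (exp0 x)%:C) xi) = - (xi / (1 + xi ^+ 2)).
  (* the phase [pi / 2] turns the cosine into minus the sine *)
  have := Rintegral_exp0_cos (pi / 2) xi.
  rewrite cos_pihalf sin_pihalf mulr1 sub0r mulNr => <-; apply: eq_Rintegral => x _.
  rewrite cosDpihalf ImM [complex.Im (expi _)]/= sinN [X in _ + X * _]/= mul0r addr0.
  by rewrite [complex.Re _]/=.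
have d0 : 1 + xi ^+ 2 != 0 by rewrite gt_eqF// ltr_pwDl// sqr_ge0.
by field.
Qed.

(** With [c = D * kap] the two energy bounds say [c^2 E <= c E' <= c^2 E] for the
    energies of [f] and of its transform. For the one-sided exponential
    [E = 1 / 2] and [E'] is the integral of [1 / (1 + xi^2)], which is [pi]. *)
Lemma plancherel_const : D * kap = 2 * pi.
Proof.
have E : energy1 (fourier (fun x => (exp0 x)%:C)) = pi%:E.
  by rewrite -integral_oneDsqr; apply: eq_integral => xi _; rewrite fourier_exp0.
have := fourier_energy_le cintegrable_exp0.
have := fourier_energy_ge cintegrable_exp0.
rewrite E energy_exp0 -!EFinM !lee_fin => h2 h1.
have p0 := pi_gt0 R.
have c0 : 0 < D * kap by nra.
apply/eqP; rewrite eq_le; apply/andP; split; last by lra.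
by rewrite -(ler_pM2l c0); lra.
Qed.

(** Plancherel's identity, in which both sides may be [+oo]. *)
Theorem fourier_energy f : cintegrable mu1 f ->
  energy1 (fourier f) = ((2 * pi)%:E * energy1 f)%E.
Proof.
move=> fi; apply/eqP; rewrite eq_le; apply/andP; split.
  by rewrite -plancherel_const; exact: fourier_energy_le.
have := fourier_energy_ge fi; rewrite plancherel_const.
have c0 : 0 < 2 * pi :> R by rewrite mulr_gt0// pi_gt0.
by rewrite expr2 EFinM -muleA lee_pmul2l.
Qed.

End calibration.

(** * Plancherel's identity for the fractional Fourier transform *)

Section vectors.
Context {R : realType}.
Implicit Types n : nat.

Lemma tnth_tcons0 n (p : measurableTypeR R * Rn R n) : tnth (tcons p) ord0 = p.1.
Proof. by []. Qed.

Lemma tnth_tconsS n (p : measurableTypeR R * Rn R n) i :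
  tnth (tcons p) (lift ord0 i) = tnth p.2 i.
Proof. by rewrite tnthS. Qed.

Lemma enorm2 n (x : Rn R n) : enorm x ^+ 2 = \sum_(i < n) (tnth x i : R) ^+ 2.
Proof. by rewrite sqr_sqrtr// sumr_ge0// => i _; exact: sqr_ge0. Qed.

Lemma enorm2_tcons n p : enorm (@tcons R n p) ^+ 2 = (p.1 : R) ^+ 2 + enorm p.2 ^+ 2.
Proof.
rewrite !enorm2 big_ord_recl tnth_tcons0; congr (_ + _).
by apply: eq_bigr => i _; rewrite tnth_tconsS.
Qed.

Lemma dotp_tcons n p q :
  dotp (@tcons R n p) (@tcons R n q) = (p.1 : R) * (q.1 : R) + dotp p.2 q.2.
Proof.
rewrite /dotp big_ord_recl !tnth_tcons0; congr (_ + _).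
by apply: eq_bigr => i _; rewrite !tnth_tconsS.
Qed.

Section measurability.
Context d (T : measurableType d) {n : nat}.
Implicit Types u v : T -> Rn R n.

Lemma measurable_coord u i : measurable_fun setT u ->
  measurable_fun setT (fun p => tnth (u p) i : R).
Proof. by move=> mu; exact: (measurableT_comp (measurable_tnth i) mu). Qed.

Lemma measurable_enorm2 u : measurable_fun setT u ->
  measurable_fun setT (fun p => enorm (u p) ^+ 2).
Proof.
move=> mu; under eq_fun do rewrite enorm2.
by apply: measurable_sum => i; apply: measurable_funX; exact: measurable_coord.
Qed.

Lemma measurable_dotp u v : measurable_fun setT u -> measurable_fun setT v ->
  measurable_fun setT (fun p => dotp (u p) (v p)).
Proof.
move=> mu mv; apply: measurable_sum => i.
by apply: measurable_funM; exact: measurable_coord.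
Qed.

Lemma measurable_tuple_of (g : 'I_n -> T -> R) :
  (forall i, measurable_fun setT (g i)) ->
  measurable_fun setT (fun p => [tuple g i p | i < n] : Rn R n).
Proof.
move=> mg; apply/measurable_fun_tnthP => i.
rewrite (_ : _ \o _ = g i); first exact: mg.
by apply/funext => p /=; rewrite tnth_mktuple.
Qed.

End measurability.

End vectors.

Section rec.
Context {R : realType} {n : nat}.
Local Notation mu1 := (@lebesgue_measure R).
Local Notation mun := (lebesgue R n).
Local Notation L := (measurableTypeR R).

Lemma ge0_integral_tcons_swap (F : Rn R n.+1 -> \bar R) : measurable_fun setT F ->
  (forall t, 0 <= F t)%E ->
  (\int[lebesgue R n.+1]_t F t =
   \int[mun]_y \int[mu1]_x F (tcons (x, y)))%E.
Proof.
move=> mF F0; rewrite ge0_integral_tcons//.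
apply: (@tonelli _ _ _ _ _ mu1 mun (fun p => F (tcons p))) => //.
by apply: measurableT_comp => //; exact: measurable_tcons.
Qed.

Lemma integral_tcons (F : Rn R n.+1 -> R) :
  (lebesgue R n.+1).-integrable setT (EFin \o F) ->
  \int[lebesgue R n.+1]_t F t = \int[mu1]_x \int[mun]_y F (tcons (x, y)).
Proof.
move=> Fi; have mT := @measurable_tcons R n.
have mF : measurable_fun setT (EFin \o F) := measurable_int _ Fi.
have mF' : measurable_fun setT F by exact/measurable_EFinP.
have mFt : measurable_fun setT (fun p => F (tcons p)) by exact: measurableT_comp.
have Fti : (mu1 \x mun)%E.-integrable setT (EFin \o (fun p => F (tcons p))).
  apply/integrableP; split; first exact/measurable_EFinP.
  rewrite fubini_tonelli1//; last first.
    by apply: measurableT_comp => //; exact/measurable_EFinP.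
  move/integrableP : Fi => [_]; rewrite ge0_integral_tcons//.
  exact: measurableT_comp.
rewrite /Rintegral; congr fine.
transitivity (\int[(mu1 \x mun)%E]_p (F (tcons p))%:E)%E.
  have := @integral_pushforward _ _ _ _ R (@tcons R n) mT
    (mu1 \x mun)%E setT (EFin \o F) mF.
  rewrite preimage_setT => /(_ _ measurableT) <-//.
rewrite -(integral12_prod_meas1 Fti); have F1 := integrable_fubini_F Fti.
apply: ae_eq_integral => //.
- exact: measurable_int F1.
- by apply/measurable_EFinP; exact: (measurable_Rintegral_param mun mFt).
- have := integrable_ae measurableT F1; apply: filterS => x /(_ I) xfin _.
  by rewrite fineK.
Qed.

Lemma cint_tcons (F : Rn R n.+1 -> R[i]) : cintegrable (lebesgue R n.+1) F ->
  cint (lebesgue R n.+1) F = cint mu1 (fun x => cint mun (fun y => F (tcons (x, y)))).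
Proof.
move=> Fi; apply: complexP => /=.
- by rewrite integral_tcons//; exact: cintegrable_Re Fi.
- by rewrite integral_tcons//; exact: cintegrable_Im Fi.
Qed.

Lemma cmeas_tcons (F : Rn R n.+1 -> R[i]) : cmeas F -> cmeas (fun p => F (tcons p)).
Proof. exact: (cmeas_comp (@measurable_tcons R n)). Qed.

Lemma cintegrable_tcons (F : Rn R n.+1 -> R[i]) : cintegrable (lebesgue R n.+1) F ->
  (\int[mu1]_x \int[mun]_y (normc (F (tcons (x, y))))%:E < +oo)%E.
Proof.
move=> [mF]; rewrite ge0_integral_tcons//.
- exact/measurable_EFinP/measurable_normc.
- by move=> t; rewrite lee_fin normc_ge0.
Qed.

Lemma ae_cintegrable_slice (F : Rn R n.+1 -> R[i]) :
  cintegrable (lebesgue R n.+1) F ->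
  {ae mu1, forall x, cintegrable mun (fun t => F (tcons (x, t)))}.
Proof.
move=> Fi; have mF := cmeas_tcons Fi.1.
have mn : measurable_fun setT (fun p => (normc (F (tcons p)))%:E).
  by apply/measurable_EFinP; exact: measurable_normc.
have ni : (mu1 \x mun)%E.-integrable setT (fun p => (normc (F (tcons p)))%:E).
  apply/integrable12ltyP => //.
  rewrite (_ : (fun _ => _) = (fun x => \int[mun]_y (normc (F (tcons (x, y))))%:E)%E).
    exact: cintegrable_tcons.
  apply/funext => x; apply: eq_integral => y _.
  by rewrite gee0_abs// lee_fin normc_ge0.
apply: (@filterS _ _ (ae_filter_ringOfSetsType mu1) _ _ _ (ae_integrable1 ni)) => x xi.
split; first exact: (cmeas_pair1 x mF).
exact: (integrable_lty measurableT xi).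
Qed.

End rec.

Lemma ae_eq_cint d (T : measurableType d) (R : realType)
    (mu : {measure set T -> \bar R}) (f g : T -> R[i]) :
  cmeas f -> cmeas g -> {ae mu, forall x, f x = g x} -> cint mu f = cint mu g.
Proof.
move=> mf mg fg; apply: complexP => /=; rewrite /Rintegral; congr fine.
- apply: ae_eq_integral => //.
  + exact/measurable_EFinP/mf.1.
  + exact/measurable_EFinP/mg.1.
  + by apply: filterS fg => x ->.
- apply: ae_eq_integral => //.
  + exact/measurable_EFinP/mf.2.
  + exact/measurable_EFinP/mg.2.
  + by apply: filterS fg => x ->.
Qed.

Section frft_constants.
Context {R : realType}.
Implicit Types (alpha : R) (n : nat).

Definition frft_base alpha : R[i] := (1 -i* cot alpha) / (2 * pi)%:C.

Lemma frft_constE n alpha : frft_const n alpha = cpow (frft_base alpha) (n%:R / 2).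
Proof. by []. Qed.

Lemma normc_frft_base alpha : sin alpha != 0 ->
  normc (frft_base alpha) = `|csc alpha| / (2 * pi).
Proof.
move=> s0; have p0 : 0 < 2 * pi :> R by rewrite mulr_gt0// pi_gt0.
rewrite /frft_base normcM normcV normc_real (gtr0_norm p0); congr (_ / _).
apply: sqr_inj_ge0; rewrite ?normc_ge0// normc2E /= real_normK ?num_real//.
by rewrite sqrrN /cot /csc expr_div_n cos2sin2 expr1n; field.
Qed.

Lemma normc_frft_base_gt0 alpha : sin alpha != 0 -> 0 < normc (frft_base alpha).
Proof.
move=> s0; rewrite normc_frft_base// divr_gt0//; last by rewrite mulr_gt0// pi_gt0.
by rewrite normr_gt0 invr_eq0.
Qed.

Lemma normc_cpow (z : R[i]) s : normc (cpow z s) = normc z `^ s.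
Proof. by rewrite /cpow normcM normc_expi mulr1 normc_real ger0_norm// powR_ge0. Qed.

Lemma normc_frft_const2 n alpha :
  normc (frft_const n alpha) ^+ 2 = normc (frft_base alpha) ^+ n.
Proof.
rewrite frft_constE normc_cpow -powR_mulrn ?powR_ge0// -powRrM.
by rewrite divfK// powR_mulrn// normc_ge0.
Qed.

Lemma normc_frft_const_gt0 n alpha : sin alpha != 0 -> 0 < normc (frft_const n alpha).
Proof.
by move=> s0; rewrite frft_constE normc_cpow powR_gt0// normc_frft_base_gt0.
Qed.

Lemma frft_constS n alpha : sin alpha != 0 ->
  frft_const n.+1 alpha = frft_const 1 alpha * frft_const n alpha.
Proof.
move=> s0; have b0 := normc_frft_base_gt0 s0.
rewrite !frft_constE /cpow -natr1 [1%:R]/(1 : R) mulrDl powRD; last first.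
  by apply/implyP => _; rewrite gt_eqF.
by rewrite [X in expi X]mulrDl expiD realcM; ring.
Qed.

Lemma frft_const0 alpha : frft_const 0 alpha = 1.
Proof. by rewrite frft_constE /cpow mul0r powRr0 mul0r expi0 mulr1. Qed.

End frft_constants.

Section frft_kernel.
Context {R : realType}.
Implicit Types (alpha : R) (n : nat).
Local Notation L := (measurableTypeR R).

Lemma normc_frft_kernel n alpha (t xi : Rn R n) :
  normc (frft_kernel alpha t xi) = normc (frft_const n alpha).
Proof. by rewrite /frft_kernel normcM normc_expi mulr1. Qed.

Lemma cmeas_frft_kernel d (T : measurableType d) n alpha (u v : T -> Rn R n) :
  measurable_fun setT u -> measurable_fun setT v ->
  cmeas (fun p => frft_kernel alpha (u p) (v p)).
Proof.
move=> mu mv; apply: cmeasM; first exact: cmeas_cst.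
apply: cmeas_expi; apply: measurable_funB.
  apply: measurable_funM => //; apply: measurable_funM => //.
  by apply: measurable_funD; exact: measurable_enorm2.
by apply: measurable_funM => //; exact: measurable_dotp.
Qed.

Definition kernel1 alpha (x xi : L) : R[i] := frft_const 1 alpha *
  expi (((x : R) ^+ 2 + (xi : R) ^+ 2) / 2 * cot alpha - (x : R) * (xi : R) * csc alpha).

Lemma frft_kernel_tcons n alpha (p q : L * Rn R n) : sin alpha != 0 ->
  frft_kernel alpha (tcons p) (tcons q) =
  kernel1 alpha p.1 q.1 * frft_kernel alpha p.2 q.2.
Proof.
move=> s0; rewrite /frft_kernel /kernel1 frft_constS//.
move: (frft_const 1 alpha) (frft_const n alpha) => a b.
rewrite [RHS]mulrACA -expiD; congr (_ * expi _); rewrite !enorm2_tcons dotp_tcons.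
by move: (enorm p.2) (enorm q.2) (dotp _ _) (p.1 : R) (q.1 : R) => ? ? ? ? ?; field.
Qed.

Lemma cmeas_kernel1 d (T : measurableType d) alpha (u v : T -> L) :
  measurable_fun setT u -> measurable_fun setT v ->
  cmeas (fun p => kernel1 alpha (u p) (v p)).
Proof.
move=> mu mv; apply: cmeasM; first exact: cmeas_cst.
apply: cmeas_expi; apply: measurable_funB.
  apply: measurable_funM => //; apply: measurable_funM => //.
  by apply: measurable_funD; exact: measurable_funX.
by apply: measurable_funM => //; exact: measurable_funM.
Qed.

End frft_kernel.

Section frft_energy1.
Context {R : realType}.
Local Notation mu1 := (@lebesgue_measure R).
Local Notation L := (measurableTypeR R).
Implicit Types (f : L -> R[i]) (alpha : R).

Definition frft1 alpha f (xi : L) := cint mu1 (fun x => f x * kernel1 alpha x xi).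

(** Multiplying by the chirp [e^{i x^2 cot / 2}] before and after reduces the
    fractional transform to the Fourier transform at [csc alpha * xi]. *)
Lemma frft1_energy alpha f : sin alpha != 0 -> cintegrable mu1 f ->
  energy mu1 (frft1 alpha f) = energy mu1 f.
Proof.
move=> s0 fi; have c0 : csc alpha != 0 by rewrite invr_eq0.
pose ph (x : L) : R := (x : R) ^+ 2 / 2 * cot alpha.
have mph : measurable_fun setT ph.
  by apply: measurable_funM => //; apply: measurable_funM => //; exact: measurable_funX.
pose g x := f x * expi (ph x).
have gi : cintegrable mu1 g := cintegrable_phase fi mph.
have E xi : frft1 alpha f xi =
    frft_const 1 alpha * expi (ph xi) * fourier g (csc alpha * xi + 0).
  rewrite /frft1 /fourier -cintZl; last first.
    apply: cintegrable_phase => //.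
    by apply: measurableT_comp => //; exact: measurable_funM.
  apply: eq_cint => x; rewrite /g /kernel1.
  rewrite [RHS](_ : _ = f x * (frft_const 1 alpha * (expi (ph xi) *
    expi (ph x) * expi (- (x * (csc alpha * xi + 0)))))); last by ring.
  by rewrite -!expiD /ph; congr (_ * (_ * expi _)); rewrite addr0; ring.
have mF := cmeas_fourier gi.1.
have -> : energy mu1 (frft1 alpha f) = ((normc (frft_const 1 alpha) ^+ 2)%:E *
    \int[mu1]_xi (normc (fourier g (csc alpha * xi + 0)%R) ^+ 2)%:E)%E.
  rewrite -ge0_integralZl_EFin ?sqr_ge0//.
  - apply: eq_integral => xi _.
    rewrite E; move: (frft_const 1 alpha) (fourier _ _) => a b.
    by rewrite !normcM normc_expi mulr1 exprMn EFinM.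
  - by move=> x _; rewrite lee_fin sqr_ge0.
  - apply/measurable_EFinP; apply: measurable_normc2.
    exact: (cmeas_comp (measurable_affine _ _) mF).
have F2 : energy mu1 (fourier g) = (`|csc alpha|%:E *
    \int[mu1]_xi (normc (fourier g (csc alpha * xi + 0)%R) ^+ 2)%:E)%E.
  apply: (@ge0_integral_affine R (fun x => (normc (fourier g x) ^+ 2)%:E)) => //.
  - by apply/measurable_EFinP; exact: measurable_normc2.
  - by move=> x; rewrite lee_fin sqr_ge0.
have Eg : energy mu1 g = energy mu1 f.
  by apply: eq_integral => x _; rewrite /g normcM normc_expi mulr1.
rewrite normc_frft_const2 expr1 normc_frft_base//.
rewrite mulrC EFinM -muleA -F2 (fourier_energy gi) Eg muleA -EFinM mulVf ?mul1e//.
by rewrite gt_eqF// mulr_gt0// pi_gt0.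
Qed.

End frft_energy1.

Section frft_energy.
Context {R : realType}.
Local Notation mu1 := (@lebesgue_measure R).
Local Notation L := (measurableTypeR R).
Implicit Types (n : nat) (alpha : R).

Lemma frft_L1E n alpha (f : Rn R n -> R[i]) xi :
  frft_L1 alpha f xi = cint (lebesgue R n) (fun t => f t * frft_kernel alpha t xi).
Proof. by []. Qed.

Lemma cmeas_frft_L1 n alpha (f : Rn R n -> R[i]) : cmeas f -> cmeas (frft_L1 alpha f).
Proof.
move=> mf.
apply: (@cmeas_param _ _ _ _ _ (lebesgue R n) (fun p => f p.2 * frft_kernel alpha p.2 p.1)).
apply: cmeasM; first exact: (cmeas_comp _ mf).
exact: cmeas_frft_kernel.
Qed.

Lemma energy_tcons n (f : Rn R n.+1 -> R[i]) : cmeas f ->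
  energy (lebesgue R n.+1) f =
  (\int[mu1]_x energy (lebesgue R n) (fun t => f (tcons (x, t))))%E.
Proof.
move=> mf; rewrite /energy ge0_integral_tcons//; first exact: measurable_energy.
by move=> t; rewrite lee_fin sqr_ge0.
Qed.

Lemma energy_tcons_swap n (f : Rn R n.+1 -> R[i]) : cmeas f ->
  energy (lebesgue R n.+1) f =
  (\int[lebesgue R n]_t energy mu1 (fun x => f (tcons (x, t))))%E.
Proof.
move=> mf; rewrite /energy ge0_integral_tcons_swap//; first exact: measurable_energy.
by move=> t; rewrite lee_fin sqr_ge0.
Qed.

Lemma cintegrable_frft_integrand n alpha (f : Rn R n -> R[i]) xi :
  cintegrable (lebesgue R n) f ->
  cintegrable (lebesgue R n) (fun t => f t * frft_kernel alpha t xi).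
Proof.
move=> fi.
apply: (@cintegrableM_bounded _ _ _ (lebesgue R n) (normc (frft_const n alpha))) => //.
- exact: normc_ge0.
- exact: cmeas_frft_kernel.
- by move=> t; rewrite normc_frft_kernel.
Qed.

(** One variable at a time: the transform in the first variable of the transform
    in the others. *)
Lemma frft_L1_tcons n alpha (f : Rn R n.+1 -> R[i]) xi (xi' : Rn R n) :
  sin alpha != 0 -> cintegrable (lebesgue R n.+1) f ->
  frft_L1 alpha f (tcons (xi, xi')) =
  frft1 alpha (fun x => frft_L1 alpha (fun t => f (tcons (x, t))) xi') xi.
Proof.
move=> s0 fi; rewrite frft_L1E cint_tcons; last exact: cintegrable_frft_integrand.
have mft := cmeas_tcons fi.1.
have mU : cmeas (fun p : L * Rn R n => f (tcons p) * frft_kernel alpha p.2 xi').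
  by apply: cmeasM => //; exact: cmeas_frft_kernel.
apply: ae_eq_cint.
- apply: (@cmeas_param _ _ _ _ _ (lebesgue R n)
    (fun p => f (tcons p) * frft_kernel alpha (tcons p) (tcons (xi, xi')))).
  by apply: cmeasM => //; apply: cmeas_frft_kernel => //; exact: measurable_tcons.
- by apply: cmeasM; [exact: (cmeas_param (lebesgue R n) mU)|exact: cmeas_kernel1].
- apply: (@filterS _ _ (ae_filter_ringOfSetsType mu1) _ _ _ (ae_cintegrable_slice fi)).
  move=> x xi_; rewrite frft_L1E mulrC -cintZl; last exact: cintegrable_frft_integrand.
  by apply: eq_cint => t; rewrite frft_kernel_tcons// mulrCA.
Qed.

Lemma cintegrable_frft_slice n alpha (f : Rn R n.+1 -> R[i]) (xi' : Rn R n) :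
  cintegrable (lebesgue R n.+1) f ->
  cintegrable mu1 (fun x => frft_L1 alpha (fun t => f (tcons (x, t))) xi').
Proof.
move=> fi; have mft := cmeas_tcons fi.1.
pose c := normc (frft_const n alpha).
have mU : cmeas (fun p : L * Rn R n => f (tcons p) * frft_kernel alpha p.2 xi').
  by apply: cmeasM => //; exact: cmeas_frft_kernel.
apply: (cintegrable_param (m1 := mu1) mU).
have E x : (\int[lebesgue R n]_t (normc (f (tcons (x, t)) * frft_kernel alpha t xi'))%:E =
   c%:E * \int[lebesgue R n]_t (normc (f (tcons (x, t))))%:E)%E.
  rewrite -ge0_integralZl_EFin ?normc_ge0//.
  - by apply: eq_integral => t _; rewrite normcM normc_frft_kernel mulrC EFinM.
  - by move=> t _; rewrite lee_fin normc_ge0.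
  - by apply/measurable_EFinP; apply: measurable_normc; exact: (cmeas_pair1 x mft).
under eq_integral do rewrite E.
rewrite ge0_integralZl_EFin ?normc_ge0//.
- rewrite lte_mul_pinfty ?lee_fin ?normc_ge0//; exact: cintegrable_tcons.
- by move=> x _; apply: integral_ge0 => t _; rewrite lee_fin normc_ge0.
- apply: (@measurable_fun_fubini_tonelli_F _ _ _ _ _ (lebesgue R n)
    (fun p => (normc (f (tcons p)))%:E)).
    by apply/measurable_EFinP; exact: measurable_normc.
  by move=> p; rewrite lee_fin normc_ge0.
Qed.

(** By induction on the dimension, exchanging the order of the two partial
    transforms with Tonelli's theorem. *)
Theorem frft_L1_energy n alpha (f : Rn R n -> R[i]) : sin alpha != 0 ->
  cintegrable (lebesgue R n) f ->
  energy (lebesgue R n) (frft_L1 alpha f) = energy (lebesgue R n) f.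
Proof.
move=> s0; elim: n f => [|n IHn] f fi.
  have mE (g : Rn R 0 -> R[i]) : cmeas g ->
      energy (lebesgue R 0) g = (normc (g [tuple]) ^+ 2)%:E.
    move=> mg; rewrite /energy /= integral_dirac ?diracT ?mul1e//.
    exact: measurable_energy.
  rewrite !mE; [|exact: fi.1|by apply: cmeas_frft_L1; exact: fi.1].
  rewrite frft_L1E; congr ((normc _ ^+ 2)%:E).
  have -> : cint (lebesgue R 0) (fun t => f t * frft_kernel alpha t [tuple]) =
      f [tuple] * frft_kernel alpha [tuple] [tuple].
    have [mR mI] : cmeas (fun t => f t * frft_kernel alpha t [tuple]).
      by apply: cmeasM; [exact: fi.1|exact: cmeas_frft_kernel].
    apply: complexP; rewrite [LHS]/= /Rintegral integral_dirac ?diracT ?mul1e//.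
    - exact/measurable_EFinP.
    - exact/measurable_EFinP.
  rewrite /frft_kernel frft_const0 mul1r.
  rewrite !enorm2 /dotp !big_ord0.
  by rewrite addr0 !mul0r subr0 expi0 mulr1.
have mf := fi.1; have mft := cmeas_tcons mf.
rewrite energy_tcons_swap; last exact: cmeas_frft_L1.
have mV : cmeas (fun q : (L * Rn R n) * Rn R n =>
    f (tcons (q.1.1, q.2)) * frft_kernel alpha q.2 q.1.2).
  apply: cmeasM; last first.
    apply: cmeas_frft_kernel => //.
    exact: (measurableT_comp measurable_snd measurable_fst).
  apply: (cmeas_comp (h := fun q : (L * Rn R n) * Rn R n => (q.1.1, q.2)) _ mft).
  apply/measurable_fun_pairP; split; last exact: measurable_snd.
  exact: (measurableT_comp measurable_fst measurable_fst).
have mW : cmeas (fun p : L * Rn R n => frft_L1 alpha (fun t => f (tcons (p.1, t))) p.2).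
  exact: (cmeas_param (lebesgue R n) mV).
transitivity (\int[lebesgue R n]_xi' energy mu1
    (fun x => frft_L1 alpha (fun t => f (tcons (x, t))) xi'))%E.
  apply: eq_integral => xi' _.
  rewrite -(frft1_energy s0 (cintegrable_frft_slice alpha xi' fi)).
  by apply: eq_integral => xi _; rewrite frft_L1_tcons.
rewrite energy_tcons//.
transitivity (\int[mu1]_x energy (lebesgue R n)
    (frft_L1 alpha (fun t => f (tcons (x, t)))))%E.
  symmetry; apply: (@tonelli _ _ _ _ _ mu1 (lebesgue R n)
    (fun p => (normc (frft_L1 alpha (fun t => f (tcons (p.1, t))) p.2) ^+ 2)%:E)).
    exact: measurable_energy.
  by move=> p; rewrite lee_fin sqr_ge0.
apply: ae_eq_integral => //.
- apply: (@measurable_fun_fubini_tonelli_F _ _ _ _ _ (lebesgue R n)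
    (fun p => (normc (frft_L1 alpha (fun t => f (tcons (p.1, t))) p.2) ^+ 2)%:E)).
    exact: measurable_energy.
  by move=> p; rewrite lee_fin sqr_ge0.
- apply: (@measurable_fun_fubini_tonelli_F _ _ _ _ _ (lebesgue R n)
    (fun p => (normc (f (tcons p)) ^+ 2)%:E)).
    exact: measurable_energy.
  by move=> p; rewrite lee_fin sqr_ge0.
- apply: (@filterS _ _ (ae_filter_ringOfSetsType mu1) _ _ _ (ae_cintegrable_slice fi)).
  by move=> x xi_ _; exact: IHn.
Qed.

End frft_energy.

(** * Square-integrable functions *)

Section square_integrable.
Context d (T : measurableType d) {R : realType}.
Variable mu : {measure set T -> \bar R}.
Implicit Types f g h : T -> R[i].

Definition L2 f := cmeas f /\ (energy mu f < +oo)%E.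

Definition l2 f : R := Num.sqrt (fine (energy mu f)).

Lemma energy_ge0 f : (0 <= energy mu f)%E.
Proof. by apply: integral_ge0 => x _; rewrite lee_fin sqr_ge0. Qed.

Lemma l2_ge0 f : 0 <= l2 f.
Proof. exact: sqrtr_ge0. Qed.

Lemma l2_sqr f : L2 f -> (l2 f ^+ 2)%:E = energy mu f.
Proof.
move=> [mf fi]; rewrite sqr_sqrtr ?fine_ge0 ?energy_ge0//.
by rewrite fineK// ge0_fin_numE// energy_ge0.
Qed.

Lemma l2_sqr_fine f : l2 f ^+ 2 = fine (energy mu f).
Proof. by rewrite sqr_sqrtr// fine_ge0// energy_ge0. Qed.

Lemma eq_energy f g : (forall x, normc (f x) = normc (g x)) ->
  energy mu f = energy mu g.
Proof. by move=> fg; apply: eq_integral => x _; rewrite fg. Qed.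

Lemma eq_l2 f g : (forall x, normc (f x) = normc (g x)) -> l2 f = l2 g.
Proof. by move=> fg; rewrite /l2 (eq_energy fg). Qed.

Lemma energy_l2 f g : energy mu f = energy mu g -> l2 f = l2 g.
Proof. by rewrite /l2 => ->. Qed.

Lemma L2_modulus f g : cmeas g -> (forall x, normc (g x) = normc (f x)) ->
  L2 f -> L2 g.
Proof. by move=> mg fg [mf fi]; split => //; rewrite (eq_energy fg). Qed.

Lemma L2_le f g : cmeas g -> (forall x, normc (g x) <= normc (f x)) ->
  L2 f -> L2 g.
Proof.
move=> mg gf [mf fi]; split => //; apply: le_lt_trans fi.
apply: ge0_le_integral => //.
- by move=> x _; rewrite lee_fin sqr_ge0.
- exact: measurable_energy.
- exact: measurable_energy.
- by move=> x _; rewrite lee_fin lerXn2r ?nnegrE ?normc_ge0.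
Qed.

Lemma L2D f g : L2 f -> L2 g -> L2 (fun x => f x + g x).
Proof.
move=> [mf fi] [mg gi]; split; first exact: cmeasD.
apply: (@le_lt_trans _ _ (\int[mu]_x (2%:E * (normc (f x) ^+ 2)%:E + 2%:E * (normc (g x) ^+ 2)%:E))%E).
  apply: ge0_le_integral => //.
  - by move=> x _; rewrite lee_fin sqr_ge0.
  - by apply: measurable_energy; exact: cmeasD.
  - by apply: emeasurable_funD; apply: emeasurable_funM => //; exact: measurable_energy.
  - by move=> x _; rewrite -!EFinM -EFinD lee_fin normcD2.
have Z h : cmeas h -> (\int[mu]_x (2%:E * (normc (h x) ^+ 2)%:E) = 2%:E * energy mu h)%E.
  move=> mh; rewrite ge0_integralZl_EFin//.
  - by move=> x _; rewrite lee_fin sqr_ge0.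
  - exact: measurable_energy.
rewrite ge0_integralD//.
- by rewrite !Z// lte_add_pinfty// lte_mul_pinfty// ?energy_ge0.
- by move=> x _; rewrite -EFinM lee_fin mulr_ge0// sqr_ge0.
- by apply: emeasurable_funM => //; exact: measurable_energy.
- by move=> x _; rewrite -EFinM lee_fin mulr_ge0// sqr_ge0.
- by apply: emeasurable_funM => //; exact: measurable_energy.
Qed.

Lemma energyZ c f : cmeas f ->
  energy mu (fun x => c * f x) = ((normc c ^+ 2)%:E * energy mu f)%E.
Proof.
move=> mf; rewrite /energy -ge0_integralZl_EFin ?sqr_ge0//.
- by apply: eq_integral => x _; rewrite normcM exprMn EFinM.
- by move=> x _; rewrite lee_fin sqr_ge0.
- exact: measurable_energy.
Qed.

Lemma L2Z c f : L2 f -> L2 (fun x => c * f x).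
Proof.
move=> [mf fi]; split; first by apply: cmeasM => //; exact: cmeas_cst.
by rewrite energyZ// lte_mul_pinfty ?lee_fin ?sqr_ge0.
Qed.

Lemma l2Z c f : L2 f -> l2 (fun x => c * f x) = normc c * l2 f.
Proof.
move=> Lf; apply: sqr_inj_ge0; rewrite ?mulr_ge0 ?l2_ge0 ?normc_ge0//.
apply: EFin_inj; rewrite l2_sqr; last exact: L2Z.
by rewrite energyZ; [rewrite -l2_sqr// -EFinM exprMn|exact: Lf.1].
Qed.

Lemma L2N f : L2 f -> L2 (fun x => - f x).
Proof.
by move=> Lf; apply: (L2_modulus _ _ Lf) => [|x]; [exact: cmeasN Lf.1|rewrite normcN].
Qed.

Lemma L2B f g : L2 f -> L2 g -> L2 (fun x => f x - g x).
Proof. by move=> Lf Lg; apply: L2D => //; exact: L2N. Qed.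

Lemma l2_distC f g : l2 (fun x => f x - g x) = l2 (fun x => g x - f x).
Proof. by apply: eq_l2 => x; rewrite -normcN opprB. Qed.

Lemma Lnorm2_energy f :
  'N[mu]_2%:E[EFin \o @normc R \o f]%E = (energy mu f `^ 2^-1)%E.
Proof.
rewrite unlock /Lnorm; congr (_ `^ _)%E; apply: eq_integral => x _ /=.
by rewrite ger0_norm ?normc_ge0// powR_mulrn// normc_ge0.
Qed.

Lemma l2_Lnorm f : L2 f -> 'N[mu]_2%:E[EFin \o @normc R \o f]%E = (l2 f)%:E.
Proof.
move=> [mf fi]; rewrite Lnorm2_energy -(@fineK _ (energy mu f)) ?ge0_fin_numE ?energy_ge0//.
by rewrite poweR_EFin powR12_sqrt// fine_ge0// energy_ge0.
Qed.

(** Cauchy-Schwarz for the moduli. *)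
Lemma integral_normcM_le f g : L2 f -> L2 g ->
  (\int[mu]_x (normc (f x * g x))%:E <= (l2 f * l2 g)%:E)%E.
Proof.
move=> Lf Lg; have mf := measurable_normc Lf.1; have mg := measurable_normc Lg.1.
have h2 : (2^-1 + 2^-1 = 1 :> R) by field.
have := hoelder mu mf mg (ltr0n _ 2) (ltr0n _ 2) h2.
rewrite Lnorm1.
rewrite -[X in (_ <= X * _)%E]/('N[mu]_2%:E[EFin \o @normc R \o f])%E.
rewrite -[X in (_ <= _ * X)%E]/('N[mu]_2%:E[EFin \o @normc R \o g])%E.
rewrite !l2_Lnorm// -EFinM; apply: le_trans.
rewrite le_eqVlt; apply/orP; left; apply/eqP; apply: eq_integral => x _ /=.
by rewrite ger0_norm ?mulr_ge0 ?normc_ge0// normcM.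
Qed.

Lemma cintegrable_L2M f g : L2 f -> L2 g -> cintegrable mu (fun x => f x * g x).
Proof.
move=> Lf Lg; split; first by apply: cmeasM; [exact: Lf.1|exact: Lg.1].
by apply: le_lt_trans (integral_normcM_le Lf Lg) _; rewrite ltry.
Qed.

Definition ip f g : R[i] := cint mu (fun x => f x * cconj (g x)).

Lemma L2J f : L2 f -> L2 (fun x => cconj (f x)).
Proof.
by move=> Lf; apply: (L2_modulus _ _ Lf) => [|x]; [exact: cmeasJ Lf.1|rewrite normcJ].
Qed.

Lemma cintegrable_ip f g : L2 f -> L2 g -> cintegrable mu (fun x => f x * cconj (g x)).
Proof. by move=> Lf Lg; apply: cintegrable_L2M => //; exact: L2J. Qed.

Lemma ipC f g : L2 f -> L2 g -> ip g f = cconj (ip f g).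
Proof.
move=> Lf Lg; rewrite /ip -cintJ; last exact: cintegrable_ip.
by apply: eq_cint => x; rewrite conjM cconjK mulrC.
Qed.

Lemma ipDl f g h : L2 f -> L2 g -> L2 h -> ip (fun x => f x + g x) h = ip f h + ip g h.
Proof.
move=> Lf Lg Lh; rewrite /ip -cintD; try exact: cintegrable_ip.
by apply: eq_cint => x; rewrite mulrDl.
Qed.

Lemma ipBl f g h : L2 f -> L2 g -> L2 h -> ip (fun x => f x - g x) h = ip f h - ip g h.
Proof.
move=> Lf Lg Lh; rewrite /ip -cintB; try exact: cintegrable_ip.
by apply: eq_cint => x; rewrite mulrBl.
Qed.

Lemma ipBr f g h : L2 f -> L2 g -> L2 h -> ip f (fun x => g x - h x) = ip f g - ip f h.
Proof.
move=> Lf Lg Lh; rewrite /ip -cintB; try exact: cintegrable_ip.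
by apply: eq_cint => x; rewrite conjD conjN mulrBr.
Qed.

Lemma ipxx f : L2 f -> ip f f = (l2 f ^+ 2)%:C.
Proof.
move=> Lf.
have -> : ip f f = cint mu (fun x => (normc (f x) ^+ 2)%:C).
  by apply: eq_cint => x; rewrite mulcJ.
apply: complexP => /=; last by rewrite /Rintegral integral0.
apply: EFin_inj; rewrite (l2_sqr Lf) /Rintegral fineK//.
by rewrite ge0_fin_numE ?energy_ge0//; exact: Lf.2.
Qed.

Lemma normc_ip f g : L2 f -> L2 g -> normc (ip f g) <= l2 f * l2 g.
Proof.
move=> Lf Lg; rewrite -lee_fin; apply: le_trans (le_normc_cint _ _) _.
  exact: (cintegrable_ip Lf Lg).1.
apply: le_trans (integral_normcM_le Lf (L2J Lg)) _.
by rewrite (@eq_l2 (fun x => cconj (g x)) g)// => x; rewrite normcJ.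
Qed.

Lemma l2D_sqr f g : L2 f -> L2 g ->
  l2 (fun x => f x + g x) ^+ 2 = l2 f ^+ 2 + l2 g ^+ 2 + 2 * complex.Re (ip f g).
Proof.
move=> Lf Lg; have LD := L2D Lf Lg.
have := ipxx LD; move=> /(congr1 (@complex.Re R)).
rewrite [RHS]/= => <-.
have E : ip (fun x => f x + g x) (fun x => f x + g x) = ip f f + ip g f + (ip f g + ip g g).
  rewrite ipDl// (ipC LD Lf) (ipC LD Lg) !ipDl// !conjD.
  by rewrite -!(ipC _ Lf)// -!(ipC _ Lg)//; ring.
rewrite E !ReD !ipxx// (ipC Lf Lg) ReJ [X in X + _ + _ = _]/= [X in _ + (_ + X) = _]/=.
by ring.
Qed.

Lemma l2D f g : L2 f -> L2 g -> l2 (fun x => f x + g x) <= l2 f + l2 g.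
Proof.
move=> Lf Lg; rewrite -(@ler_pXn2r _ 2) ?nnegrE ?addr_ge0 ?l2_ge0//.
rewrite l2D_sqr// sqrrD.
have : complex.Re (ip f g) <= l2 f * l2 g.
  by apply: le_trans (normc_ip Lf Lg); apply: le_trans (ler_norm _) (le_Re_normc _).
by rewrite -mulr_natl; lra.
Qed.

Lemma l2B_le f g h : L2 f -> L2 g -> L2 h ->
  l2 (fun x => f x - h x) <= l2 (fun x => f x - g x) + l2 (fun x => g x - h x).
Proof.
move=> Lf Lg Lh; apply: le_trans (l2D (L2B Lf Lg) (L2B Lg Lh)).
by rewrite le_eqVlt; apply/orP; left; apply/eqP; apply: eq_l2 => x; congr normc; ring.
Qed.

Lemma l2_dist f g : L2 f -> L2 g -> `|l2 f - l2 g| <= l2 (fun x => f x - g x).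
Proof.
move=> Lf Lg.
have h1 : l2 f <= l2 (fun x => f x - g x) + l2 g.
  apply: le_trans (l2D (L2B Lf Lg) Lg).
  by rewrite le_eqVlt; apply/orP; left; apply/eqP; apply: eq_l2 => x; congr normc; ring.
have h2 : l2 g <= l2 (fun x => f x - g x) + l2 f.
  rewrite l2_distC; apply: le_trans (l2D (L2B Lg Lf) Lf).
  by rewrite le_eqVlt; apply/orP; left; apply/eqP; apply: eq_l2 => x; congr normc; ring.
by rewrite ler_norml; apply/andP; split; lra.
Qed.

Lemma energy0 : energy mu (fun=> 0) = 0%E.
Proof. by rewrite /energy; under eq_integral do rewrite normc_zero expr0n/=; rewrite integral0. Qed.

Lemma l2_subrr f : l2 (fun x => f x - f x) = 0.
Proof.
rewrite (@eq_l2 _ (fun=> 0)); last by move=> x; rewrite subrr.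
by rewrite /l2 energy0 sqrtr0.
Qed.

End square_integrable.

Section l2_complete.
Context d (T : measurableType d) {R : realType}.
Variable mu : {measure set T -> \bar R}.
Implicit Types f g h : T -> R[i].
Local Notation L2 := (L2 mu).
Local Notation l2 := (l2 mu).

Lemma l2_le f (e : R) : 0 <= e -> cmeas f -> (energy mu f <= (e ^+ 2)%:E)%E ->
  L2 f /\ l2 f <= e.
Proof.
move=> e0 mf fe; have Lf : L2 f by split => //; apply: le_lt_trans fe _; rewrite ltry.
split => //; rewrite -(@ler_pXn2r _ 2) ?nnegrE ?l2_ge0//.
by rewrite -lee_fin l2_sqr.
Qed.

(** Square-integrable functions are approximated by their truncations to
    [1/k <= |f|], which are integrable. *)
Lemma L2_dense f (e : R) : 0 < e -> L2 f ->
  exists h, [/\ cintegrable mu h, L2 h & l2 (fun x => h x - f x) <= e].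
Proof.
move=> e0 Lf; have [mf fi] := Lf.
pose r k : R := k.+1%:R^-1.
have r0 k : 0 < r k by rewrite invr_gt0.
pose h k x := if r k <= normc (f x) then f x else 0.
have mn := measurable_normc mf.
have mb k : measurable_fun setT (fun x => r k <= normc (f x)).
  exact: measurable_fun_ler.
have mh k : cmeas (h k).
  split.
    rewrite (_ : (fun _ => _) = (fun x => if r k <= normc (f x) then complex.Re (f x) else 0)).
      by apply: measurable_fun_ifT => //; exact: mf.1.
    by apply/funext => x; rewrite /h; case: ifP.
  rewrite (_ : (fun _ => _) = (fun x => if r k <= normc (f x) then complex.Im (f x) else 0)).
    by apply: measurable_fun_ifT => //; exact: mf.2.
  by apply/funext => x; rewrite /h; case: ifP.
have hi k : cintegrable mu (h k).
  apply: (@le_cintegrable _ _ _ _ _ (fun x => (r k)^-1 * normc (f x) ^+ 2)) => //.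
  - move=> x; rewrite /h; case: ifPn => [rk|_].
      by rewrite ler_pdivlMl// expr2 ler_wpM2r ?normc_ge0.
    by rewrite normc_zero mulr_ge0 ?invr_ge0 ?sqr_ge0// ltW.
  - by apply: measurable_funM => //; exact: measurable_normc2.
  - under eq_integral do rewrite EFinM.
    rewrite ge0_integralZl_EFin ?invr_ge0 ?(ltW (r0 _))//.
    + by rewrite lte_mul_pinfty// lee_fin invr_ge0 ltW.
    + by move=> x _; rewrite lee_fin sqr_ge0.
    + exact: measurable_energy.
have hL k : L2 (h k).
  apply: (L2_le (mh k) _ Lf) => x; rewrite /h; case: ifPn => // _.
  by rewrite normc_zero normc_ge0.
pose u k x := (normc (h k x - f x) ^+ 2)%:E.
have uE k x : u k x = if r k <= normc (f x) then 0%E else (normc (f x) ^+ 2)%:E.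
  rewrite /u /h; case: ifP => _; first by rewrite subrr normc_zero expr0n.
  by rewrite sub0r normcN.
have [|||||_ _] := @dominated_convergence _ _ _ mu setT measurableT u (cst 0%E)
    (fun x => (normc (f x) ^+ 2)%:E).
- by move=> k; apply: measurable_energy; exact: cmeasB.
- exact: measurable_cst.
- apply: aeW => x _; have [f0|f0] := eqVneq (normc (f x)) 0.
    under eq_fun do rewrite uE f0 expr0n/= if_same.
    exact: cvg_cst.
  have fx0 : 0 < normc (f x) by rewrite lt0r f0 normc_ge0.
  apply: cvg_near_cst; have := near_infty_natSinv_lt (PosNum fx0).
  by apply: filterS => k /= /ltW rk; rewrite uE /r rk.
- apply/integrableP; split; first exact: measurable_energy.
  by under eq_integral do rewrite gee0_abs ?lee_fin ?sqr_ge0//.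
- apply: aeW => x k _; rewrite gee0_abs; last by rewrite lee_fin sqr_ge0.
  by rewrite uE; case: ifP => // _; rewrite lee_fin sqr_ge0.
rewrite integral0 => cv.
have e2 : 0 < e ^+ 2 by rewrite exprn_gt0.
have [k _ /(_ k (leqnn k)) hk] := cvgr_lt _ (fine_cvg cv) _ e2.
have {}hk : (energy mu (fun x => (h k x - f x)%R) < (e ^+ 2)%:E)%E.
  by rewrite -(l2_sqr (L2B (hL k) Lf)) lte_fin l2_sqr_fine.
exists (h k); split => //.
by have [_ ->] := l2_le (ltW e0) (cmeasB (mh k) mf) (ltW hk).
Qed.

Lemma fast_cauchy_cvg (u : R^nat) (s : R) : 0 <= s ->
  (forall k, `|u k.+1 - u k| <= s * 2^-1 ^+ k) -> cvgn u.
Proof.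
move=> s0 us.
have cs : cvgn (series (telescope u)).
  apply: normed_cvg; apply: (@series_le_cvg _ _ (geometric s 2^-1)).
  - by move=> k; exact: normr_ge0.
  - by move=> k; rewrite /geometric/= mulr_ge0// exprn_ge0.
  - by move=> k; exact: us.
  - apply: is_cvg_geometric_series.
    by rewrite ger0_norm// invf_lt1// ltr1n.
have -> : u = (fun k => u 0%N + series (telescope u) k).
  by apply/funext => k; exact: eq_sum_telescope.
by apply: is_cvgD => //; exact: is_cvg_cst.
Qed.

Lemma measurable_fine_limn_esup (v : nat -> T -> R) :
  (forall k, measurable_fun setT (v k)) ->
  measurable_fun setT (fun x => fine (limn_esup (fun k => (v k x)%:E))).
Proof.
move=> mv; apply: measurableT_comp => //; apply: measurable_fun_limn_esup => k.
exact/measurable_EFinP.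
Qed.

Lemma fine_limn_esupE (v : R^nat) : cvgn v ->
  v @ \oo --> fine (limn_esup (fun k => (v k)%:E)).
Proof.
move=> cv; have cE : (v k)%:E @[k --> \oo] --> (limn v)%:E.
  by apply: cvg_comp cv _; exact: cvg_id.
by have /cvg_limn_einf_sup[_ ->] := cE.
Qed.

Lemma ae_lty (S : T -> \bar R) : measurable_fun setT S -> (forall x, 0 <= S x)%E ->
  (\int[mu]_x S x < +oo)%E -> {ae mu, forall x, (S x < +oo)%E}.
Proof.
move=> mS S0 Si.
have iS : mu.-integrable setT S.
  apply/integrableP; split => //.
  by under eq_integral do rewrite gee0_abs//.
apply: filterS (integrable_ae measurableT iS) => x /(_ I).
by rewrite ge0_fin_numE.
Qed.

Lemma sum_geometric_le (N : nat) : \sum_(0 <= k < N) (4 / 9) ^+ k <= 9 / 5 :> R.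
Proof.
have -> : \sum_(0 <= k < N) (4 / 9) ^+ k = 9 / 5 * (1 - (4 / 9) ^+ N) :> R.
  elim: N => [|N IH]; first by rewrite big_nil expr0 subrr mulr0.
  by rewrite big_nat_recr//= IH exprS; field.
by rewrite ler_piMr// gerBl exprn_ge0.
Qed.

(** Riesz-Fischer, for sequences converging fast: the weighted sum of the
    squared increments is integrable, so that the increments decay geometrically
    almost everywhere. *)
Lemma L2_complete (g : nat -> T -> R[i]) :
  (forall k, L2 (g k)) ->
  (forall k, l2 (fun x => g k.+1 x - g k x) <= 3^-1 ^+ k) ->
  exists2 G, L2 G & forall k, l2 (fun x => G x - g k x) <= 3 / 2 * 3^-1 ^+ k.
Proof.
move=> gL gd.
have mg k := (gL k).1.
have dL k : L2 (fun x => g k.+1 x - g k x) by exact: L2B.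
pose a k x : \bar R := (4 ^+ k * normc (g k.+1 x - g k x) ^+ 2)%:E.
have a0 k x : (0 <= a k x)%E by rewrite lee_fin mulr_ge0 ?sqr_ge0// exprn_ge0.
have ma k : measurable_fun setT (a k).
  apply/measurable_EFinP; apply: measurable_funM => //.
  by apply: measurable_normc2; exact: cmeasB.
pose S x := (\sum_(k <oo) a k x)%E.
have mS : measurable_fun setT S by apply: ge0_emeasurable_sum.
have S0 x : (0 <= S x)%E by apply: nneseries_ge0.
have ai k : (\int[mu]_x a k x <= ((4 / 9) ^+ k)%:E)%E.
  rewrite /a; under eq_integral do rewrite EFinM.
  rewrite ge0_integralZl_EFin ?exprn_ge0//; last 2 first.
  - by move=> x _; rewrite lee_fin sqr_ge0.
  - by apply: measurable_energy; exact: cmeasB.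
  rewrite -[X in (_ * X)%E]/(energy mu _) -(l2_sqr (dL k)) -EFinM lee_fin.
  rewrite expr_div_n ler_wpM2l ?exprn_ge0//.
  have -> : (9 ^+ k)^-1 = (3^-1 ^+ k) ^+ 2 :> R.
    rewrite -exprM mulnC exprM -exprVn; congr (_ ^+ k).
    by field.
  by rewrite lerXn2r ?nnegrE ?l2_ge0// exprn_ge0.
have Si : (\int[mu]_x S x < +oo)%E.
  rewrite integral_nneseries//; apply: (@le_lt_trans _ _ (9 / 5)%:E); last exact: ltry.
  apply: lime_le.
    by apply: is_cvg_nneseries => k _ _; exact: integral_ge0.
  apply: nearW => N; apply: le_trans (_ : _ <= \sum_(0 <= k < N) ((4 / 9) ^+ k)%:E)%E _.
    by apply: lee_sum => k _; exact: ai.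
  by rewrite sumEFin lee_fin sum_geometric_le.
have aeS := ae_lty mS S0 Si.
pose reS x := fine (limn_esup (fun k => (complex.Re (g k x))%:E)).
pose imS x := fine (limn_esup (fun k => (complex.Im (g k x))%:E)).
pose G x : R[i] := reS x +i* imS x.
have mG : cmeas G.
  by split; apply: measurable_fine_limn_esup => k; [exact: (mg k).1|exact: (mg k).2].
have cvG : {ae mu, forall x, complex.Re (g k x) @[k --> \oo] --> reS x /\
    complex.Im (g k x) @[k --> \oo] --> imS x}.
  apply: filterS aeS => x Sx.
  have s0 : 0 <= fine (S x) by rewrite fine_ge0.
  have ds k : normc (g k.+1 x - g k x) <= Num.sqrt (fine (S x)) * 2^-1 ^+ k.
    rewrite -(@ler_pXn2r _ 2) ?nnegrE ?normc_ge0 ?mulr_ge0 ?sqrtr_ge0 ?exprn_ge0//.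
    rewrite exprMn sqr_sqrtr// -exprM mulnC exprM.
    have -> : (2^-1 ^+ 2) ^+ k = (4 ^+ k)^-1 :> R.
      by rewrite -exprVn; congr (_ ^+ k); field.
    rewrite ler_pdivlMr ?exprn_gt0// mulrC -lee_fin fineK ?ge0_fin_numE//.
    rewrite -[leLHS]/(a k x); apply: le_trans (nneseries_lim_ge k.+1 _); last by [].
    by rewrite big_nat_recr//= leeDr// sume_ge0.
  split; apply: fine_limn_esupE.
  - apply: (fast_cauchy_cvg (sqrtr_ge0 (fine (S x)))) => k; apply: le_trans (ds k).
    by rewrite -ReN -ReD; exact: le_Re_normc.
  - apply: (fast_cauchy_cvg (sqrtr_ge0 (fine (S x)))) => k; apply: le_trans (ds k).
    by rewrite -ImN -ImD; exact: le_Im_normc.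
have gd2 k j : l2 (fun x => g (k + j)%N x - g k x) <=
    3 / 2 * (3^-1 ^+ k - 3^-1 ^+ (k + j)).
  elim: j => [|j IH].
    by rewrite addn0 l2_subrr subrr mulr0.
  apply: le_trans (l2B_le (gL _) (gL (k + j)%N) (gL _)) _; rewrite addnS.
  apply: le_trans (lerD (gd (k + j)%N) IH) _.
  by rewrite [in leRHS]exprS; lra.
have bound k : L2 (fun x => G x - g k x) /\ l2 (fun x => G x - g k x) <= 3 / 2 * 3^-1 ^+ k.
  apply: l2_le; [by rewrite mulr_ge0 ?exprn_ge0|exact: cmeasB|].
  apply: (@fatou_bound _ _ _ mu (fun j x => normc (g (k + j)%N x - g k x) ^+ 2)).
  - by move=> j; apply: measurable_normc2; exact: cmeasB.
  - by apply: measurable_normc2; exact: cmeasB.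
  - by move=> j x; exact: sqr_ge0.
  - apply: filterS cvG => x [cR cI].
    have sR : complex.Re (g (k + j)%N x) @[j --> \oo] --> reS x.
      by move: cR; rewrite -(cvg_shiftn k); under eq_fun do rewrite addnC.
    have sI : complex.Im (g (k + j)%N x) @[j --> \oo] --> imS x.
      by move: cI; rewrite -(cvg_shiftn k); under eq_fun do rewrite addnC.
    under eq_fun do rewrite normc2E ReD ImD ReN ImN.
    rewrite normc2E ReD ImD ReN ImN.
    apply: cvgD.
    + apply: (@continuous_cvg _ _ _ _ _ _ (fun y : R => y ^+ 2)); first exact: exprn_continuous.
      by apply: cvgD => //; exact: cvg_cst.
    + apply: (@continuous_cvg _ _ _ _ _ _ (fun y : R => y ^+ 2)); first exact: exprn_continuous.
      by apply: cvgD => //; exact: cvg_cst.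
  - move=> j; have Lj := L2B (gL (k + j)%N) (gL k).
    apply: le_trans (_ : energy mu (fun x => (g (k + j)%N x - g k x)%R) <= _)%E; first by [].
    rewrite -(l2_sqr Lj) lee_fin; apply: lerXn2r; rewrite ?nnegrE ?l2_ge0// ?mulr_ge0 ?exprn_ge0//.
    by apply: le_trans (gd2 k j) _; rewrite ler_wpM2l// gerBl exprn_ge0.
exists G; last by move=> k; exact: (bound k).2.
have := L2D (bound 0%N).1 (gL 0%N); apply: L2_modulus => // x.
by rewrite subrK.
Qed.

End l2_complete.

(** * The fractional Fourier transform on L2 *)

Section frft_L2.
Context {R : realType} {n : nat}.
Local Notation mun := (lebesgue R n).
Local Notation V := (Rn R n).
Local Notation L2 := (L2 mun).
Local Notation l2 := (l2 mun).
Local Notation ip := (ip mun).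
Implicit Types (f g h : V -> R[i]) (alpha : R).

Definition L12 h := cintegrable mun h /\ L2 h.

Lemma frft_L1D alpha f g xi : cintegrable mun f -> cintegrable mun g ->
  frft_L1 alpha (fun t => f t + g t) xi = frft_L1 alpha f xi + frft_L1 alpha g xi.
Proof.
move=> fi gi; rewrite !frft_L1E -cintD; try exact: cintegrable_frft_integrand.
by apply: eq_cint => t; rewrite mulrDl.
Qed.

Lemma frft_L1Z alpha c f xi : cintegrable mun f ->
  frft_L1 alpha (fun t => c * f t) xi = c * frft_L1 alpha f xi.
Proof.
move=> fi; rewrite !frft_L1E -cintZl; last exact: cintegrable_frft_integrand.
by apply: eq_cint => t; rewrite mulrA.
Qed.

Lemma frft_L1B alpha f g xi : cintegrable mun f -> cintegrable mun g ->
  frft_L1 alpha (fun t => f t - g t) xi = frft_L1 alpha f xi - frft_L1 alpha g xi.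
Proof.
move=> fi gi; rewrite (_ : (fun t => _) = (fun t => f t + -1 * g t)); last first.
  by apply/funext => t; rewrite mulN1r.
by rewrite frft_L1D ?frft_L1Z ?mulN1r//; exact: cintegrableZl.
Qed.

Lemma L2_frft_L1 alpha h : sin alpha != 0 -> L12 h -> L2 (frft_L1 alpha h).
Proof.
move=> s0 [hi Lh]; split; first exact: cmeas_frft_L1 hi.1.
by rewrite frft_L1_energy//; exact: Lh.2.
Qed.

Lemma l2_frft_L1 alpha h : sin alpha != 0 -> cintegrable mun h ->
  l2 (frft_L1 alpha h) = l2 h.
Proof. by move=> s0 hi; rewrite /l2 frft_L1_energy. Qed.

Lemma l2_frft_L1B alpha h h' : sin alpha != 0 -> L12 h -> L12 h' ->
  l2 (fun xi => frft_L1 alpha h xi - frft_L1 alpha h' xi) =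
  l2 (fun t => h t - h' t).
Proof.
move=> s0 [hi Lh] [hi' Lh'].
have bi : cintegrable mun (fun t => h t - h' t).
  by apply: cintegrableD => //; exact: cintegrableN.
rewrite -(l2_frft_L1 s0 bi); apply: eq_l2 => xi.
by rewrite frft_L1B.
Qed.

(** The graph of the transform on L2, as the closure of its graph on [L1 n L2].
    Unlike the chosen value [frft alpha f], this relation does not depend on
    representatives, and it can be transported along isometries. *)
Definition frel alpha f g := [/\ L2 f, L2 g & forall e : R, 0 < e ->
  exists h, [/\ L12 h, l2 (fun t => h t - f t) <= e
             & l2 (fun xi => frft_L1 alpha h xi - g xi) <= e]].

Lemma le0_eps (x : R) : 0 <= x -> (forall e : R, 0 < e -> x <= e) -> x = 0.
Proof.
move=> x0 xe; apply/eqP; rewrite eq_le x0 andbT leNgt; apply/negP => xp.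
by have := xe (x / 2) (divr_gt0 xp (ltr0n _ 2)); lra.
Qed.

Lemma frel_l2 alpha f g : sin alpha != 0 -> frel alpha f g -> l2 g = l2 f.
Proof.
move=> s0 [Lf Lg fg]; apply/eqP; rewrite -subr_eq0 -normr_eq0; apply/eqP.
apply: le0_eps => // e e0.
have [h [Hh hf hg]] := fg (e / 2) (divr_gt0 e0 (ltr0n _ 2)).
have LF := L2_frft_L1 s0 Hh; have [hi Lh] := Hh.
have h1 := l2_dist Lh Lf; have h2 := l2_dist LF Lg.
rewrite (l2_frft_L1 s0 hi) in h2.
have -> : l2 g - l2 f = (l2 h - l2 f) - (l2 h - l2 g) by ring.
by apply: le_trans (ler_normB _ _) _; lra.
Qed.

Lemma frel_L1 alpha h : sin alpha != 0 -> L12 h -> frel alpha h (frft_L1 alpha h).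
Proof.
move=> s0 Hh; have [hi Lh] := Hh.
split => //; first exact: L2_frft_L1.
by move=> e /ltW e0; exists h; split => //; rewrite l2_subrr.
Qed.

Lemma L12D h h' : L12 h -> L12 h' -> L12 (fun t => h t + h' t).
Proof. by move=> [hi Lh] [hi' Lh']; split; [exact: cintegrableD|exact: L2D]. Qed.

Lemma L12Z c h : L12 h -> L12 (fun t => c * h t).
Proof. by move=> [hi Lh]; split; [exact: cintegrableZl|exact: L2Z]. Qed.

Lemma frelD alpha f g f' g' : sin alpha != 0 -> frel alpha f g -> frel alpha f' g' ->
  frel alpha (fun t => f t + f' t) (fun xi => g xi + g' xi).
Proof.
move=> s0 [Lf Lg fg] [Lf' Lg' fg']; split; [exact: L2D|exact: L2D|move=> e e0].
have e2 := divr_gt0 e0 (ltr0n R 2).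
have [h [Hh hf hg]] := fg _ e2; have [h' [Hh' hf' hg']] := fg' _ e2.
have [hi Lh] := Hh; have [hi' Lh'] := Hh'.
have LF := L2_frft_L1 s0 Hh; have LF' := L2_frft_L1 s0 Hh'.
exists (fun t => h t + h' t); split; first exact: L12D.
- apply: le_trans (_ : l2 (fun t => (h t - f t) + (h' t - f' t)) <= _).
    by rewrite le_eqVlt; apply/orP; left; apply/eqP; apply: eq_l2 => t; congr normc; ring.
  by apply: le_trans (l2D (L2B Lh Lf) (L2B Lh' Lf')) _; lra.
- apply: le_trans (_ : l2 (fun xi => (frft_L1 alpha h xi - g xi) +
      (frft_L1 alpha h' xi - g' xi)) <= _).
    rewrite le_eqVlt; apply/orP; left; apply/eqP; apply: eq_l2 => t; congr normc.
    by rewrite frft_L1D//; ring.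
  by apply: le_trans (l2D (L2B LF Lg) (L2B LF' Lg')) _; lra.
Qed.

Lemma frelZ alpha c f g : sin alpha != 0 -> frel alpha f g ->
  frel alpha (fun t => c * f t) (fun xi => c * g xi).
Proof.
move=> s0 [Lf Lg fg]; split; [exact: L2Z|exact: L2Z|move=> e e0].
have c1 : 0 < normc c + 1 by have := normc_ge0 c; lra.
have [h [Hh hf hg]] := fg _ (divr_gt0 e0 c1).
have [hi Lh] := Hh; have LF := L2_frft_L1 s0 Hh.
have le_e x : 0 <= x -> x <= e / (normc c + 1) -> normc c * x <= e.
  move=> x0 xe; have := normc_ge0 c => c0.
  apply: le_trans (_ : (normc c + 1) * x <= _); first by rewrite ler_wpM2r// lerDl.
  by rewrite mulrC -ler_pdivlMr.
exists (fun t => c * h t); split; first exact: L12Z.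
- rewrite (@eq_l2 _ _ _ mun _ (fun t => c * (h t - f t))); last first.
    by move=> t; rewrite mulrBr.
  by rewrite l2Z; [apply: le_e => //; exact: l2_ge0|exact: L2B].
- rewrite (@eq_l2 _ _ _ mun _ (fun t => c * (frft_L1 alpha h t - g t))); last first.
    by move=> t; rewrite frft_L1Z// mulrBr.
  by rewrite l2Z; [apply: le_e => //; exact: l2_ge0|exact: L2B].
Qed.

Lemma frelB alpha f g f' g' : sin alpha != 0 -> frel alpha f g -> frel alpha f' g' ->
  frel alpha (fun t => f t - f' t) (fun xi => g xi - g' xi).
Proof.
move=> s0 fg /(frelZ (-1) s0) fg'; have := frelD s0 fg fg'.
have -> : (fun t => f t + -1 * f' t) = (fun t => f t - f' t).
  by apply/funext => t; rewrite mulN1r.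
by have -> : (fun t => g t + -1 * g' t) = (fun t => g t - g' t) by
  apply/funext => t; rewrite mulN1r.
Qed.

Lemma frel_l2B alpha f g f' g' : sin alpha != 0 -> frel alpha f g -> frel alpha f' g' ->
  l2 (fun xi => g xi - g' xi) = l2 (fun t => f t - f' t).
Proof. by move=> s0 fg fg'; apply: (frel_l2 s0); exact: frelB. Qed.

Lemma frel_ae alpha f g f' g' : L2 f' -> L2 g' ->
  l2 (fun t => f t - f' t) = 0 -> l2 (fun xi => g xi - g' xi) = 0 ->
  sin alpha != 0 -> frel alpha f g -> frel alpha f' g'.
Proof.
move=> Lf' Lg' ff' gg' s0 [Lf Lg fg]; split => // e e0.
have [h [Hh hf hg]] := fg _ e0.
have [hi Lh] := Hh; have LF := L2_frft_L1 s0 Hh.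
exists h; split => //.
- by apply: le_trans (l2B_le Lh Lf Lf') _; rewrite ff' addr0.
- by apply: le_trans (l2B_le LF Lg Lg') _; rewrite gg' addr0.
Qed.

(** Take a sequence in [L1 n L2] that converges fast to [f]; its transforms form a
    fast Cauchy sequence because the transform is isometric. *)
Lemma frel_exists alpha f : sin alpha != 0 -> L2 f -> exists g, frel alpha f g.
Proof.
move=> s0 Lf.
have p3 k : 0 < (3^-1 ^+ k) / 2 :> R by rewrite divr_gt0// exprn_gt0.
have /choice[h hP] k : exists h, L12 h /\ l2 (fun t => h t - f t) <= 3^-1 ^+ k / 2.
  by have [h [hi Lh hf]] := L2_dense (p3 k) Lf; exists h.
have Hh k := (hP k).1; have Lh k := (Hh k).2; have hf k := (hP k).2.
have LF k := L2_frft_L1 s0 (Hh k).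
have [k|G LG GF] := L2_complete LF.
  rewrite (l2_frft_L1B s0 (Hh _) (Hh _)); apply: le_trans (l2B_le (Lh _) Lf (Lh _)) _.
  rewrite [X in _ + X <= _]l2_distC; apply: le_trans (lerD (hf _) (hf _)) _.
  rewrite exprS; have : 0 <= 3^-1 ^+ k :> R by rewrite exprn_ge0.
  by lra.
exists G; split => // e e0.
have : (fun k => 3 / 2 * 3^-1 ^+ k) @ \oo --> (3 / 2 * 0 : R).
  apply: cvgM; first exact: cvg_cst.
  by apply: cvg_expr; rewrite ger0_norm// invf_lt1// ltr1n.
rewrite mulr0 => cv.
have [k _ /(_ k (leqnn k)) hk] := cvgr_lt _ cv _ e0.
exists (h k); split => //.
- apply: le_trans (hf k) _; apply: le_trans (ltW hk).
  have : 0 <= 3^-1 ^+ k :> R by rewrite exprn_ge0.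
  by lra.
- by rewrite l2_distC; apply: le_trans (GF k) (ltW hk).
Qed.

End frft_L2.

Section conjugate_kernel.
Context {R : realType}.
Implicit Types alpha : R.

Lemma realcV (r : R) : (r%:C)^-1 = (r^-1)%:C.
Proof. by rewrite (fmorphV (real_complex R)). Qed.

(** The principal argument is odd away from the negative axis. *)
Lemma cpow_conj (z : R[i]) s : 0 < complex.Re z -> cpow (cconj z) s = cconj (cpow z s).
Proof.
move=> z0; rewrite /cpow conjM conj_real conj_expi normcJ; congr (_ * expi _).
rewrite -mulrN; congr (_ * _); rewrite /Carg normcJ ReJ ImJ.
have [I0|I0|I0] := ltgtP 0 (complex.Im z).
- by rewrite leNgt oppr_lt0 I0.
- by rewrite oppr_ge0 (ltW I0) opprK.
- have -> : normc z = complex.Re z.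
    apply: sqr_inj_ge0; rewrite ?normc_ge0 ?(ltW z0)//.
    by rewrite normc2E -I0 expr0n addr0.
  by rewrite divff ?gt_eqF// acos1 oppr0; case: ifP.
Qed.

Lemma cotN alpha : cot (- alpha) = - cot alpha.
Proof. by rewrite /cot cosN sinN invrN mulrN. Qed.

Lemma frft_constN n alpha : frft_const n (- alpha) = cconj (frft_const n alpha).
Proof.
have E : frft_base (- alpha) = cconj (frft_base alpha).
  rewrite /frft_base conjM realcV; congr (_ * _); last by rewrite conj_real.
  by apply: complexP; rewrite ?ReJ ?ImJ/= ?cotN.
rewrite !frft_constE E cpow_conj//.
rewrite /frft_base realcV ReM/= mul1r mulr0 subr0 invr_gt0.
by rewrite mulr_gt0// pi_gt0.
Qed.

Lemma frft_kernelN n alpha (t xi : Rn R n) :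
  frft_kernel (- alpha) xi t = cconj (frft_kernel alpha t xi).
Proof.
rewrite /frft_kernel frft_constN conjM conj_expi; congr (_ * expi _).
rewrite cotN /csc sinN invrN.
have -> : dotp xi t = dotp t xi by apply: eq_bigr => i _; rewrite mulrC.
by ring.
Qed.

Lemma sinN_neq0 alpha : sin alpha != 0 -> sin (- alpha) != 0.
Proof. by rewrite sinN oppr_eq0. Qed.

End conjugate_kernel.

Section adjoint.
Context {R : realType} {n : nat}.
Local Notation mun := (lebesgue R n).
Local Notation V := (Rn R n).
Local Notation L2 := (L2 mun).
Local Notation l2 := (l2 mun).
Local Notation ip := (ip mun).
Implicit Types (f g h u v : V -> R[i]) (alpha : R).

Lemma frft_L1_adjoint alpha h u : cintegrable mun h -> cintegrable mun u ->
  ip (frft_L1 alpha h) u = ip h (frft_L1 (- alpha) u).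
Proof.
move=> hi ui.
have E : cint mun (fun x => h x * cint mun (fun y => frft_kernel alpha x y * cconj (u y))) =
    cint mun (fun y => cint mun (fun x => h x * frft_kernel alpha x y) * cconj (u y)).
  apply: (@cint_kernel_adjoint _ _ _ _ _ mun mun (normc (frft_const n alpha))
    (fun p : V * V => frft_kernel alpha p.1 p.2) h (fun x => cconj (u x))
    (normc_ge0 _) _ _ hi (cintegrableJ ui)).
  - exact: cmeas_frft_kernel.
  - by move=> p; rewrite normc_frft_kernel.
rewrite /ip; transitivity (cint mun (fun y =>
    cint mun (fun x => h x * frft_kernel alpha x y) * cconj (u y))).
  by apply: eq_cint => x; rewrite frft_L1E.
rewrite -E; apply: eq_cint => t; congr (_ * _); rewrite frft_L1E -cintJ; last first.
  exact: cintegrable_frft_integrand.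
by apply: eq_cint => x; rewrite conjM frft_kernelN cconjK mulrC.
Qed.

Lemma ip_close f g f' g' (e : R) : L2 f -> L2 g -> L2 f' -> L2 g' ->
  e <= 1 -> l2 (fun t => f' t - f t) <= e -> l2 (fun t => g' t - g t) <= e ->
  normc (ip f' g' - ip f g) <= e * (l2 f + l2 g + 1).
Proof.
move=> Lf Lg Lf' Lg' e1 fe ge.
have -> : ip f' g' - ip f g =
    ip (fun t => f' t - f t) g + ip f' (fun t => g' t - g t).
  by rewrite ipBl// ipBr//; ring.
apply: le_trans (le_normcD _ _) _.
have h1 := normc_ip (L2B Lf' Lf) Lg; have h2 := normc_ip Lf' (L2B Lg' Lg).
have h3 := l2_dist Lf' Lf; have := l2_ge0 mun g; have := l2_ge0 mun f'.
have e0 : 0 <= e := le_trans (l2_ge0 _ _) fe.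
move: h3; rewrite ler_norml => /andP[_ h3] f0 g0.
apply: le_trans (lerD h1 h2) _.
have h4 : l2 (fun t => f' t - f t) * l2 g <= e * l2 g by rewrite ler_wpM2r.
have h5 : l2 f' * l2 (fun t => g' t - g t) <= l2 f' * e by rewrite ler_wpM2l.
apply: le_trans (lerD h4 h5) _.
have h6 : l2 f' * e <= (l2 f + 1) * e by rewrite ler_wpM2r//; lra.
lra.
Qed.

Lemma frel_adjoint alpha f g u v : sin alpha != 0 ->
  frel alpha f g -> frel (- alpha) u v -> ip g u = ip f v.
Proof.
move=> s0 [Lf Lg fg] [Lu Lv uv]; have s0' := sinN_neq0 s0.
apply/eqP; rewrite -subr_eq0 -normc_eq0; apply/eqP.
pose M := l2 f + l2 g + l2 u + l2 v + 2.
have M0 : 0 < M.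
  by have := l2_ge0 mun f; have := l2_ge0 mun g; have := l2_ge0 mun u;
    have := l2_ge0 mun v; rewrite /M; lra.
apply: le0_eps; rewrite ?normc_ge0// => e e0.
pose d := Num.min 1 (e / M).
have d0 : 0 < d by rewrite lt_min ltr01 divr_gt0.
have d1 : d <= 1 by rewrite ge_min lexx.
have dM : d * M <= e by rewrite -ler_pdivlMr// ge_min lexx orbT.
have [h [Hh hf hg]] := fg _ d0; have [k [Hk ku kv]] := uv _ d0.
have LF := L2_frft_L1 s0 Hh; have LF' := L2_frft_L1 s0' Hk.
have := ip_close Lg Lu LF Hk.2 d1 hg ku.
have := ip_close Lf Lv Hh.2 LF' d1 hf kv.
rewrite (frft_L1_adjoint alpha Hh.1 Hk.1) -normcN => h1 h2.
have -> : ip g u - ip f v = - (ip h (frft_L1 (- alpha) k) - ip g u) +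
   (ip h (frft_L1 (- alpha) k) - ip f v) by ring.
apply: le_trans (le_normcD _ _) _; rewrite normcN; rewrite normcN in h1.
apply: le_trans (lerD h2 h1) _; apply: le_trans dM; rewrite /M.
by rewrite -mulrDr ler_wpM2l ?(ltW d0)//; lra.
Qed.

(** Expanding [|K - H|^2] for [K] the transform of [G]: the cross term is
    [<G, G>] by adjointness, and all three squares agree. *)
Lemma frel_inversion alpha (H G : V -> R[i]) : sin alpha != 0 ->
  frel (- alpha) H G -> frel alpha G H.
Proof.
move=> s0 HG; have [LH LG _] := HG; have [K GK] := frel_exists s0 LG.
have [_ LK _] := GK.
apply: (frel_ae LG LH (l2_subrr _ _) _ s0 GK).
apply/eqP; rewrite -sqrf_eq0; apply/eqP.
rewrite (l2D_sqr LK (L2N LH)).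
have -> : ip K (fun x => - H x) = - ip K H.
  by rewrite /ip -cintN; [apply: eq_cint => x; rewrite conjN mulrN|exact: cintegrable_ip].
rewrite (frel_adjoint s0 GK HG) ipxx// ReN/=.
rewrite (@eq_l2 _ _ _ mun (fun x => - H x) H); last by move=> x; rewrite normcN.
by rewrite (frel_l2 s0 GK) (frel_l2 (sinN_neq0 s0) HG); ring.
Qed.

Lemma frel_parseval alpha f g f' g' : sin alpha != 0 ->
  frel alpha f g -> frel alpha f' g' -> ip g g' = ip f f'.
Proof.
move=> s0 fg fg'; apply: (frel_adjoint s0 fg).
by apply: frel_inversion; rewrite ?opprK// sinN_neq0.
Qed.

End adjoint.

Section frft_L2.
Context {R : realType} {n : nat}.
Local Notation mun := (lebesgue R n).
Local Notation V := (Rn R n).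
Local Notation L2 := (L2 mun).
Local Notation l2 := (l2 mun).
Implicit Types (f g h : V -> R[i]) (alpha : R).

Lemma cLp2E f : cLp 2%:E f <-> L2 f.
Proof.
split => [[mf fi]|Lf].
  split => //; apply: (@lty_poweRy _ _ 2^-1); first by rewrite invr_eq0.
  by rewrite -Lnorm2_energy.
by split; [exact: Lf.1|rewrite /cLnorm l2_Lnorm// ltry].
Qed.

Lemma cLnorm2 f : L2 f -> cLnorm 2%:E f = (l2 f)%:E.
Proof. exact: l2_Lnorm. Qed.

Lemma cLp1E f : cLp 1%:E f <-> cintegrable mun f.
Proof.
have E : cLnorm 1%:E f = (\int[mun]_x (normc (f x))%:E)%E.
  rewrite /cLnorm Lnorm1; apply: eq_integral => x _ /=.
  by rewrite ger0_norm ?normc_ge0.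
by split => -[mf fi]; split => //; [rewrite -E|rewrite E].
Qed.

(** The isometry makes the two sequences in [is_frft] equal. *)
Lemma is_frft_frel alpha f g : sin alpha != 0 -> frel alpha f g -> is_frft alpha f g.
Proof.
move=> s0 fg; have [Lf Lg _] := fg; split; first exact/cLp2E.
move=> f_ f_L.
have H k : L12 (f_ k) by have [/cLp1E ? /cLp2E] := f_L k.
rewrite (_ : (fun k => cLnorm 2%:E (frft_L1 alpha (f_ k) \- g)) =
  (fun k => cLnorm 2%:E (f_ k \- f)))//.
apply/funext => k; have LF := L2_frft_L1 s0 (H k).
rewrite (cLnorm2 (L2B LF Lg)) (cLnorm2 (L2B (H k).2 Lf)).
by rewrite (frel_l2B s0 (frel_L1 s0 (H k)) fg).
Qed.

Lemma frel_is_frft alpha f g : sin alpha != 0 -> L2 f -> is_frft alpha f g ->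
  frel alpha f g.
Proof.
move=> s0 Lf [/cLp2E Lg fg].
have /choice[h hP] : forall k : nat, exists h, L12 h /\ l2 (fun t => h t - f t) <= k.+1%:R^-1.
  move=> k; have k0 : 0 < k.+1%:R^-1 :> R by rewrite invr_gt0.
  by have [h [hi Lh hf]] := L2_dense k0 Lf; exists h.
have LF k := L2_frft_L1 s0 (hP k).1.
have hf0 : l2 (fun t => h k t - f t) @[k --> \oo] --> 0.
  apply: (squeeze_cvgr _ (cvg_cst (0 : R)) (@cvg_harmonic R)).
  by near=> k; rewrite l2_ge0 (hP k).2.
have hg0 : l2 (fun t => frft_L1 alpha (h k) t - g t) @[k --> \oo] --> 0.
  apply: (@fine_cvg _ _ _ _ (fun k => (l2 (fun t => frft_L1 alpha (h k) t - g t))%:E)).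
  rewrite (_ : (fun k => (l2 _)%:E) = fun k => cLnorm 2%:E (frft_L1 alpha (h k) \- g)).
    apply: fg => [k|]; first by split; [apply/cLp1E|apply/cLp2E]; exact: (hP k).1.2 || exact: (hP k).1.1.
    rewrite (_ : (fun k => _) = (fun k => (l2 (fun t => h k t - f t))%:E)).
      by apply: cvg_EFin hf0; exact: nearW.
    by apply/funext => k; rewrite (cLnorm2 (L2B (hP k).1.2 Lf)).
  by apply/funext => k; rewrite (cLnorm2 (L2B (LF k) Lg)).
split => // e e0.
have H1 : \forall k \near \oo, l2 (fun t => h k t - f t) < e by exact: (cvgr_lt _ hf0).
have H2 : \forall k \near \oo, l2 (fun t => frft_L1 alpha (h k) t - g t) < e.
  exact: (cvgr_lt _ hg0).
have [k [k1 k2]] : exists k, l2 (fun t => h k t - f t) < e /\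
    l2 (fun t => frft_L1 alpha (h k) t - g t) < e.
  by have := filterI H1 H2; case=> k _ /(_ k (leqnn _)); exists k.
by exists (h k); split; [exact: (hP k).1|exact: ltW|exact: ltW].
Unshelve. all: by end_near.
Qed.

Lemma frel_frft alpha f : sin alpha != 0 -> L2 f -> frel alpha f (frft alpha f).
Proof.
move=> s0 Lf; apply: frel_is_frft => //; rewrite /frft.
apply: (@xgetPex _ _ [set g | is_frft alpha f g]).
by have [g fg] := frel_exists s0 Lf; exists g; exact: is_frft_frel.
Qed.

End frft_L2.

(** Subtracting the multiple [floor (x / pi) * pi] brings [x] into [0, pi[, where
    the sine vanishes only at 0. *)
Lemma sin_neq0 (R : realType) (x : R) : (forall k : int, x <> k%:~R * pi) -> sin x != 0.
Proof.
move=> xk; apply/eqP => sx; have p0 := pi_gt0 R.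
pose k := Num.floor (x / pi); pose r := x - k%:~R * pi.
have r0 : 0 <= r by rewrite subr_ge0 -ler_pdivlMr// Num.Theory.floor_le.
have rp : r < pi.
  by rewrite ltrBlDr -[X in X + _]mul1r -mulrDl -ltr_pdivrMr// addrC -(intrD _ _ 1) Num.Theory.floorD1_gt.
have shift (y : R) (m : nat) : sin (y + m%:R * pi) = (-1) ^+ m * sin y.
  by have := alternatingn (@sinDpi R) m y; rewrite -(mulr_natl pi).
have sr : sin r = 0.
  rewrite /r; case: (k) => m.
    have := shift (x - m%:R * pi) m; rewrite subrK sx => /esym/eqP.
    by rewrite mulf_eq0 signr_eq0/= => /eqP.
  by rewrite NegzE mulrNz mulNr opprK shift sx mulr0.
have rn0 : r != 0 by apply/eqP => /eqP; rewrite subr_eq0 => /eqP; exact: xk.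
by have := @sin_gt0_pi _ r; rewrite sr lt0r rn0 r0 rp ltxx => /(_ isT).
Qed.

(** * Covariance of the transform *)

Section affine.
Context {R : realType}.
Implicit Types n : nat.

Definition aff n (a b t : Rn R n) : Rn R n :=
  [tuple (tnth a i : R) * (tnth t i : R) + (tnth b i : R) | i < n].

Lemma tnth_aff n (a b t : Rn R n) i :
  tnth (aff a b t) i = (tnth a i : R) * (tnth t i : R) + (tnth b i : R).
Proof. by rewrite tnth_mktuple. Qed.

Lemma measurable_aff d (T : measurableType d) n (u v w : T -> Rn R n) :
  measurable_fun setT u -> measurable_fun setT v -> measurable_fun setT w ->
  measurable_fun setT (fun p => aff (u p) (v p) (w p)).
Proof.
move=> mu mv mw; apply: measurable_tuple_of => i.
by apply: measurable_funD; [apply: measurable_funM|]; exact: measurable_coord.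
Qed.

Lemma tconsE n (t : Rn R n.+1) : exists p, t = tcons p.
Proof.
by exists (thead t, [tuple of behead t]); rewrite /tcons/= [LHS]tuple_eta; exact: val_inj.
Qed.

Lemma aff_tcons n (a b t : measurableTypeR R * Rn R n) :
  aff (tcons a) (tcons b) (tcons t) =
  tcons ((a.1 : R) * t.1 + b.1, aff a.2 b.2 t.2).
Proof.
apply: eq_from_tnth => i; rewrite tnth_aff.
case: (unliftP ord0 i) => [j ->|->]; last by [].
by rewrite !tnth_tconsS /= tnth_aff.
Qed.

Lemma absp_tcons n (a : measurableTypeR R * Rn R n) :
  absp (tcons a) = `|a.1 : R| * absp a.2.
Proof.
rewrite /absp big_ord_recl normrM; congr (_ * `|_|).
by apply: eq_bigr => i _; rewrite tnth_tconsS.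
Qed.

Lemma absp_ge0 n (a : Rn R n) : 0 <= absp a.
Proof. exact: normr_ge0. Qed.

Lemma ge0_integral_aff n (g : Rn R n -> \bar R) (a b : Rn R n) : absp a != 0 ->
  measurable_fun setT g -> (forall x, 0 <= g x)%E ->
  (\int[lebesgue R n]_x g x = (absp a)%:E * \int[lebesgue R n]_x g (aff a b x))%E.
Proof.
elim: n g a b => [|n IHn] g a b a0 mg g0.
  rewrite /absp big_ord0 normr1 mul1e; apply: eq_integral => x _.
  by congr g; rewrite (tuple0 (aff a b x)) (tuple0 x).
have mga : measurable_fun setT (fun x => g (aff a b x)).
  by apply: (measurableT_comp mg); exact: measurable_aff.
rewrite !ge0_integral_tcons//.
have [[a1 a'] E1] := tconsE a; have [[b1 b'] E2] := tconsE b; subst a b.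
move: a0; rewrite absp_tcons/= mulf_eq0 negb_or normr_eq0 => /andP[a10 a'0].
have mgt : measurable_fun setT (fun p => g (tcons p)).
  by apply: measurableT_comp => //; exact: measurable_tcons.
have mF : measurable_fun setT (fun x => \int[lebesgue R n]_y g (tcons (x, y)))%E.
  by apply: (@measurable_fun_fubini_tonelli_F _ _ _ _ _ (lebesgue R n) (fun p => g (tcons p))).
rewrite (ge0_integral_affine b1 a10 mF); last by move=> x; exact: integral_ge0.
rewrite EFinM -muleA; congr (_ * _)%E.
rewrite -ge0_integralZl_EFin ?absp_ge0//; last 2 first.
- by move=> x _; exact: integral_ge0.
- apply: (@measurable_fun_fubini_tonelli_F _ _ _ _ _ (lebesgue R n)
    (fun p => g (aff (tcons (a1, a')) (tcons (b1, b')) (tcons p)))) => //.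
  by apply: (measurableT_comp mga); exact: measurable_tcons.
apply: eq_integral => x _.
rewrite (IHn (fun y => g (tcons ((a1 * x + b1)%R, y))) a' b')//.
- by congr (_ * _)%E; apply: eq_integral => y _; rewrite aff_tcons.
- exact: (measurableT_comp mgt (pair1_measurable _)).
Qed.

End affine.

Section aff_transport.
Context {R : realType} {n : nat}.
Local Notation mun := (lebesgue R n).
Local Notation V := (Rn R n).
Implicit Types (a b : V) (f : V -> R[i]).

Lemma cintegrable_aff f a b : absp a != 0 -> cintegrable mun f ->
  cintegrable mun (fun t => f (aff a b t)).
Proof.
move=> a0; apply: (@cintegrable_scale _ _ _ mun _ (absp a)).
- by rewrite lt0r a0 absp_ge0.
- exact: measurable_aff.
- by move=> g mg g0; exact: ge0_integral_aff.
Qed.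

Lemma cint_aff f a b : absp a != 0 -> cintegrable mun f ->
  cint mun f = (absp a)%:C * cint mun (fun t => f (aff a b t)).
Proof.
move=> a0; apply: cint_scale.
- by rewrite lt0r a0 absp_ge0.
- exact: measurable_aff.
- by move=> g mg g0; exact: ge0_integral_aff.
Qed.

Lemma energy_aff f a b : absp a != 0 -> cmeas f ->
  energy mun f = ((absp a)%:E * energy mun (fun t => f (aff a b t)))%E.
Proof.
move=> a0 mf; rewrite /energy (ge0_integral_aff b a0)//.
- exact: measurable_energy.
- by move=> x; rewrite lee_fin sqr_ge0.
Qed.

Lemma cmeas_aff f a b : cmeas f -> cmeas (fun t => f (aff a b t)).
Proof. by apply: cmeas_comp; exact: measurable_aff. Qed.

(** Weighted affine substitutions with [|w|^2 = |a|_p] act isometrically. *)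
Definition wsub (w : V -> R[i]) a b f (t : V) := w t * f (aff a b t).

Variables (w : V -> R[i]) (a b : V).
Hypothesis a0 : absp a != 0.
Hypothesis mw : cmeas w.
Hypothesis nw : forall t, normc (w t) ^+ 2 = absp a.

Lemma energy_wsub f : cmeas f -> energy mun (wsub w a b f) = energy mun f.
Proof.
move=> mf; rewrite (energy_aff b a0 mf) /energy -ge0_integralZl_EFin ?absp_ge0//.
- by apply: eq_integral => t _; rewrite /wsub normcM exprMn nw EFinM.
- by move=> t _; rewrite lee_fin sqr_ge0.
- by apply: measurable_energy; exact: cmeas_aff.
Qed.

Lemma cmeas_wsub f : cmeas f -> cmeas (wsub w a b f).
Proof. by move=> mf; apply: cmeasM => //; exact: cmeas_aff. Qed.

Lemma L2_wsub f : L2 mun f -> L2 mun (wsub w a b f).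
Proof. by move=> [mf fi]; split; [exact: cmeas_wsub|rewrite energy_wsub]. Qed.

Lemma l2_wsubB f g : cmeas f -> cmeas g ->
  l2 mun (fun t => wsub w a b f t - wsub w a b g t) = l2 mun (fun t => f t - g t).
Proof.
move=> mf mg; rewrite /l2 -(energy_wsub (cmeasB mf mg)); congr (Num.sqrt (fine _)).
by apply: eq_energy => t; rewrite /wsub mulrBr.
Qed.

Lemma cintegrable_wsub f : cintegrable mun f -> cintegrable mun (wsub w a b f).
Proof.
move=> fi; have fai := cintegrable_aff b a0 fi.
have E : wsub w a b f = (fun t => f (aff a b t) * w t).
  by apply/funext => t; rewrite /wsub mulrC.
rewrite E; apply: (cintegrableM_bounded (sqrtr_ge0 (absp a)) fai mw).
by move=> t; rewrite -(nw t) sqrtr_sqr ger0_norm// normc_ge0.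
Qed.

Lemma L12_wsub f : L12 f -> L12 (wsub w a b f).
Proof. by move=> [fi Lf]; split; [exact: cintegrable_wsub|exact: L2_wsub]. Qed.

End aff_transport.

(** The transform intertwines two weighted affine substitutions on L2 as soon as
    it does so pointwise on integrable functions. *)
Lemma frel_wsub {R : realType} {n : nat} (alpha : R) (w w' : Rn R n -> R[i])
    (a b a' b' : Rn R n) f g :
  sin alpha != 0 -> absp a != 0 -> absp a' != 0 -> cmeas w -> cmeas w' ->
  (forall t, normc (w t) ^+ 2 = absp a) ->
  (forall t, normc (w' t) ^+ 2 = absp a') ->
  (forall h, cintegrable (lebesgue R n) h -> forall xi,
     frft_L1 alpha (wsub w a b h) xi = wsub w' a' b' (frft_L1 alpha h) xi) ->
  frel alpha f g -> frel alpha (wsub w a b f) (wsub w' a' b' g).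
Proof.
move=> s0 a0 a0' mw mw' nw nw' H [Lf Lg fg]; split; [exact: L2_wsub|exact: L2_wsub|].
move=> e e0; have [h [Hh hf hg]] := fg _ e0; have [hi Lh] := Hh.
have LF := L2_frft_L1 s0 Hh.
exists (wsub w a b h); split; first exact: L12_wsub.
- by rewrite l2_wsubB//; [exact: Lh.1|exact: Lf.1].
- rewrite (@eq_l2 _ _ _ _ _ (fun xi => wsub w' a' b' (frft_L1 alpha h) xi -
     wsub w' a' b' g xi)); last by move=> xi; rewrite H.
  by rewrite l2_wsubB//; [exact: LF.1|exact: Lg.1].
Qed.

Section covariance.
Context {R : realType} {n : nat}.
Local Notation mun := (lebesgue R n).
Local Notation V := (Rn R n).
Implicit Types (f g : V -> R[i]).

(** A substitution intertwines with the transform when it respects the kernel: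
    only the phases have to be compared. *)
Lemma frel_phase (alpha : R) (p q : V -> R) (a b a' b' : V) f g :
  sin alpha != 0 -> absp a * absp a' = 1 ->
  measurable_fun setT p -> measurable_fun setT q ->
  (forall t xi, p t + ((enorm t ^+ 2 + enorm xi ^+ 2) / 2 * cot alpha -
       dotp t xi * csc alpha) =
     q xi + ((enorm (aff a b t) ^+ 2 + enorm (aff a' b' xi) ^+ 2) / 2 * cot alpha -
       dotp (aff a b t) (aff a' b' xi) * csc alpha)) ->
  frel alpha f g ->
  frel alpha (fun t => (Num.sqrt (absp a))%:C * expi (p t) * f (aff a b t))
    (fun xi => (Num.sqrt (absp a'))%:C * expi (q xi) * g (aff a' b' xi)).
Proof.
move=> s0 aa' mp mq H.
have a0 : absp a != 0 by apply: contra_eq_neq aa' => ->; rewrite mul0r eq_sym oner_eq0.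
have a0' : absp a' != 0 by apply: contra_eq_neq aa' => ->; rewrite mulr0 eq_sym oner_eq0.
have mw (c : R) (r : V -> R) : measurable_fun setT r -> cmeas (fun t => c%:C * expi (r t)).
  by move=> mr; apply: cmeasM; [exact: cmeas_cst|exact: cmeas_expi].
have nw (c : V) (r : V -> R) t :
    normc ((Num.sqrt (absp c))%:C * expi (r t)) ^+ 2 = absp c.
  by rewrite normcM normc_expi mulr1 normc_real ger0_norm ?sqrtr_ge0// sqr_sqrtr// absp_ge0.
apply: (frel_wsub (a := a) (b := b) (a' := a') (b' := b')
  (w := fun t => (Num.sqrt (absp a))%:C * expi (p t))
  (w' := fun t => (Num.sqrt (absp a'))%:C * expi (q t)) s0 a0 a0'
  (mw _ _ mp) (mw _ _ mq)) => //.
move=> h hi xi; rewrite /wsub !frft_L1E (cint_aff b a0 (cintegrable_frft_integrand alpha _ hi)).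
rewrite mulrA -cintZl; last first.
  exact: (cintegrable_aff b a0 (cintegrable_frft_integrand alpha _ hi)).
apply: eq_cint => t; rewrite /frft_kernel; move: (frft_const _ _) => c.
have sa : Num.sqrt (absp a) = Num.sqrt (absp a') * absp a.
  have e1 : Num.sqrt (absp a') * Num.sqrt (absp a) = 1.
    by rewrite -sqrtrM ?absp_ge0// mulrC aa' sqrtr1.
  by rewrite -[X in _ * X](sqr_sqrtr (absp_ge0 a)) expr2 mulrA e1 mul1r.
rewrite sa realcM.
have := congr1 (@expi R) (H t xi).
rewrite [in LHS]expiD [in RHS]expiD => E.
move: E; set X := expi (p t); set Y := expi (_ - _); set X' := expi (q xi); set Y' := expi (_ - _).
move=> E.
transitivity ((Num.sqrt (absp a'))%:C * (absp a)%:C * c * h (aff a b t) * (X * Y)); first by ring.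
by rewrite E; ring.
Qed.

End covariance.

Section coordinate_shift.
Context {R : realType} {n : nat}.
Local Notation mun := (lebesgue R n).
Local Notation V := (Rn R n).
Local Notation L2 := (L2 mun).
Local Notation l2 := (l2 mun).
Local Notation ip := (ip mun).
Implicit Types (f g A B : V -> R[i]) (alpha beta r s : R).

Definition onev : V := [tuple 1 | i < n].
Definition zerov : V := [tuple 0 | i < n].

Lemma absp_onev : absp onev = 1 :> R.
Proof. by rewrite /absp big1 ?normr1// => i _; rewrite tnth_mktuple. Qed.

Lemma onev_neq0 : absp onev != 0 :> R.
Proof. by rewrite absp_onev oner_eq0. Qed.

Lemma aff_id (t : V) : aff onev zerov t = t.
Proof. by apply: eq_from_tnth => i; rewrite tnth_aff !tnth_mktuple mul1r addr0. Qed.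

Variable j : 'I_n.

Definition axis r : V := [tuple if i == j then r else 0 | i < n].
Definition translate r (t : V) : V := aff onev (axis r) t.

Lemma tnth_translate r t i :
  tnth (translate r t) i = (tnth t i : R) + (if i == j then r else 0) :> R.
Proof. by rewrite /translate tnth_aff !tnth_mktuple mul1r. Qed.

Lemma translateD r s t : translate r (translate s t) = translate (r + s) t.
Proof.
apply: eq_from_tnth => i; rewrite !tnth_translate; case: ifP => _; last by rewrite !addr0.
by rewrite -addrA [s + r]addrC.
Qed.

Lemma translate0 t : translate 0 t = t.
Proof. by apply: eq_from_tnth => i; rewrite !tnth_translate; case: ifP; rewrite addr0. Qed.

Lemma enorm2_translate r (t : V) :
  enorm (translate r t) ^+ 2 = enorm t ^+ 2 + 2 * r * (tnth t j : R) + r ^+ 2.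
Proof.
rewrite !enorm2 [LHS](bigD1 j)//= [\sum_(i < n) _](bigD1 j)//= tnth_translate eqxx.
rewrite (eq_bigr (fun i => (tnth t i : R) ^+ 2)); last first.
  by move=> i /negbTE ij; rewrite tnth_translate ij addr0.
by ring.
Qed.

Lemma dotp_translate r (t xi : V) :
  dotp (translate r t) xi = dotp t xi + r * (tnth xi j : R).
Proof.
rewrite /dotp [LHS](bigD1 j)//= [\sum_(i < n) _](bigD1 j)//= tnth_translate eqxx.
rewrite (eq_bigr (fun i => (tnth t i : R) * (tnth xi i : R))); last first.
  by move=> i /negbTE ij; rewrite tnth_translate ij addr0.
by ring.
Qed.

Lemma measurable_translate r : measurable_fun setT (translate r).
Proof. by apply: measurable_aff => //; exact: measurable_cst. Qed.

Lemma measurable_tnth_real : measurable_fun setT (fun t : V => tnth t j : R).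
Proof. exact: measurable_coord. Qed.

(** The unitary group whose generator becomes multiplication by the [j]-th
    coordinate after the transform of angle [alpha]. *)
Definition phase_shift alpha r g (t : V) : R[i] :=
  expi (r * cos alpha * (tnth t j : R) + r ^+ 2 * (sin alpha * cos alpha) / 2) *
  g (translate (r * sin alpha) t).

Lemma shift0 alpha g : phase_shift alpha 0 g = g.
Proof.
by apply/funext => t; rewrite /phase_shift !mul0r expr0n/= !mul0r addr0 expi0 mul1r translate0.
Qed.

Lemma frel_shift alpha r g A : sin alpha != 0 -> frel alpha g A ->
  frel alpha (phase_shift alpha r g) (fun xi => expi (r * (tnth xi j : R)) * A xi).
Proof.
move=> s0 gA.
have aa : absp onev * absp onev = 1 :> R by rewrite absp_onev mulr1.
pose p (t : V) : R := r * cos alpha * (tnth t j : R) + r ^+ 2 * (sin alpha * cos alpha) / 2.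
pose q (t : V) : R := r * (tnth t j : R).
have mp : measurable_fun setT p.
  apply: measurable_funD => //; apply: measurable_funM => //; exact: measurable_tnth_real.
have mq : measurable_fun setT q.
  by apply: measurable_funM => //; exact: measurable_tnth_real.
have := frel_phase (a := onev) (b := axis (r * sin alpha)) (a' := onev) (b' := zerov)
  s0 aa mp mq _ gA.
rewrite absp_onev sqrtr1.
have -> : (fun t => 1%:C * expi (p t) * g (aff onev (axis (r * sin alpha)) t)) =
    phase_shift alpha r g by apply/funext => t; rewrite mul1r.
have -> : (fun xi => 1%:C * expi (q xi) * A (aff onev zerov xi)) =
    (fun xi => expi (r * (tnth xi j : R)) * A xi).
  by apply/funext => t; rewrite mul1r aff_id.
apply => t xi; rewrite aff_id -/(translate _ _) enorm2_translate dotp_translate /p /q /cot /csc.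
by field.
Qed.

Lemma L2_shift alpha r g : L2 g -> L2 (phase_shift alpha r g).
Proof.
move=> Lg; apply: (@L2_wsub _ _ (fun t : V => expi (r * cos alpha * (tnth t j : R) +
    r ^+ 2 * (sin alpha * cos alpha) / 2)) onev (axis (r * sin alpha)) onev_neq0 _ _ _ Lg).
- apply: cmeas_expi; apply: measurable_funD => //; apply: measurable_funM => //.
  exact: measurable_tnth_real.
- by move=> t; rewrite normc_expi expr1n absp_onev.
Qed.

(** The shift groups of angles [alpha] and [beta] commute up to a scalar phase; as
    the inverse of a shift is its adjoint, this can be said with inner products
    only. A translation of the variable carries one integrand to the other. *)
Lemma ip_shift alpha beta r s g : L2 g ->
  ip (phase_shift beta s g) (phase_shift alpha (- r) g) =
  expi (r * s * sin (alpha - beta)) * ip (phase_shift alpha r g) (phase_shift beta (- s) g).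
Proof.
move=> Lg; rewrite /ip.
have I := cintegrable_ip (L2_shift alpha r Lg) (L2_shift beta (- s) Lg).
rewrite (cint_aff (axis (s * sin beta - r * sin alpha)) onev_neq0 I) absp_onev mul1r.
rewrite -cintZl; last exact: (cintegrable_aff _ onev_neq0 I).
apply: eq_cint => t; rewrite -/(translate _ _) /phase_shift !translateD !conjM !conj_expi.
have -> : r * sin alpha + (s * sin beta - r * sin alpha) = s * sin beta by ring.
have -> : - s * sin beta + (s * sin beta - r * sin alpha) = - r * sin alpha by ring.
rewrite tnth_translate eqxx sinB.
set G := g _; set G' := cconj (g _).
transitivity (expi (s * cos beta * (tnth t j : R) + s ^+ 2 * (sin beta * cos beta) / 2) *
  expi (- (- r * cos alpha * (tnth t j : R) + (- r) ^+ 2 * (sin alpha * cos alpha) / 2)) *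
  (G * G')); first by ring.
set E1 := expi (r * s * _); set E2 := expi (r * cos _ * _ + _).
set E3 := expi (- (- s * _ * _ + _)).
transitivity (E1 * E2 * E3 * (G * G')); last by ring.
by congr (_ * _); rewrite /E1 /E2 /E3 -!expiD; congr expi; field.
Qed.

Definition moment A (xi : V) : R[i] := (tnth xi j : R)%:C * A xi.

(** On the transform side the shift is multiplication by [e^{i r xi_j}]. *)
Lemma l2_shiftB alpha r g A : sin alpha != 0 -> frel alpha g A -> L2 (moment A) ->
  l2 (fun t => phase_shift alpha r g t - g t) <= `|r| * l2 (moment A).
Proof.
move=> s0 gA LA; rewrite -(frel_l2 s0 (frelB s0 (frel_shift r s0 gA) gA)).
have -> : `|r| * l2 (moment A) = l2 (fun xi => r%:C * moment A xi).
  by rewrite l2Z// normc_real.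
have LrA : L2 (fun xi => r%:C * moment A xi) by exact: L2Z.
have [_ LA' _] := gA.
have E xi : normc (expi (r * (tnth xi j : R)) * A xi - A xi) <= normc (r%:C * moment A xi).
  have -> : expi (r * (tnth xi j : R)) * A xi - A xi = (expi (r * (tnth xi j : R)) - 1) * A xi.
    by ring.
  rewrite mulrA -realcM !normcM ler_wpM2r ?normc_ge0// normc_real.
  rewrite -(@ler_pXn2r _ 2) ?nnegrE ?normc_ge0// real_normK ?num_real//.
  by rewrite normc_expiB1 chord_le.
have [_ LD _] := frelB s0 (frel_shift r s0 gA) gA.
apply: (l2_le (l2_ge0 _ _) LD.1 _).2.
rewrite l2_sqr//; apply: ge0_le_integral => //.
- by move=> x _; rewrite lee_fin sqr_ge0.
- exact: measurable_energy LD.1.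
- exact: measurable_energy LrA.1.
- by move=> x _; rewrite lee_fin lerXn2r ?nnegrE ?normc_ge0.
Qed.

End coordinate_shift.

(** * The uncertainty inequality *)

Section coordinate_uncertainty.
Context {R : realType} {n : nat}.
Local Notation mun := (lebesgue R n).
Local Notation V := (Rn R n).
Local Notation L2 := (L2 mun).
Local Notation l2 := (l2 mun).
Local Notation ip := (ip mun).
Implicit Types (f g A B : V -> R[i]) (alpha beta : R).
Variable j : 'I_n.

Lemma l2_shift alpha r g : cmeas g -> l2 (phase_shift j alpha r g) = l2 g.
Proof.
move=> mg; apply: energy_l2.
apply: (@energy_wsub _ _ (fun t : V => expi (r * cos alpha * (tnth t j : R) +
    r ^+ 2 * (sin alpha * cos alpha) / 2)) onev (axis j (r * sin alpha)) onev_neq0 _ g mg).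
by move=> t; rewrite normc_expi expr1n absp_onev.
Qed.

Lemma chord_lower (x s : R) : 0 <= x <= 1 -> `|s| <= 1 ->
  x ^+ 2 * `|s| * (1 - x) <= normc (expi (x * x * s) - 1).
Proof.
move=> /andP[x0 x1] s1; have s0 : 0 <= `|s| := normr_ge0 s.
rewrite -(@ler_pXn2r _ 2) ?nnegrE ?normc_ge0// ?mulr_ge0 ?sqr_ge0 ?subr_ge0//.
rewrite normc_expiB1; apply: le_trans (chord_ge _).
have -> : (x * x * s) ^+ 2 = (x ^+ 2 * `|s|) ^+ 2.
  by rewrite !exprMn real_normK ?num_real//; ring.
rewrite exprMn ler_wpM2l ?sqr_ge0//.
have h1 : x ^+ 2 * `|s| <= x by rewrite expr2 -mulrA ler_piMr// mulr_ile1.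
have h0 : 0 <= x ^+ 2 * `|s| by rewrite mulr_ge0// sqr_ge0.
by move: h0 h1; set y := x ^+ 2 * `|s| => h0 h1; nra.
Qed.

(** With [u], [v] the shifts of [g] by [x] and [u'], [v'] those by [- x],
    [ip_shift] reads [<v, u'> = e^{i x^2 s} <u, v'>], where [s = sin (alpha - beta)].
    The difference of the two inner products equals
    [<v - g, u' - g> - <u - g, v' - g>], because the terms linear in the
    displacements cancel; so it is at most twice the product of the displacements
    caused by the two groups, hence [O(x^2)] with the moments as constants. It also
    equals [(e^{i x^2 s} - 1) <u, v'>], which is [i x^2 s |g|^2] to leading order.
    Compare and let [x] tend to 0. *)
Lemma coordinate_uncertainty alpha beta g A B : sin alpha != 0 -> sin beta != 0 ->
  frel alpha g A -> frel beta g B -> L2 (moment j A) -> L2 (moment j B) ->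
  `|sin (alpha - beta)| * l2 g ^+ 2 <= 2 * l2 (moment j A) * l2 (moment j B).
Proof.
move=> sa sb gA gB LA LB; have [Lg _ _] := gA.
set N := l2 g; set a := l2 (moment j A); set b := l2 (moment j B).
set s := sin (alpha - beta).
have N0 : 0 <= N := l2_ge0 _ _.
have a0 : 0 <= a := l2_ge0 _ _.
have b0 : 0 <= b := l2_ge0 _ _.
have s0 : 0 <= `|s| := normr_ge0 s.
have s1 : `|s| <= 1 by rewrite ler_norml sin_geN1 sin_le1.
have key x : 0 < x -> x <= 1 ->
    `|s| * (N ^+ 2 - x * ((a + b) * N + N ^+ 2)) <= 2 * a * b.
  move=> x0 x1.
  pose u := phase_shift j alpha x g; pose u' := phase_shift j alpha (- x) g.
  pose v := phase_shift j beta x g; pose v' := phase_shift j beta (- x) g.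
  have [Lu Lu' Lv Lv'] : [/\ L2 u, L2 u', L2 v & L2 v'].
    by split; apply: L2_shift.
  have du : l2 (fun t => u t - g t) <= x * a.
    by have := l2_shiftB x sa gA LA; rewrite (gtr0_norm x0).
  have du' : l2 (fun t => u' t - g t) <= x * a.
    by have := l2_shiftB (- x) sa gA LA; rewrite normrN (gtr0_norm x0).
  have dv : l2 (fun t => v t - g t) <= x * b.
    by have := l2_shiftB x sb gB LB; rewrite (gtr0_norm x0).
  have dv' : l2 (fun t => v' t - g t) <= x * b.
    by have := l2_shiftB (- x) sb gB LB; rewrite normrN (gtr0_norm x0).
  have E : ip v u' = expi (x * x * s) * ip u v' by exact: ip_shift.
  have Ev : ip v g = ip g v'.
    by have := ip_shift j alpha beta 0 x Lg; rewrite oppr0 !shift0 !mul0r expi0 mul1r.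
  have Eu : ip g u' = ip u g.
    by have := ip_shift j alpha beta x 0 Lg; rewrite oppr0 !shift0 mulr0 mul0r expi0 mul1r.
  have bil w w' : L2 w -> L2 w' -> ip (fun t => w t - g t) (fun t => w' t - g t) =
      ip w w' - ip w g - ip g w' + ip g g.
    by move=> Lw Lw'; rewrite ipBl// ?ipBr//; [ring|exact: L2B].
  have D : (expi (x * x * s) - 1) * ip u v' =
      ip (fun t => v t - g t) (fun t => u' t - g t) -
      ip (fun t => u t - g t) (fun t => v' t - g t).
    by rewrite !bil// Ev Eu mulrBl -E; ring.
  have up : normc ((expi (x * x * s) - 1) * ip u v') <= x ^+ 2 * (2 * a * b).
    rewrite D; apply: le_trans (le_normcD _ _) _; rewrite normcN.
    have h1 := normc_ip (L2B Lv Lg) (L2B Lu' Lg).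
    have h2 := normc_ip (L2B Lu Lg) (L2B Lv' Lg).
    have h3 := ler_pM (l2_ge0 _ _) (l2_ge0 _ _) dv du'.
    have h4 := ler_pM (l2_ge0 _ _) (l2_ge0 _ _) du dv'.
    apply: le_trans (lerD (le_trans h1 h3) (le_trans h2 h4)) _.
    by rewrite le_eqVlt; apply/orP; left; apply/eqP; ring.
  have low : N ^+ 2 - x * ((a + b) * N) <= normc (ip u v').
    have -> : ip u v' = ip g g + (ip (fun t => u t - g t) v' + ip g (fun t => v' t - g t)).
      by rewrite ipBl// ipBr//; ring.
    have h1 := normc_ip (L2B Lu Lg) Lv'; have h2 := normc_ip Lg (L2B Lv' Lg).
    rewrite (l2_shift beta (- x) Lg.1) -/N in h1; rewrite -/N in h2.
    have h3 : l2 (fun t => u t - g t) * N <= x * a * N by rewrite ler_wpM2r.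
    have h4 : N * l2 (fun t => v' t - g t) <= N * (x * b) by rewrite ler_wpM2l.
    rewrite ipxx// -/N.
    set z := ip _ v' + _; have hz : normc z <= x * a * N + N * (x * b).
      apply: le_trans (le_normcD _ _) _.
      exact: lerD (le_trans h1 h3) (le_trans h2 h4).
    have := le_normcD ((N ^+ 2)%:C + z) (- z).
    rewrite addrK normcN normc_real ger0_norm ?sqr_ge0// => h5.
    have -> : x * ((a + b) * N) = x * a * N + N * (x * b) by ring.
    by rewrite lerBlDr; apply: le_trans h5 _; rewrite lerD2l.
  have x01 : 0 <= x <= 1 by rewrite (ltW x0).
  have low2 := chord_lower x01 s1.
  have x2 : 0 < x ^+ 2 by rewrite exprn_gt0.
  rewrite -(ler_pM2l x2); apply: le_trans up; rewrite normcM.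
  apply: (@le_trans _ _ (x ^+ 2 * `|s| * (1 - x) * normc (ip u v'))); last first.
    by rewrite ler_wpM2r ?normc_ge0.
  apply: (@le_trans _ _ (x ^+ 2 * `|s| * (1 - x) * (N ^+ 2 - x * ((a + b) * N)))); last first.
    by rewrite ler_wpM2l// !mulr_ge0 ?subr_ge0// ltW.
  rewrite [X in X <= _]mulrA -[X in _ <= X]mulrA ler_wpM2l ?mulr_ge0 ?(ltW x2) ?(ltW x0)//.
  have -> : (1 - x) * (N ^+ 2 - x * ((a + b) * N)) =
      N ^+ 2 - x * ((a + b) * N + N ^+ 2) + x * x * ((a + b) * N) by ring.
  rewrite lerDl mulr_ge0//; first by rewrite mulr_ge0// ltW.
  by rewrite mulr_ge0// addr_ge0.
(* letting [x] tend to 0 in [key] *)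
rewrite leNgt; apply/negP => lt.
pose d := `|s| * N ^+ 2 - 2 * a * b.
have d0 : 0 < d by rewrite subr_gt0.
pose M := `|s| * ((a + b) * N + N ^+ 2) + 1.
have M0 : 0 < M.
  by rewrite ltr_wpDl// mulr_ge0// addr_ge0 ?sqr_ge0// mulr_ge0// addr_ge0.
pose x := Num.min 1 (d / (2 * M)).
have x0 : 0 < x by rewrite lt_min ltr01 divr_gt0// mulr_gt0.
have x1 : x <= 1 by rewrite ge_min lexx.
have xM : x * (2 * M) <= d by rewrite -ler_pdivlMr ?mulr_gt0// ge_min lexx orbT.
have := key x x0 x1.
have : x * (2 * M) = 2 * x + 2 * (`|s| * (x * ((a + b) * N + N ^+ 2))).
  by rewrite /M; ring.
move: xM d0; rewrite /d mulrBr; move: (`|s| * (x * _)) (x * _) (`|s| * N ^+ 2) => p y z h1 h2 h3 h4.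
move: h1 h2 h3 h4 x0; clear; move: (2 * a * b) => w; lra.
Qed.

End coordinate_uncertainty.

Section dispersion.
Context {R : realType} {n : nat}.
Local Notation mun := (lebesgue R n).
Local Notation V := (Rn R n).
Local Notation L2 := (L2 mun).
Local Notation l2 := (l2 mun).
Implicit Types (f g A B : V -> R[i]) (alpha beta : R).

Definition dispersion A : \bar R :=
  (\int[mun]_xi (enorm xi ^+ 2 * normc (A xi) ^+ 2)%:E)%E.

Lemma dispersion_ge0 A : (0 <= dispersion A)%E.
Proof. by apply: integral_ge0 => x _; rewrite lee_fin mulr_ge0// sqr_ge0. Qed.

Lemma cmeas_moment j A : cmeas A -> cmeas (moment j A).
Proof. by apply: cmeasM; apply: cmeas_real; exact: measurable_tnth_real. Qed.

Lemma measurable_dispersion A : cmeas A ->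
  measurable_fun setT (fun xi => (enorm xi ^+ 2 * normc (A xi) ^+ 2)%:E).
Proof.
move=> mA; apply/measurable_EFinP; apply: measurable_funM; first exact: measurable_enorm2.
exact: measurable_normc2.
Qed.

Lemma dispersion_sum A : cmeas A ->
  dispersion A = (\sum_(j < n) energy mun (moment j A))%E.
Proof.
move=> mA; rewrite /energy -(@ge0_integral_sum _ _ _ mun setT measurableT _
  (fun j xi => (normc (moment j A xi) ^+ 2)%:E)).
- apply: eq_integral => xi _; rewrite sumEFin; congr EFin.
  rewrite enorm2 mulr_suml; apply: eq_bigr => j _.
  by rewrite /moment normcM exprMn normc_real real_normK// num_real.
- by move=> j; apply: measurable_energy; exact: cmeas_moment.
- by move=> j xi _; rewrite lee_fin sqr_ge0.
Qed.

(** The product form of the inequality is weakened to a sum with a free parameter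
    [l], by [2 l a b <= b^2 + l^2 a^2]: a sum is compatible with adding the
    coordinates, with infinite moments and with integration over a parameter. *)
Lemma uncertainty_sum alpha beta g A B (l : R) : sin alpha != 0 -> sin beta != 0 ->
  frel alpha g A -> frel beta g B -> 0 <= l ->
  ((l * n%:R * `|sin (alpha - beta)|)%:E * energy mun g <=
   dispersion B + (l ^+ 2)%:E * dispersion A)%E.
Proof.
move=> sa sb gA gB l0; have [Lg LA _] := gA; have [_ LB _] := gB.
set s := `|sin _|; have s0 : 0 <= s := normr_ge0 _.
rewrite (dispersion_sum LA.1) (dispersion_sum LB.1) ge0_sume_distrr; last first.
  by move=> j _; exact: energy_ge0.
rewrite -big_split/= -(l2_sqr Lg) -EFinM.
have -> : l * n%:R * s * l2 g ^+ 2 = \sum_(j < n) (l * s * l2 g ^+ 2).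
  by rewrite sumr_const card_ord -mulr_natr; ring.
rewrite -sumEFin; apply: lee_sum => j _.
have mA := cmeas_moment j LA.1; have mB := cmeas_moment j LB.1.
have [Ai|Ai] := ltP (energy mun (moment j A)) +oo%E; last first.
  have [->|ln0] := eqVneq l 0.
    rewrite !mul0r expr0n/= mul0e adde0; exact: energy_ge0.
  have l2p : 0 < l ^+ 2 by rewrite exprn_gt0// lt0r ln0.
  move: Ai; rewrite leye_eq => /eqP ->; rewrite gt0_muley ?lte_fin//.
  by rewrite addey ?leey// gt_eqF// (lt_le_trans _ (energy_ge0 _ _))// ltNy0.
have [Bi|Bi] := ltP (energy mun (moment j B)) +oo%E; last first.
  move: Bi; rewrite leye_eq => /eqP ->; rewrite addye ?leey// gt_eqF//.
  rewrite (lt_le_trans (ltNyr 0))// mule_ge0 ?lee_fin ?sqr_ge0//; exact: energy_ge0.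
have LmA : L2 (moment j A) by [].
have LmB : L2 (moment j B) by [].
have := coordinate_uncertainty sa sb gA gB LmA LmB; rewrite -/s.
rewrite -(l2_sqr LmA) -(l2_sqr LmB) -EFinM -EFinD lee_fin.
move: (l2 (moment j A)) (l2 (moment j B)) (l2 g ^+ 2) => a b N h.
apply: (@le_trans _ _ (l * (2 * a * b))).
  by rewrite -mulrA ler_wpM2l.
rewrite -subr_ge0; have -> : b ^+ 2 + l ^+ 2 * a ^+ 2 - l * (2 * a * b) = (b - l * a) ^+ 2 by ring.
exact: sqr_ge0.
Qed.

Definition difference_quotient j beta g k : \bar R :=
  ((k.+1%:R ^+ 2)%:E * energy mun (fun t => phase_shift j beta k.+1%:R^-1 g t - g t)%R)%E.

Lemma sqr_rescale k (u : R) : k.+1%:R ^+ 2 * (k.+1%:R^-1 * u) ^+ 2 = u ^+ 2.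
Proof. by rewrite -exprMn mulrA divff ?mul1r// pnatr_eq0. Qed.

Lemma cvg_chord_quotient (u : R) :
  k.+1%:R ^+ 2 * (2 * (1 - cos (k.+1%:R^-1 * u))) @[k --> \oo] --> u ^+ 2.
Proof.
have h (k : nat) := sqr_rescale k u.
have c0 : u ^+ 2 * (1 - k.+1%:R^-1 ^+ 2 * u ^+ 2 / 4) @[k --> \oo] --> u ^+ 2 * (1 - (0 : R) ^+ 2 * u ^+ 2 / 4).
  apply: cvgM; first exact: cvg_cst.
  apply: cvgB; first exact: cvg_cst.
  apply: cvgM; last exact: cvg_cst.
  apply: cvgM; last exact: cvg_cst.
  apply: (@continuous_cvg _ _ _ _ _ _ (fun y : R => y ^+ 2)).
    exact: exprn_continuous.
  exact: cvg_harmonic.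
move: c0; rewrite expr0n/= !mul0r subr0 mulr1 => c0.
apply: (squeeze_cvgr _ c0 (cvg_cst (u ^+ 2))).
apply: nearW => k; apply/andP; split.
  apply: le_trans (ler_wpM2l (sqr_ge0 _) (chord_ge _)).
  by rewrite [X in _ <= X]mulrA h exprMn.
by apply: le_trans (ler_wpM2l (sqr_ge0 _) (chord_le _)) _; rewrite h.
Qed.

(** The difference quotients of the shift group exhaust the moment: they are
    integrals of [k^2 |e^{i xi_j / k} - 1|^2 |B|^2], which is at most
    [xi_j^2 |B|^2] and tends to it. They do not mention the transform, so they show
    that the moment depends measurably on parameters. *)
Lemma moment_sup j beta g B : sin beta != 0 -> frel beta g B ->
  energy mun (moment j B) = esups (difference_quotient j beta g) 0.
Proof.
move=> sb gB; have [Lg LB _] := gB.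
pose u k (xi : V) : R := k.+1%:R ^+ 2 * (2 * (1 - cos (k.+1%:R^-1 * (tnth xi j : R)))) *
  normc (B xi) ^+ 2.
have c0 (k : nat) (x : R) : 0 <= k.+1%:R ^+ 2 * (2 * (1 - cos x)) :> R.
  by rewrite mulr_ge0 ?sqr_ge0// mulr_ge0// subr_ge0 cos_le1.
have mc (k : nat) : measurable_fun setT
    (fun xi : V => k.+1%:R ^+ 2 * (2 * (1 - cos (k.+1%:R^-1 * (tnth xi j : R)))) : R).
  apply: measurable_funM => //; apply: measurable_funM => //; apply: measurable_funB => //.
  apply: measurableT_comp; first exact: continuous_measurable_fun (@continuous_cos R).
  by apply: measurable_funM => //; exact: measurable_tnth_real.
have mB := measurable_normc2 LB.1.
have mu k : measurable_fun setT (u k) by exact: measurable_funM.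
have u0 k xi : 0 <= u k xi by rewrite mulr_ge0// sqr_ge0.
have E k : difference_quotient j beta g k = (\int[mun]_xi (u k xi)%:E)%E.
  have fS := frelB sb (frel_shift j k.+1%:R^-1 sb gB) gB.
  have [LS LSB _] := fS.
  rewrite /difference_quotient -(l2_sqr LS) -(frel_l2 sb fS) (l2_sqr LSB).
  rewrite -ge0_integralZl_EFin ?sqr_ge0//.
  - apply: eq_integral => xi _; rewrite -EFinM; congr EFin.
    have -> : expi (k.+1%:R^-1 * (tnth xi j : R)) * B xi - B xi =
      (expi (k.+1%:R^-1 * (tnth xi j : R)) - 1) * B xi by ring.
    by rewrite normcM exprMn normc_expiB1 mulrA.
  - by move=> xi _; rewrite lee_fin sqr_ge0.
  - exact: measurable_energy LSB.1.
have mm : measurable_fun setT (fun xi => (tnth xi j : R) ^+ 2 * normc (B xi) ^+ 2 : R).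
  apply: measurable_funM => //; apply: measurable_funX; exact: measurable_tnth_real.
have Em : energy mun (moment j B) = (\int[mun]_xi ((tnth xi j : R) ^+ 2 * normc (B xi) ^+ 2)%:E)%E.
  apply: eq_integral => xi _; congr EFin.
  by rewrite /moment normcM exprMn normc_real real_normK// num_real.
apply/eqP; rewrite eq_le Em; apply/andP; split.
  apply: (@fatou_bound _ _ _ mun u).
  - exact: mu.
  - exact: mm.
  - exact: u0.
  - apply: aeW => xi; apply: cvgM; [exact: cvg_chord_quotient|exact: cvg_cst].
  - by move=> k; rewrite -E; apply: ereal_sup_ubound; exists k.
apply/ereal_supP => _ [k _ <-]; rewrite E; apply: ge0_le_integral => //.
- by move=> xi _; rewrite lee_fin.
- exact/measurable_EFinP.
- exact/measurable_EFinP.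
- move=> xi _; rewrite lee_fin ler_wpM2r ?sqr_ge0//.
  apply: le_trans (ler_wpM2l (sqr_ge0 _) (chord_le _)) _.
  by rewrite sqr_rescale.
Qed.

End dispersion.

(** * The wavelet transform *)

Section coordinate_hyperplanes.
Context {R : realType}.
Implicit Types n : nat.

Lemma measurable_absp n : measurable_fun setT (@absp R n).
Proof.
apply: measurableT_comp => //; apply: measurable_prod => i _; exact: measurable_coord.
Qed.

Lemma measurable_absp_eq0 n : measurable_fun setT (fun x : Rn R n => absp x == 0).
Proof. by apply: measurable_fun_eqr => //; exact: measurable_absp. Qed.

Lemma ae_absp_neq0 n : {ae lebesgue R n, forall x, absp x != 0}.
Proof.
pose z (b : bool) : \bar R := (b%:R)%:E.
have mz d (T : measurableType d) (p : T -> bool) : measurable_fun setT p ->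
    measurable_fun setT (fun x => z (p x)).
  move=> mp; rewrite (_ : (fun x => _) = (fun x => (if p x then 1 else 0)%:E)).
    by apply/measurable_EFinP; exact: measurable_fun_ifT.
  by apply/funext => x; rewrite /z; case: (p x).
have z0 b : (0 <= z b)%E by rewrite lee_fin ler0n.
suff H : (\int[lebesgue R n]_x z (absp x == 0%R) = 0)%E.
  have [+ _] := ae_eq_integral_abs (lebesgue R n) measurableT (mz _ _ _ (@measurable_absp_eq0 n)).
  case; first by rewrite -[RHS]H; apply: eq_integral => x _; rewrite gee0_abs.
  move=> N [mN N0 sN]; exists N; split => // x /= x0; apply: sN => /= h; apply: x0.
  apply/negP => x0; have /(congr1 (@fine R)) := h I.
  by rewrite /z x0/= => /eqP; rewrite oner_eq0.
elim: n => [|n IHn].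
  rewrite -(integral0 (lebesgue R 0) setT); apply: eq_integral => x _.
  by rewrite /absp big_ord0 normr1 /z oner_eq0.
have mT : measurable_fun setT (fun p => z (absp (@tcons R n p) == 0)).
  apply: mz; apply: (measurableT_comp (@measurable_absp_eq0 n.+1)).
  exact: measurable_tcons.
rewrite ge0_integral_tcons//; last by apply: mz; exact: measurable_absp_eq0.
rewrite (@ae_eq_integral _ _ _ (@lebesgue_measure R) setT (fun=> 0%E))//.
- by rewrite integral0.
- by apply: (@measurable_fun_fubini_tonelli_F _ _ _ _ _ (lebesgue R n)
    (fun p => z (absp (@tcons R n p) == 0))).
exists [set 0]; split => //; first exact: lebesgue_measure_set1.
move=> x /= xn0; apply: contrapT => x0; apply: xn0 => _.
rewrite -[RHS]IHn; apply: eq_integral => y _; congr z.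
by rewrite absp_tcons/= mulf_eq0 normr_eq0 (introF eqP x0).
Qed.

(** The weights occurring below are inverse powers of [|a|_p], which are 0 when
    [|a|_p = 0]. *)
Lemma integral_R0 n (F : Rn R n -> \bar R) : (forall a, absp a = 0 -> F a = 0%E) ->
  (\int[lebesgue R n]_(a in R0 R n) F a = \int[lebesgue R n]_a F a)%E.
Proof.
move=> F0; rewrite integral_mkcond; apply: eq_integral => a _.
rewrite patchE; case: ifPn => // /negP aR0; rewrite F0//.
by apply/eqP/negPn/negP => a0; apply: aR0; rewrite inE.
Qed.

End coordinate_hyperplanes.

Section daughter.
Context {R : realType} {n : nat}.
Local Notation mun := (lebesgue R n).
Local Notation V := (Rn R n).
Local Notation L2 := (L2 mun).
Local Notation l2 := (l2 mun).
Local Notation ip := (ip mun).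
Implicit Types (f g psi A Psi : V -> R[i]) (a b t xi : V) (alpha : R).

Definition invv a : V := [tuple ((tnth a i : R))^-1 | i < n].
Definition divNv b a : V := [tuple - ((tnth b i : R) / (tnth a i : R)) | i < n].

Lemma divv_aff t b a : divv (subv t b) a = aff (invv a) (divNv b a) t.
Proof.
apply: eq_from_tnth => i; rewrite tnth_aff !tnth_mktuple mulrBl [in RHS]mulrC //.
Qed.

Lemma absp_neq0P a : absp a != 0 -> forall i, (tnth a i : R) != 0.
Proof. by rewrite normr_eq0 => /prodf_neq0 h i; exact: h. Qed.

Lemma absp_invv a : absp (invv a) = (absp a)^-1.
Proof.
rewrite /absp -normfV -prodfV; congr `|_|.
by apply: eq_bigr => i _; rewrite tnth_mktuple.
Qed.

Lemma dotp_scale_divv a b t xi : absp a != 0 ->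
  dotp (divv (subv t b) a) (aff a (zerov) xi) = dotp t xi - dotp b xi.
Proof.
move=> /absp_neq0P a0; rewrite /dotp -sumrB; apply: eq_bigr => i _.
by rewrite tnth_aff !tnth_mktuple; have := a0 i => ai; field.
Qed.

(** The chirps in the definition of the daughter wavelets are exactly those for
    which dilation and translation respect the kernel, up to phases. *)
Lemma frel_daughter alpha psi Psi a b : sin alpha != 0 -> absp a != 0 ->
  frel alpha (fun t => expi (- (enorm t ^+ 2 / 2 * cot alpha)) * psi t) Psi ->
  frel alpha (daughter alpha psi a b)
    (fun xi => (Num.sqrt (absp a))%:C *
      expi ((enorm b ^+ 2 + enorm xi ^+ 2 - enorm (aff a zerov xi) ^+ 2) / 2 * cot alpha -
        dotp b xi * csc alpha) * Psi (aff a zerov xi)).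
Proof.
move=> s0 a0 h.
pose p t : R := (enorm (divv (subv t b) a) ^+ 2 - enorm t ^+ 2 + enorm b ^+ 2) / 2 * cot alpha.
pose q xi : R := (enorm b ^+ 2 + enorm xi ^+ 2 - enorm (aff a zerov xi) ^+ 2) / 2 * cot alpha -
        dotp b xi * csc alpha.
have aa : absp (invv a) * absp a = 1 by rewrite absp_invv mulVf.
have maf (u v : V) : measurable_fun setT (fun t : V => aff u v t).
  by apply: measurable_aff => //; exact: measurable_cst.
have mp : measurable_fun setT p.
  apply: measurable_funM => //; apply: measurable_funM => //; apply: measurable_funD => //.
  apply: measurable_funB; last exact: measurable_enorm2.
  by under eq_fun do rewrite divv_aff; exact: measurable_enorm2.
have mq : measurable_fun setT q.
  apply: measurable_funB; apply: measurable_funM => //.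
    apply: measurable_funM => //; apply: measurable_funB; last exact: measurable_enorm2.
    by apply: measurable_funD => //; exact: measurable_enorm2.
  by apply: measurable_dotp => //; exact: measurable_cst.
have := frel_phase (a := invv a) (b := divNv b a) (a' := a) (b' := zerov) s0 aa mp mq _ h.
rewrite -/q (_ : (fun t => _) = daughter alpha psi a b); last first.
  apply/funext => t; rewrite -divv_aff /daughter absp_invv sqrtrV ?absp_ge0//.
  set c := (_^-1)%:C; set y := psi _; set e1 := expi (p t); set e2 := expi _.
  transitivity (c * y * (e1 * e2)); first by ring.
  by rewrite /e1 /e2 -expiD; congr (_ * expi _); rewrite /p; field.
apply => t xi; rewrite -divv_aff dotp_scale_divv// /p /q; by field.
Qed.

End daughter.

Section wavelet_coefficients.
Context {R : realType} {n : nat}.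
Local Notation mun := (lebesgue R n).
Local Notation V := (Rn R n).
Local Notation L2 := (L2 mun).
Local Notation l2 := (l2 mun).
Local Notation ip := (ip mun).
Implicit Types (f g psi A Psi : V -> R[i]) (a b t xi : V) (alpha : R).

(** Up to the constant factor, the transform of [b |-> W f(b, a)]. *)
Definition spectrum alpha A Psi a xi : R[i] :=
  (Num.sqrt (absp a))%:C * expi (enorm (aff a zerov xi) ^+ 2 / 2 * cot alpha) *
  (A xi * cconj (Psi (aff a zerov xi))).

Lemma normc_spectrum alpha A Psi a xi :
  normc (spectrum alpha A Psi a xi) ^+ 2 =
  absp a * (normc (A xi) ^+ 2 * normc (Psi (aff a zerov xi)) ^+ 2).
Proof.
rewrite /spectrum; move: (A xi) (Psi _) (expi _) (normc_expi (enorm (aff a zerov xi) ^+ 2 / 2 * cot alpha)).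
move=> z w e e1; rewrite normcM [normc (_ * e)]normcM e1 mulr1 normcM normcJ.
by rewrite normc_real ger0_norm ?sqrtr_ge0// !exprMn sqr_sqrtr// absp_ge0.
Qed.

Lemma measurable_aff0 d (T : measurableType d) (u v : T -> V) :
  measurable_fun setT u -> measurable_fun setT v ->
  measurable_fun setT (fun p => aff (u p) (zerov) (v p)).
Proof. by move=> mu mv; apply: measurable_aff => //; exact: measurable_cst. Qed.

Lemma L2_dilate Psi a : absp a != 0 -> L2 Psi -> L2 (fun xi => Psi (aff a zerov xi)).
Proof.
move=> a0 [mP iP]; split; first exact: cmeas_aff.
move: iP; rewrite (energy_aff (zerov) a0 mP).
have : (0 <= energy mun (fun xi => Psi (aff a zerov xi)))%E := energy_ge0 _ _.
case: (energy mun (fun xi => Psi (aff a zerov xi))) => [r _ _| _ |//]; first exact: ltry.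
by rewrite gt0_muley// lte_fin lt0r a0 absp_ge0.
Qed.

Lemma cintegrable_spectrum alpha A Psi a : absp a != 0 -> L2 A -> L2 Psi ->
  cintegrable mun (spectrum alpha A Psi a).
Proof.
move=> a0 LA LP; have LPa := L2_dilate a0 LP.
have I := cintegrable_L2M LA (L2J LPa).
have E : spectrum alpha A Psi a = (fun xi => (A xi * cconj (Psi (aff a zerov xi))) *
   ((Num.sqrt (absp a))%:C * expi (enorm (aff a zerov xi) ^+ 2 / 2 * cot alpha))).
  by apply/funext => xi; rewrite /spectrum mulrC.
rewrite E; apply: (cintegrableM_bounded (sqrtr_ge0 (absp a)) I).
  apply: cmeasM; first exact: cmeas_cst.
  apply: cmeas_expi; apply: measurable_funM => //; apply: measurable_funM => //.
  by apply: measurable_enorm2; apply: measurable_aff0.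
by move=> xi; rewrite normcM normc_expi mulr1 normc_real ger0_norm ?sqrtr_ge0.
Qed.

(** Parseval, and the kernel of angle [- alpha] is the conjugate kernel. *)
Lemma cfrwtE alpha psi Psi f A a b : sin alpha != 0 -> absp a != 0 ->
  frel alpha (fun t => expi (- (enorm t ^+ 2 / 2 * cot alpha)) * psi t) Psi ->
  frel alpha f A ->
  cfrwt alpha psi f b a =
  (cconj (frft_const n alpha))^-1 * frft_L1 (- alpha) (spectrum alpha A Psi a) b.
Proof.
move=> s0 a0 hP hA; have hd := frel_daughter b s0 a0 hP.
have [_ LA _] := hA; have [_ LP _] := hP.
rewrite (_ : cfrwt _ _ _ _ _ = ip f (daughter alpha psi a b)); last by [].
rewrite -(frel_parseval s0 hA hd) frft_L1E -cintZl; last first.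
  by apply: cintegrable_frft_integrand; exact: cintegrable_spectrum.
have C0 : cconj (frft_const n alpha) != 0.
  by rewrite -normc_eq0 normcJ gt_eqF// normc_frft_const_gt0.
apply: eq_cint => xi; rewrite frft_kernelN /frft_kernel /spectrum.
move: (frft_const n alpha) C0 => C C0; rewrite !conjM !conj_expi conj_real.
set q := _ - dotp b xi * _; set k := _ - _ * csc alpha; set w := _ / 2 * cot alpha.
have E : expi (- q) = expi w * expi (- k).
  by rewrite -expiD; congr expi; rewrite /q /k /w; field.
rewrite E; move: (cconj C) C0 (expi w) (expi (- k)) => C' C0.
move: (cconj _) (A xi) (_%:C) => x y z u v.
by field.
Qed.

Lemma energy_cfrwt alpha psi Psi f A a : sin alpha != 0 -> absp a != 0 ->
  frel alpha (fun t => expi (- (enorm t ^+ 2 / 2 * cot alpha)) * psi t) Psi ->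
  frel alpha f A ->
  energy mun (fun b => cfrwt alpha psi f b a) =
  ((normc (frft_const n alpha) ^- 2)%:E * energy mun (spectrum alpha A Psi a))%E.
Proof.
move=> s0 a0 hP hA; have [_ LA _] := hA; have [_ LP _] := hP.
have I := cintegrable_spectrum alpha a0 LA LP.
rewrite -(frft_L1_energy (sinN_neq0 s0) I).
rewrite -(exprVn (normc _)) -normcJ -normcV -energyZ; last by apply: cmeas_frft_L1; exact: I.1.
by apply: eq_energy => b; rewrite (cfrwtE _ s0 a0 hP hA).
Qed.

Lemma frel_cfrwt alpha psi Psi f A a : sin alpha != 0 -> absp a != 0 ->
  frel alpha (fun t => expi (- (enorm t ^+ 2 / 2 * cot alpha)) * psi t) Psi ->
  frel alpha f A -> (energy mun (spectrum alpha A Psi a) < +oo)%E ->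
  frel alpha (fun b => cfrwt alpha psi f b a)
    (fun xi => (cconj (frft_const n alpha))^-1 * spectrum alpha A Psi a xi).
Proof.
move=> s0 a0 hP hA iS; have [_ LA _] := hA; have [_ LP _] := hP.
have I := cintegrable_spectrum alpha a0 LA LP.
have H : L12 (spectrum alpha A Psi a) by split => //; split => //; exact: I.1.
rewrite (_ : (fun b => _) = (fun b => (cconj (frft_const n alpha))^-1 *
   frft_L1 (- alpha) (spectrum alpha A Psi a) b)); last first.
  by apply/funext => b; rewrite (cfrwtE _ s0 a0 hP hA).
exact: (frelZ _ s0 (frel_inversion s0 (frel_L1 (sinN_neq0 s0) H))).
Qed.

Definition admissibility Psi : \bar R :=
  (\int[mun]_u (normc (Psi u) ^+ 2 / absp u)%:E)%E.

Lemma admissibility_ge0 Psi : (0 <= admissibility Psi)%E.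
Proof. by apply: integral_ge0 => u _; rewrite lee_fin divr_ge0 ?sqr_ge0// absp_ge0. Qed.

Lemma measurable_admissibility Psi : cmeas Psi ->
  measurable_fun setT (fun u => (normc (Psi u) ^+ 2 / absp u)%:E).
Proof.
move=> mP; apply/measurable_EFinP; apply: measurable_div; first exact: measurable_normc2.
exact: measurable_absp.
Qed.

(** Dilations preserve [du / |u|_p]. *)
Lemma admissibility_dilate Psi xi : absp xi != 0 -> cmeas Psi ->
  admissibility Psi =
  (\int[mun]_a (normc (Psi (aff a zerov xi)) ^+ 2 / absp a)%:E)%E.
Proof.
move=> x0 mP; have x1 : 0 < absp xi by rewrite lt0r x0 absp_ge0.
have mq := measurable_admissibility mP.
rewrite /admissibility (ge0_integral_aff (zerov) x0 mq); last first.
  by move=> u; rewrite lee_fin divr_ge0 ?sqr_ge0// absp_ge0.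
rewrite -ge0_integralZl_EFin ?absp_ge0//; last 2 first.
- by move=> u _; rewrite lee_fin divr_ge0 ?sqr_ge0// absp_ge0.
- by apply: (measurableT_comp mq); exact: measurable_aff0.
apply: eq_integral => a _; rewrite -EFinM; congr EFin.
have -> : aff xi zerov a = aff a zerov xi.
  by apply: eq_from_tnth => i; rewrite !tnth_aff mulrC.
have -> : absp (aff a zerov xi) = absp a * absp xi.
  rewrite /absp -normrM -big_split/=; congr `|_|; apply: eq_bigr => i _.
  by rewrite tnth_aff tnth_mktuple addr0.
by rewrite invfM; move: (normc _ ^+ 2) (absp a)^-1 => x y; field.
Qed.

(** Tonelli: each frequency contributes the admissibility constant. *)
Lemma integral_spectrum alpha A Psi (w : V -> R) : cmeas A -> cmeas Psi ->
  measurable_fun setT w -> (forall xi, 0 <= w xi) ->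
  (\int[mun]_a ((\int[mun]_xi (w xi * normc (spectrum alpha A Psi a xi) ^+ 2)%:E) *
     (absp a ^- 2)%:E) =
   admissibility Psi * \int[mun]_xi (w xi * normc (A xi) ^+ 2)%:E)%E.
Proof.
move=> mA mP mw w0.
pose F (p : V * V) : R := w p.2 * normc (A p.2) ^+ 2 * (normc (Psi (aff p.1 zerov p.2)) ^+ 2 / absp p.1).
have mF : measurable_fun setT F.
  apply: measurable_funM; first apply: measurable_funM.
  - exact: measurableT_comp.
  - by apply: (measurableT_comp (measurable_normc2 mA)).
  apply: measurable_div; last exact: (measurableT_comp (@measurable_absp R n)).
  by apply: (measurableT_comp (measurable_normc2 mP)); exact: measurable_aff0.
have F0 p : 0 <= F p.
  apply: mulr_ge0; first by rewrite mulr_ge0// sqr_ge0.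
  by rewrite divr_ge0 ?sqr_ge0// absp_ge0.
transitivity (\int[mun]_a \int[mun]_xi (F (a, xi))%:E)%E.
  apply: eq_integral => a _; rewrite muleC -ge0_integralZl_EFin ?invr_ge0 ?sqr_ge0//.
  - apply: eq_integral => xi _; rewrite -EFinM; congr EFin.
    rewrite normc_spectrum /F/=.
    have [->|a0] := eqVneq (absp a) 0; first by rewrite invr0 expr0n invr0 !(mul0r, mulr0).
    by field.
  - by move=> xi _; rewrite lee_fin mulr_ge0// sqr_ge0.
  - apply/measurable_EFinP; apply: measurable_funM => //.
    rewrite (_ : (fun xi => _) = (fun xi => absp a * (normc (A xi) ^+ 2 * normc (Psi (aff a zerov xi)) ^+ 2))).
      apply: measurable_funM => //; apply: measurable_funM; first exact: measurable_normc2.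
      by apply: (measurableT_comp (measurable_normc2 mP)); exact: measurable_aff0.
    by apply/funext => xi; rewrite normc_spectrum.
rewrite (@tonelli _ _ _ _ R mun mun (fun p => (F p)%:E)); last 2 first.
- exact/measurable_EFinP.
- by move=> p; rewrite lee_fin.
rewrite -ge0_integralZl ?admissibility_ge0//; last 2 first.
- apply/measurable_EFinP; apply: measurable_funM => //; exact: measurable_normc2.
- by move=> xi _; rewrite lee_fin mulr_ge0// sqr_ge0.
apply: ae_eq_integral => //.
- apply: (@measurable_fun_fubini_tonelli_F _ _ _ _ _ mun (fun p => (F (p.2, p.1))%:E)).
  - by apply/measurable_EFinP; apply: (measurableT_comp mF); exact: measurable_fun_pair.
  - by move=> p; rewrite lee_fin.
- apply: emeasurable_funM => //; apply/measurable_EFinP; apply: measurable_funM => //.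
  exact: measurable_normc2.
have := @ae_absp_neq0 R n; apply: filterS => xi x0 _.
rewrite (admissibility_dilate x0 mP) muleC -ge0_integralZl_EFin ?mulr_ge0 ?normc_ge0//.
- by move=> a _; rewrite lee_fin divr_ge0 ?sqr_ge0// absp_ge0.
- apply/measurable_EFinP; apply: measurable_div; last exact: measurable_absp.
  by apply: (measurableT_comp (measurable_normc2 mP)); exact: measurable_aff0.
Qed.

End wavelet_coefficients.

(** The integral of a nonnegative function, measurable or not, is the supremum of
    the integrals of the simple functions below it. *)
Lemma ge0_le_integral_any d (T : measurableType d) (R : realType)
    (mu : {measure set T -> \bar R}) (D : set T) (f g : T -> \bar R) :
  (forall x, D x -> 0 <= f x)%E -> (forall x, 0 <= g x)%E ->
  (forall x, D x -> f x <= g x)%E ->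
  (\int[mu]_(x in D) f x <= \int[mu]_x g x)%E.
Proof.
move=> f0 g0 fg; rewrite ge0_integralE// ge0_integralTE//.
apply: le_ereal_sup => _ /= [h hf <-]; exists h => // x.
apply: le_trans (hf x) _; rewrite patchE; case: ifPn => // /set_mem; exact: fg.
Qed.

Section zero_dispersion.
Context {R : realType} {n : nat}.
Local Notation mun := (lebesgue R n).
Local Notation V := (Rn R n).

Lemma enorm_neq0 (xi : V) : (0 < n)%N -> absp xi != 0 -> enorm xi ^+ 2 != 0.
Proof.
move=> n0 /absp_neq0P x0; rewrite enorm2 psumr_neq0; last by move=> i _; exact: sqr_ge0.
apply/hasP; exists (Ordinal n0); first by rewrite mem_index_enum.
by rewrite /= exprn_even_gt0//= x0.
Qed.

(** [enorm] vanishes on a null set only. *)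
Lemma dispersion_eq0 (B : V -> R[i]) : (0 < n)%N -> cmeas B ->
  dispersion B = 0%E -> energy mun B = 0%E.
Proof.
move=> n0 mB B0; have [+ _] := ae_eq_integral_abs mun measurableT (measurable_dispersion mB).
case.
  rewrite -[RHS]B0; apply: eq_integral => xi _.
  by rewrite gee0_abs// lee_fin mulr_ge0// sqr_ge0.
move=> N [mN N0 sN]; rewrite -(integral0 mun setT).
apply: ae_eq_integral => //; first exact: measurable_energy.
have H : {ae mun, forall xi : V, (enorm xi ^+ 2 * normc (B xi) ^+ 2)%:E = 0%E}.
  exists N; split => // xi /= h; apply: sN => /= h'; apply: h; exact: h' I.
have := @ae_absp_neq0 R n; apply: filterS2 H => xi + x0 _ => /(congr1 (@fine R))/= /eqP.
by rewrite mulf_eq0 (negbTE (enorm_neq0 n0 x0))/= => /eqP ->.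
Qed.

End zero_dispersion.

Section joint_measurability.
Context {R : realType} {n : nat}.
Local Notation mun := (lebesgue R n).
Local Notation V := (Rn R n).
Implicit Types (f psi : V -> R[i]) (alpha beta : R).

Lemma measurable_energy_param (F : V * V -> R[i]) : cmeas F ->
  measurable_fun setT (fun a => energy mun (fun t => F (a, t))).
Proof.
move=> mF; apply: (@measurable_fun_fubini_tonelli_F _ _ _ _ _ mun
  (fun p => (normc (F p) ^+ 2)%:E)).
- exact: measurable_energy.
- by move=> p; rewrite lee_fin sqr_ge0.
Qed.

Lemma measurable_sqrt_absp d (T : measurableType d) (u : T -> V) :
  measurable_fun setT u -> measurable_fun setT (fun p => (Num.sqrt (absp (u p)))^-1).
Proof.
move=> mu; apply: (measurableT_comp (@measurable_invr R)).
under eq_fun do rewrite -powR12_sqrt ?absp_ge0//.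
by apply: (measurableT_comp (measurable_powR _)); exact: (measurableT_comp (@measurable_absp R n)).
Qed.

Lemma cmeas_cfrwt alpha psi f : cmeas psi -> cmeas f ->
  cmeas (fun p : V * V => cfrwt alpha psi f p.2 p.1).
Proof.
move=> mpsi mf; pose F (q : (V * V) * V) := f q.2 * cconj (daughter alpha psi q.1.1 q.1.2 q.2).
have m1 : measurable_fun setT (fun q : (V * V) * V => q.1.1) by exact: measurableT_comp.
have m2 : measurable_fun setT (fun q : (V * V) * V => q.1.2) by exact: measurableT_comp.
have mF : cmeas F.
  apply: cmeasM; first by apply: cmeas_comp mf.
  apply: cmeasJ; apply: cmeasM; first apply: cmeasM.
  - by apply: cmeas_real; exact: measurable_sqrt_absp.
  - apply: cmeas_comp mpsi; apply: measurable_tuple_of => i.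
    apply: measurable_div; last exact: measurable_coord.
    under eq_fun do rewrite tnth_mktuple.
    by apply: measurable_funB; exact: measurable_coord.
  - apply: cmeas_expi; apply: measurableT_comp => //; apply: measurable_funM => //.
    apply: measurable_funM => //; apply: measurable_funB; exact: measurable_enorm2.
exact: (cmeas_param mun mF).
Qed.

Lemma measurable_difference_quotient j beta k (G : V * V -> R[i]) : cmeas G ->
  measurable_fun setT (fun a => difference_quotient j beta (fun t => G (a, t)) k).
Proof.
move=> mG; apply: emeasurable_funM => //.
apply: (@measurable_energy_param (fun p =>
  phase_shift j beta k.+1%:R^-1 (fun t => G (p.1, t)) p.2 - G p)%R) => //.
apply: cmeasB => //; apply: cmeasM.
  apply: cmeas_expi; apply: measurable_funD => //; apply: measurable_funM => //.
  exact: measurable_coord.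
apply: (cmeas_comp (h := fun p : V * V => (p.1, translate j (k.+1%:R^-1 * sin beta) p.2)) _ mG).
apply: measurable_fun_pair => //; apply: measurableT_comp => //; exact: measurable_translate.
Qed.

End joint_measurability.

Section wavelet_transform.
Context {R : realType} {n : nat}.
Local Notation mun := (lebesgue R n).
Local Notation V := (Rn R n).
Local Notation L2 := (L2 mun).
Local Notation l2 := (l2 mun).
Variables (alpha : R) (psi : V -> R[i]).
Hypothesis sa : sin alpha != 0.
Hypothesis Lpsi : L2 psi.

Definition chirped : V -> R[i] := fun t => expi (- (enorm t ^+ 2 / 2 * cot alpha)) * psi t.
Local Notation Psi := (frft alpha chirped).
Local Notation C := (frft_const n alpha).

Lemma frel_chirped : frel alpha chirped Psi.
Proof.
apply: (frel_frft sa); apply: (L2_modulus _ _ Lpsi).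
  apply: cmeasM; last exact: Lpsi.1.
  apply: cmeas_expi; apply: measurableT_comp => //; apply: measurable_funM => //.
  by apply: measurable_funM => //; exact: measurable_enorm2.
by move=> t; rewrite /chirped normcM normc_expi mul1r.
Qed.

Lemma L2_Psi : L2 Psi. Proof. by case: frel_chirped. Qed.

Lemma frwt_constE : frwt_const alpha psi = admissibility Psi.
Proof.
rewrite /frwt_const integral_R0//.
by move=> a a0; rewrite a0 invr0 mulr0.
Qed.

Let C0 : 0 < normc C ^+ 2.
Proof. by rewrite exprn_gt0// normc_frft_const_gt0. Qed.

Lemma absp0_weight (a : V) : absp a = 0 -> absp a ^- 2 = 0 :> R.
Proof. by move=> ->; rewrite expr0n invr0. Qed.

Lemma weight_congr (a : V) (x y : \bar R) : (absp a != 0 -> x = y) ->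
  (x * (absp a ^- 2)%:E = y * (absp a ^- 2)%:E)%E.
Proof.
have [a0 _|a0 ->//] := eqVneq (absp a) 0.
by rewrite (absp0_weight a0) !mule0.
Qed.

Lemma measurable_weight : measurable_fun setT (fun a : V => (absp a ^- 2)%:E).
Proof.
apply/measurable_EFinP; apply: (measurableT_comp (@measurable_invr R)).
by apply: measurable_funX; exact: measurable_absp.
Qed.

Lemma measurable_spectrum f (w : V -> R) : L2 f -> measurable_fun setT w ->
  (forall xi, 0 <= w xi) ->
  measurable_fun setT (fun a => \int[mun]_xi
    (w xi * normc (spectrum alpha (frft alpha f) Psi a xi) ^+ 2)%:E)%E.
Proof.
move=> Lf mw w0; have [_ LA _] := frel_frft sa Lf.
rewrite (_ : (fun a => _) = (fun a => \int[mun]_xi (w xi * (absp a *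
   (normc (frft alpha f xi) ^+ 2 * normc (Psi (aff a zerov xi)) ^+ 2)))%:E)%E); last first.
  by apply/funext => a; apply: eq_integral => xi _; rewrite normc_spectrum.
apply: (@measurable_fun_fubini_tonelli_F _ _ _ _ _ mun (fun p : V * V =>
  (w p.2 * (absp p.1 * (normc (frft alpha f p.2) ^+ 2 *
     normc (Psi (aff p.1 zerov p.2)) ^+ 2)))%:E)).
  apply/measurable_EFinP; apply: measurable_funM; first exact: measurableT_comp.
  apply: measurable_funM; first exact: (measurableT_comp (@measurable_absp R n)).
  apply: measurable_funM; first by apply: (measurableT_comp (measurable_normc2 LA.1)).
  by apply: (measurableT_comp (measurable_normc2 L2_Psi.1)); exact: measurable_aff0.
move=> p; rewrite lee_fin mulr_ge0// mulr_ge0 ?absp_ge0//.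
by rewrite mulr_ge0 ?sqr_ge0.
Qed.

Lemma measurable_spectrum_energy f : L2 f ->
  measurable_fun setT (fun a => energy mun (spectrum alpha (frft alpha f) Psi a)).
Proof.
move=> Lf; have := measurable_spectrum Lf (@measurable_cst _ _ V R setT 1) (fun=> ler01).
congr measurable_fun; apply/funext => a; apply: eq_integral => xi _.
by rewrite mul1r.
Qed.

(** Up to normalisation the wavelet transform is isometric: Plancherel in [b],
    then [integral_spectrum] with weight 1. *)
Lemma wavelet_energy f : L2 f ->
  (\int[mun]_a (energy mun (fun b => cfrwt alpha psi f b a) * (absp a ^- 2)%:E) =
   (normc C ^- 2)%:E * (admissibility Psi * energy mun f))%E.
Proof.
move=> Lf; have fA := frel_frft sa Lf; have [_ LA _] := fA.
have mS : measurable_fun setT (fun a => energy mun (spectrum alpha (frft alpha f) Psi a) *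
    (absp a ^- 2)%:E)%E.
  by apply: emeasurable_funM; [exact: measurable_spectrum_energy|exact: measurable_weight].
transitivity (\int[mun]_a ((normc C ^- 2)%:E *
    (energy mun (spectrum alpha (frft alpha f) Psi a) * (absp a ^- 2)%:E)))%E.
  apply: eq_integral => a _; rewrite muleA; apply: weight_congr => a0.
  exact: (energy_cfrwt sa a0 frel_chirped fA).
rewrite ge0_integralZl_EFin ?invr_ge0 ?(ltW C0)//; last first.
  by move=> a _; rewrite mule_ge0 ?energy_ge0// lee_fin invr_ge0 sqr_ge0.
congr (_ * _)%E.
have := integral_spectrum alpha LA.1 L2_Psi.1 (@measurable_cst _ _ V R setT 1) (fun=> ler01).
rewrite -(l2_sqr Lf) -(frel_l2 sa fA) (l2_sqr LA) => E.
transitivity (\int[mun]_a ((\int[mun]_xi (1 * normc (spectrum alpha (frft alpha f) Psi a xi) ^+ 2)%:E) *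
     (absp a ^- 2)%:E))%E.
  by apply: eq_integral => a _; congr (_ * _)%E; apply: eq_integral => xi _; rewrite mul1r.
by rewrite E; congr (_ * _)%E; apply: eq_integral => xi _; rewrite mul1r.
Qed.

(** The wavelet condition says that the energy of the wavelet transform of [psi]
    itself is finite; by [wavelet_energy] it is a positive multiple of the
    admissibility constant. *)
Lemma admissibility_lty : cLnorm 2%:E psi != 0%E ->
  (\int[mun]_(a in R0 R n)
        ((\int[mun]_b ((normc (inner (daughter alpha psi a b) psi)) ^+ 2)%:E) *
         ((absp a) ^- 2)%:E) < +oo)%E -> (admissibility Psi < +oo)%E.
Proof.
move=> psi0; rewrite integral_R0; last by move=> a a0; rewrite absp0_weight// mule0.
rewrite (_ : (\int[mun]_a _)%E = (\int[mun]_a (energy mun (fun b => cfrwt alpha psi psi b a) *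
   (absp a ^- 2)%:E))%E); last first.
  apply: eq_integral => a _; apply: weight_congr => a0; apply: eq_integral => b _.
  have [Ld _ _] := frel_daughter b sa a0 frel_chirped.
  by rewrite -[in RHS]normcJ -(ipC Lpsi Ld).
rewrite (wavelet_energy Lpsi) -(l2_sqr Lpsi).
rewrite (cLnorm2 Lpsi) in psi0.
have l0 : 0 < l2 psi ^+ 2 by rewrite exprn_gt0// lt0r l2_ge0 andbT; apply: contraNneq psi0 => ->.
have := admissibility_ge0 Psi.
case: (admissibility Psi) => [r _ _| _|//]; first exact: ltry.
by rewrite gt0_mulye ?lte_fin// gt0_muley ?lte_fin// invr_gt0.
Qed.

Variables (beta : R) (f : V -> R[i]).
Hypothesis sb : sin beta != 0.
Hypothesis Lf : L2 f.
Hypothesis adm : (admissibility Psi < +oo)%E.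

Local Notation W a := (fun b => cfrwt alpha psi f b a).
Local Notation A := (frft alpha f).

Lemma dispersion_spectrumE a :
  dispersion (fun xi => (cconj C)^-1 * spectrum alpha A Psi a xi)%R =
  (\int[mun]_xi (normc C ^- 2 * enorm xi ^+ 2 *
     normc (spectrum alpha A Psi a xi) ^+ 2)%:E)%E.
Proof.
apply: eq_integral => xi _; rewrite normcM exprMn normcV normcJ exprVn.
by rewrite mulrCA mulrA.
Qed.

Let mwt : measurable_fun setT (fun xi : V => normc C ^- 2 * enorm xi ^+ 2).
Proof. by apply: measurable_funM => //; exact: measurable_enorm2. Qed.

Let wt0 (xi : V) : 0 <= normc C ^- 2 * enorm xi ^+ 2.
Proof. by rewrite mulr_ge0 ?sqr_ge0// invr_ge0 ltW. Qed.

Lemma dispersion_spectrum :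
  (\int[mun]_a (dispersion (fun xi => (cconj C)^-1 * spectrum alpha A Psi a xi)%R *
     (absp a ^- 2)%:E) =
   (normc C ^- 2)%:E * (admissibility Psi * dispersion A))%E.
Proof.
have [_ LA _] := frel_frft sa Lf.
have := integral_spectrum alpha LA.1 L2_Psi.1 mwt wt0.
rewrite (_ : (\int[mun]_xi (normc C ^- 2 * enorm xi ^+ 2 * normc (A xi) ^+ 2)%:E)%E =
  ((normc C ^- 2)%:E * dispersion A)%E); last first.
  rewrite -ge0_integralZl_EFin ?invr_ge0 ?(ltW C0)//.
  - by apply: eq_integral => xi _; rewrite -mulrA.
  - by move=> xi _; rewrite lee_fin mulr_ge0 ?sqr_ge0.
  - exact: measurable_dispersion LA.1.
rewrite muleCA => <-; apply: eq_integral => a _.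
by rewrite dispersion_spectrumE.
Qed.

(** The scales at which [b |-> W f (b, a)] is square-integrable. *)
Definition good_scales : set V :=
  [set a | absp a != 0 /\ (energy mun (spectrum alpha A Psi a) < +oo)%E].

Lemma measurable_good_scales : measurable good_scales.
Proof.
have -> : good_scales = [set a | absp a != 0] `&`
    [set a | (energy mun (spectrum alpha A Psi a) < +oo)%E] by [].
apply: measurableI.
  rewrite (_ : [set a | _] = setT `&` (fun a : V => absp a == 0) @^-1` [set false]).
    exact: (@measurable_absp_eq0 R n measurableT).
  by rewrite setTI; apply/seteqP; split => a /=; [move/negbTE|move=> ->].
have := emeasurable_fun_infty_o measurableT (measurable_spectrum_energy Lf) +oo%E.
by rewrite setTI.
Qed.

Lemma good_frel a : good_scales a ->
  frel alpha (W a) (fun xi => (cconj C)^-1 * spectrum alpha A Psi a xi).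
Proof.
move=> [a0 ai]; exact: (frel_cfrwt sa a0 frel_chirped (frel_frft sa Lf) ai).
Qed.

(** On good scales, the dispersion of the transform of [W f (., a)], written so
    as to be visibly measurable in [a]. *)
Definition scale_dispersion a : \bar R :=
  (\sum_(j < n) esups (difference_quotient j beta (W a)) 0%N)%E.

Lemma scale_dispersionE a : good_scales a ->
  scale_dispersion a = dispersion (frft beta (W a)).
Proof.
move=> /good_frel[LW _ _]; have WB := frel_frft sb LW; have [_ LB _] := WB.
rewrite (dispersion_sum LB.1); apply: eq_bigr => j _; exact/esym/moment_sup.
Qed.

Lemma measurable_scale_dispersion : measurable_fun setT scale_dispersion.
Proof.
apply: emeasurable_sum => j; apply: measurable_fun_esups => k.
apply: (@measurable_difference_quotient _ _ j beta k
  (fun p => cfrwt alpha psi f p.2 p.1)).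
exact: (cmeas_cfrwt alpha Lpsi.1 Lf.1).
Qed.

Local Notation E a := (energy mun (W a) * (absp a ^- 2)%:E)%E.

Lemma measurable_wavelet_energy : measurable_fun setT (fun a => E a).
Proof.
apply: emeasurable_funM; last exact: measurable_weight.
apply: (@measurable_energy_param _ _ (fun p => cfrwt alpha psi f p.2 p.1)).
exact: (cmeas_cfrwt alpha Lpsi.1 Lf.1).
Qed.

Lemma weight_ge0 (a : V) : (0 <= (absp a ^- 2)%:E)%E.
Proof. by rewrite lee_fin invr_ge0 sqr_ge0. Qed.

(** The total energy is finite, so almost every scale with [|a|_p != 0] is good. *)
Lemma good_wavelet_energy :
  (\int[mun]_(a in good_scales) E a = \int[mun]_a E a)%E.
Proof.
have Efin : (\int[mun]_a E a < +oo)%E.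
  rewrite (wavelet_energy Lf) -(l2_sqr Lf) lte_mul_pinfty ?lee_fin ?invr_ge0 ?(ltW C0)//.
  by rewrite lte_mul_pinfty ?admissibility_ge0// ?ge0_fin_numE ?admissibility_ge0// ltry.
have E0 a : (0 <= E a)%E by rewrite mule_ge0 ?energy_ge0// weight_ge0.
have h := ae_lty measurable_wavelet_energy E0 Efin.
rewrite integral_mkcond; apply: ae_eq_integral => //.
- apply/(measurable_restrictT _ measurable_good_scales).
  exact: measurable_funTS measurable_wavelet_energy.
- exact: measurable_wavelet_energy.
apply: filterS h => a Ea _; rewrite patchE; case: ifPn => // /negP aD.
have [a0|a0] := eqVneq (absp a) 0.
  by move: Ea; rewrite [(absp a ^- 2)%R](absp0_weight a0) mule0.
exfalso; apply: aD; rewrite inE; split => //.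
move: Ea; rewrite (energy_cfrwt sa a0 frel_chirped (frel_frft sa Lf)).
have : (0 <= energy mun (spectrum alpha A Psi a))%E := energy_ge0 _ _.
case: (energy mun (spectrum alpha A Psi a)) => [r _ _| _ |//]; first exact: ltry.
have w0 : 0 < absp a ^- 2 by rewrite invr_gt0 exprn_even_gt0.
by rewrite gt0_muley ?lte_fin ?invr_gt0// gt0_mulye ?lte_fin.
Qed.

Local Notation P := (\int[mun]_(a in good_scales) (scale_dispersion a * (absp a ^- 2)%:E))%E.

(** [uncertainty_sum] for [W f (., a)], whose transform of angle [alpha] is the
    spectrum, integrated against [da / |a|_p^2]. *)
Lemma integrated_uncertainty (l : R) : 0 <= l ->
  ((l * n%:R * `|sin (alpha - beta)|)%:E *
     ((normc C ^- 2)%:E * (admissibility Psi * energy mun f)) <=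
   P + (l ^+ 2)%:E * ((normc C ^- 2)%:E * (admissibility Psi * dispersion A)))%E.
Proof.
move=> l0; rewrite -(wavelet_energy Lf) -good_wavelet_energy -dispersion_spectrum.
set s := `|sin _|; have s0 : 0 <= s := normr_ge0 _.
have mD := measurable_good_scales.
pose F a := (dispersion (fun xi => (cconj C)^-1 * spectrum alpha A Psi a xi)%R *
  (absp a ^- 2)%:E)%E.
have F0 a : (0 <= F a)%E by rewrite mule_ge0 ?dispersion_ge0// weight_ge0.
have mF : measurable_fun setT F.
  apply: emeasurable_funM; last exact: measurable_weight.
  under eq_fun do rewrite dispersion_spectrumE.
  exact: measurable_spectrum Lf mwt wt0.
pose G a := (scale_dispersion a * (absp a ^- 2)%:E)%E.
have mG : measurable_fun setT G.
  by apply: emeasurable_funM; [exact: measurable_scale_dispersion|exact: measurable_weight].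
have G0 a : good_scales a -> (0 <= G a)%E.
  by move=> /scale_dispersionE h; rewrite /G h mule_ge0 ?dispersion_ge0// weight_ge0.
have E0 a : (0 <= E a)%E by rewrite mule_ge0 ?energy_ge0// weight_ge0.
apply: (@le_trans _ _ (P + (l ^+ 2)%:E * \int[mun]_(a in good_scales) F a)%E); last first.
  apply: leeD2l; apply: lee_wpmul2l; first by rewrite lee_fin sqr_ge0.
  exact: ge0_le_integral_any.
rewrite -ge0_integralZl_EFin ?mulr_ge0//; last exact: measurable_funTS measurable_wavelet_energy.
rewrite -[X in (_ <= _ + X)%E]ge0_integralZl_EFin ?sqr_ge0//; last exact: measurable_funTS mF.
rewrite -ge0_integralD//; last 3 first.
- exact: measurable_funTS mG.
- by move=> a _; rewrite mule_ge0// lee_fin sqr_ge0.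
- by apply: emeasurable_funM => //; exact: measurable_funTS.
apply: ge0_le_integral => //.
- by move=> a _; rewrite mule_ge0// lee_fin !mulr_ge0.
- by apply: emeasurable_funM => //; exact: measurable_funTS measurable_wavelet_energy.
- apply: emeasurable_funD; first exact: measurable_funTS mG.
  by apply: emeasurable_funM => //; exact: measurable_funTS.
move=> a Da; have WA := good_frel Da; have [LW _ _] := WA.
have := uncertainty_sum sa sb WA (frel_frft sb LW) l0.
rewrite -(scale_dispersionE Da) -/s => h.
rewrite muleA; apply: le_trans (lee_wpmul2r (weight_ge0 a) h) _.
rewrite ge0_muleDl ?mule_ge0 ?lee_fin ?sqr_ge0 ?dispersion_ge0//.
- by rewrite -muleA.
- by rewrite (scale_dispersionE Da) dispersion_ge0.
Qed.

(** A function whose transform has dispersion 0 vanishes. This settles the case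
    where the other factor of the uncertainty product is infinite. *)
Lemma scale_dispersion_eq0 : (0 < n)%N -> P = 0%E ->
  ((normc C ^- 2)%:E * (admissibility Psi * energy mun f) = 0)%E.
Proof.
move=> n0 P0; rewrite -(wavelet_energy Lf) -good_wavelet_energy.
have mD := measurable_good_scales.
have mG : measurable_fun good_scales (fun a => scale_dispersion a * (absp a ^- 2)%:E)%E.
  apply: measurable_funTS; apply: emeasurable_funM; last exact: measurable_weight.
  exact: measurable_scale_dispersion.
have [+ _] := ae_eq_integral_abs mun mD mG; case.
  rewrite -[RHS]P0; apply: eq_integral => a /set_mem Da.
  by rewrite gee0_abs// (scale_dispersionE Da) mule_ge0 ?dispersion_ge0// weight_ge0.
move=> N [mN N0 sN]; rewrite -(integral0 mun good_scales).
apply: ae_eq_integral => //.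
  exact: measurable_funTS measurable_wavelet_energy.
exists N; split => // a /= aN; apply: sN => /= h; apply: aN => Da.
have [LW _ _] := good_frel Da; have WB := frel_frft sb LW; have [_ LB _] := WB.
have := h Da => /eqP; rewrite mule_eq0 => /orP[|].
  rewrite (scale_dispersionE Da) => /eqP/(dispersion_eq0 n0 LB.1).
  by rewrite -(l2_sqr LB) (frel_l2 sb WB) (l2_sqr LW) => ->; rewrite mul0e.
have [a0 _] := Da; rewrite eqe invr_eq0 sqrf_eq0 => h0.
by rewrite h0 in a0.
Qed.

End wavelet_transform.

(** Optimisation over the free parameter [l] of a family of additive
    inequalities, in the extended reals. *)
Lemma product_of_sums (R : realType) (p q : \bar R) (m k : R) :
  (0 <= p)%E -> (0 <= q)%E -> 0 < m -> 0 < k ->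
  (p != 0)%E -> (q != 0)%E ->
  (forall l : R, 0 <= l -> ((l * m)%:E <= p + (l ^+ 2 * k)%:E * q)%E) ->
  ((m ^+ 2 / (4 * k))%:E <= p * q)%E.
Proof.
move=> p0 q0 m0 k0 pn0 qn0 H.
have pp : (0 < p)%E by rewrite lt0e pn0.
have qp : (0 < q)%E by rewrite lt0e qn0.
case: q q0 qn0 qp H => [q| |//] q0 qn0 qp H; last by rewrite gt0_muley// leey.
case: p p0 pn0 pp H => [p| |//] p0 pn0 pp H; last by rewrite gt0_mulye// leey.
rewrite !lte_fin in qp pp.
(* the value of [l] that maximises [l m - l^2 k q] *)
have l0 : 0 <= m / (2 * k * q) by rewrite divr_ge0 ?(ltW m0)// !mulr_ge0// ltW.
have := H _ l0; rewrite -EFinM -EFinD !lee_fin => h.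
have : m / (2 * k * q) * m * q <= (p + (m / (2 * k * q)) ^+ 2 * k * q) * q.
  by rewrite ler_wpM2r// ltW.
have -> : m / (2 * k * q) * m * q = m ^+ 2 / (4 * k) * 2 by field; rewrite !gt_eqF.
have -> : (p + (m / (2 * k * q)) ^+ 2 * k * q) * q = p * q + m ^+ 2 / (4 * k).
  by field; rewrite !gt_eqF.
by rewrite mulr_natr mulr2n lerD2r.
Qed.

Theorem theorem4p1 (R : realType) (n : nat) (alpha beta : R)
    (psi f : Rn R n -> R[i]) :
  (1 <= n)%N ->
  (forall k : int, alpha <> k%:~R * pi) ->
  (forall k : int, beta <> k%:~R * pi) ->
  (forall k : int, alpha - beta <> k%:~R * pi) ->
  wavelet alpha psi ->
  cLp 2%:E f ->
  ((\int[lebesgue R n]_(a in R0 R n)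
      ((\int[lebesgue R n]_t
          (enorm t ^+ 2 *
           normc (frft beta (fun b => cfrwt alpha psi f b a) t) ^+ 2)%:E) *
       (absp a ^- 2)%:E)) *
   (\int[lebesgue R n]_xi
      (enorm xi ^+ 2 * normc (frft alpha f xi) ^+ 2)%:E)
   >=
   (n%:R ^+ 2)%:E * frwt_const alpha psi / (4 * normc (frft_const n alpha) ^+ 2)%:E
   * (`|sin (alpha - beta)| ^+ 2)%:E * cLnorm 2%:E f ^+ 4)%E.
Proof.
move=> n0 /sin_neq0 sa /sin_neq0 sb /sin_neq0 sab [/cLp2E Lpsi psi0 wadm] /cLp2E Lf.
have admi := admissibility_lty sa Lpsi psi0 wadm.
have adm0 := admissibility_ge0 (frft alpha (chirped alpha psi)).
rewrite (frwt_constE alpha psi) (cLnorm2 Lf).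
have C0 : 0 < normc (frft_const n alpha) ^+ 2 by rewrite exprn_gt0// normc_frft_const_gt0.
set K := fine (admissibility (frft alpha (chirped alpha psi))).
have admE : admissibility (frft alpha (chirped alpha psi)) = K%:E.
  by rewrite fineK// ge0_fin_numE.
have K0 : 0 <= K by exact: fine_ge0.
set c := normc (frft_const n alpha) ^+ 2 in C0 *.
set s := `|sin (alpha - beta)|; have s0 : 0 < s by rewrite normr_gt0.
set N := l2 (lebesgue R n) f; have N0 : 0 <= N := l2_ge0 _ _.
have c4 : 4 * c != 0 by rewrite mulf_neq0// gt_eqF.
rewrite admE inver (negbTE c4) -EFin_expe -!EFinM.
rewrite integral_R0; last by move=> a a0; rewrite (absp0_weight a0) mule0.
rewrite -/(dispersion (frft alpha f)).
set P' := (\int[_]_a _)%E.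
set P := (\int[lebesgue R n]_(a in good_scales alpha psi f)
  (scale_dispersion alpha psi beta f a * (absp a ^- 2)%:E))%E.
(* the integrand of [P'] need not be measurable, that of [P] is *)
have PP' : (P <= P')%E.
  apply: ge0_le_integral_any => a.
  - move=> Da; rewrite (scale_dispersionE sa Lpsi sb Lf Da).
    by rewrite mule_ge0 ?dispersion_ge0// weight_ge0.
  - by rewrite mule_ge0 ?weight_ge0// (dispersion_ge0 (frft beta (fun b => cfrwt alpha psi f b a))).
  - by move=> Da; rewrite (scale_dispersionE sa Lpsi sb Lf Da).
have P0 : (0 <= P)%E.
  apply: integral_ge0 => a Da; rewrite (scale_dispersionE sa Lpsi sb Lf Da).
  by rewrite mule_ge0 ?dispersion_ge0// weight_ge0.
have Q0 := dispersion_ge0 (frft alpha f).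
apply: le_trans (lee_wpmul2r Q0 PP').
have [KN0|KN0] := eqVneq (K * N ^+ 2) 0.
  have -> : n%:R ^+ 2 * K * (4 * c)^-1 * s ^+ 2 * N ^+ 4 =
      n%:R ^+ 2 * (4 * c)^-1 * s ^+ 2 * N ^+ 2 * (K * N ^+ 2) by ring.
  by rewrite KN0 mulr0 mule_ge0.
have KN : 0 < K * N ^+ 2 by rewrite lt0r KN0 mulr_ge0 ?sqr_ge0.
have Kp : 0 < K by rewrite lt0r K0 andbT; apply: contraNneq KN0 => ->; rewrite mul0r.
have fE : energy (lebesgue R n) f = (N ^+ 2)%:E by rewrite (l2_sqr Lf).
have Pn0 : (P != 0)%E.
  apply/eqP => /(scale_dispersion_eq0 sa Lpsi sb Lf admi n0).
  rewrite admE fE -!EFinM => /(congr1 (@fine R))/= /eqP.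
  by rewrite mulf_eq0 (negbTE KN0) orbF invr_eq0 (gt_eqF C0).
have fA := frel_frft sa Lf; have [_ LA _] := fA.
have Qn0 : (dispersion (frft alpha f) != 0)%E.
  apply/eqP => /(dispersion_eq0 n0 LA.1); rewrite -(l2_sqr LA) (frel_l2 sa fA).
  move=> /(congr1 (@fine R))/= E; by rewrite E mulr0 eqxx in KN0.
have n0R : 0 < n%:R :> R by rewrite ltr0n.
have kc : 0 < K / c by rewrite divr_gt0.
have m0 : 0 < n%:R * s * (K / c * N ^+ 2).
  have Np : 0 < N ^+ 2 by rewrite -(pmulr_rgt0 _ Kp).
  by rewrite (mulr_gt0 (mulr_gt0 n0R s0) (mulr_gt0 kc Np)).
have H (l : R) : 0 <= l -> ((l * (n%:R * s * (K / c * N ^+ 2)))%:E <=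
    P + (l ^+ 2 * (K / c))%:E * dispersion (frft alpha f))%E.
  move=> l0; have := integrated_uncertainty sa Lpsi sb Lf admi l0.
  rewrite -/P -/s admE fE !muleA -!EFinM.
  by rewrite (_ : l * n%:R * s * _ * _ * _ = l * (n%:R * s * (K / c * N ^+ 2)))
    1?(_ : l ^+ 2 * _ * _ = l ^+ 2 * (K / c)) //; rewrite /c; ring.
apply: le_trans (product_of_sums P0 Q0 m0 kc Pn0 Qn0 H).
rewrite lee_fin le_eqVlt; apply/orP; left; apply/eqP.
by field; rewrite !gt_eqF.
Qed.
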